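(* Let $k:(0,\infty)\times(0,\infty)\to\mathbb{R}$ be Borel-measurable and homogeneous of degree $\beta-1$ for some $\beta\in(0,2)$ (i.e. $k(t,ts)=t^{\beta-1}k(1,s)$ for $t>0$, $s\in(0,1)$), with $k(1,\cdot)\in L^{1+\varepsilon}((0,1))$ for some $\varepsilon>0$. Let $\hat\Phi(\lambda)=\sum_{n\ge0}\hat c_n\lambda^n$ with $\hat c_0=1$, $\hat c_n=\hat c_{n-1}\int_0^1k(1,s)s^{\beta(n-1)}ds$, and suppose $x\mapsto\hat\Phi(-x)$ is completely monotone on $(0,\infty)$. Then: (i) Let $\gamma\in(\beta,2]$ and $\delta\in[\gamma,2]\setminus\{\gamma/\beta\}$. If $A_{\gamma/\delta}$ is a nonnegative random variable with Laplace transform $x\mapsto\hat\Phi(-x^{\gamma/\delta})$ and $(Y^{(\delta,0,\beta/\gamma)}_t)_{t\ge0}$ is a symmetric linear fractional stable motion independent of $A_{\gamma/\delta}$, then $(A_{\gamma/\delta}^{1/\delta}Y^{(\delta,0,\beta/\gamma)}_t)_{t\ge0}$ provides a stochastic solution to $$u(t,x)=u_0(x)+\int_0^tk(t,s)\Delta^{\gamma/2}u(s,x)ds\ (t>0,x\in\mathbb{R}),\qquad \lim_{t\searrow0}u(t,x)=u_0(x)\ (x\in\mathbb{R}).$$ (ii) Let $\beta\ne1$, $\delta\in(\beta,2]\setminus\{1\}$ and $\rho\in[-1,1]$. If $A$ is a nonnegative random variable with Laplace transform $\hat\Phi(-\cdot)$ and $(Y^{(\delta,\rho,\beta/\delta)}_t)_{t\ge0}$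 is a linear fractional stable motion independent of $A$, then $(A^{1/\delta}Y^{(\delta,\rho,\beta/\delta)}_t)_{t\ge0}$ provides a stochastic solution to $$u(t,x)=u_0(x)+\int_0^tk(t,s)L_{\delta,\rho_0}u(s,x)ds\ (t>0,x\in\mathbb{R}),\qquad \lim_{t\searrow0}u(t,x)=u_0(x)\ (x\in\mathbb{R}),$$ where $\rho_0=\rho$ if $\beta\in(1,2)$, and if $\beta\in(0,1)$, $$\rho_0=\rho\,\frac{\frac1\beta-\int_0^\infty\big(x^{(\beta-1)/\delta}-(1+x)^{(\beta-1)/\delta}\big)^\delta dx}{\frac1\beta+\int_0^\infty\big(x^{(\beta-1)/\delta}-(1+x)^{(\beta-1)/\delta}\big)^\delta dx}.$$
   Context: Dimension $d=1$. For $\delta\in(0,2]$ and $\rho\in[-1,1]$ (with $\rho=0$ if $\delta=1$), $\psi_{\delta,\rho}(p)=|p|^\delta(1-i\rho\,\mathrm{sign}(p)\tan(\pi\delta/2))$, and $L_{\delta,\rho}$ is the pseudo-differential operator $L_{\delta,\rho}\varphi=\mathfrak{F}^{-1}[(-\psi_{\delta,\rho})\mathfrak{F}\varphi]$ on the Schwartz space $S(\mathbb{R})$ ($\mathfrak{F}\varphi(p)=(2\pi)^{-1/2}\int e^{-ipx}\varphi(x)dx$), closed in $C_\infty(\mathbb{R})$; $\Delta^{\delta/2}:=L_{\delta,0}$ (symbol $-|p|^\delta$). A stable random measure $M_{\delta,\rho}$ is a $\sigma$-additive map from the Borel sets of $\mathbb{R}$ to real random variables with independent values on pairwise disjoint sets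 and $\mathbb{E}[e^{ipM_{\delta,\rho}(A)}]=e^{-\mathrm{Leb}(A)\psi_{\delta,\rho}(p)}$. For $H\in(0,1)\setminus\{1/\delta\}$, the linear fractional stable motion is $Y^{(\delta,\rho,H)}_t=\frac1{K_{\delta,H}}\int_{\mathbb{R}}\big((t-x)_+^{H-1/\delta}-(-x)_+^{H-1/\delta}\big)M_{\delta,\rho}(dx)$, $t\ge0$, with $K_{\delta,H}=\big(\int_0^\infty|(1+x)^{H-1/\delta}-x^{H-1/\delta}|^\delta dx+\frac1{\delta H}\big)^{1/\delta}$; ''symmetric'' means $\rho=0$. A real-valued process $(X_t)_{t\ge0}$ with $X_0=0$ a.s. provides a stochastic solution to an equation of the displayed form if for every $u_0\in S(\mathbb{R})$ the function $u(t,x)=\mathbb{E}[u_0(x+X_t)]$ solves it. *)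

(* Defs.v *)
From HB Require Import structures.
From mathcomp Require Import all_boot all_order all_algebra.
From mathcomp Require Import all_classical all_reals all_analysis.
Set Implicit Arguments. Unset Strict Implicit. Unset Printing Implicit Defensive.
Import Order.TTheory GRing.Theory Num.Theory.
Import numFieldNormedType.Exports.
Local Open Scope classical_set_scope.
Local Open Scope ring_scope.

Section Analytic.
Variable R : realType.
Local Notation leb := (@lebesgue_measure R).

Definition pospow (x a : R) : R := if 0 < x then x `^ a else 0.

Definition smooth (f : R -> R) : Prop :=
  forall (n : nat) (x : R), derivable (derive1n n f) x 1.
Definition schwartz (f : R -> R) : Prop :=
  smooth f /\ forall m n : nat, exists C : R, forall x : R, `|x ^+ m * derive1n n f x| <= C.

Definition C_infty (f : R -> R) : Prop :=
  continuous f /\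
  forall e : R, 0 < e -> exists M : R, forall x : R, M < `|x| -> `|f x| < e.

(** Fourier transform  F phi (p) = (2 pi)^{-1/2} int e^{-ipx} phi(x) dx
    = Fc phi p - i * Fs phi p   (phi real valued) *)
Definition Fc (phi : R -> R) (p : R) : R :=
  (Num.sqrt (2 * pi))^-1 * Rintegral leb setT (fun x => cos (p * x) * phi x).
Definition Fs (phi : R -> R) (p : R) : R :=
  (Num.sqrt (2 * pi))^-1 * Rintegral leb setT (fun x => sin (p * x) * phi x).

Definition psiRe (delta : R) (p : R) : R := `|p| `^ delta.
Definition psiIm (delta rho : R) (p : R) : R :=
  - (`|p| `^ delta * rho * Num.sg p * tan (pi * delta / 2)).

(** L_{delta,rho} phi = F^{-1}[(-psi) F phi] on S(R) (real part written out;
    the result is real-valued for real phi). With g = (-psi) * F phi: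
    Re g = -psiRe*Fc - psiIm*Fs,  Im g = -psiIm*Fc + psiRe*Fs. *)
Definition Lop (delta rho : R) (phi : R -> R) (x : R) : R :=
  (Num.sqrt (2 * pi))^-1 * Rintegral leb setT (fun p =>
     cos (p * x) * (- psiRe delta p * Fc phi p - psiIm delta rho p * Fs phi p)
   - sin (p * x) * (- psiIm delta rho p * Fc phi p + psiRe delta p * Fs phi p)).

Definition unif_cvg (f : nat -> R -> R) (g : R -> R) : Prop :=
  forall e : R, 0 < e -> exists N : nat, forall n : nat, (N <= n)%N ->
    forall x : R, `|f n x - g x| < e.

(** graph of the closure in C_infty(R) of L_{delta,rho} with domain S(R):
    Lbar delta rho u g  <->  u is in the domain of the closure and (closure) u = g *)
Definition Lbar (delta rho : R) (u g : R -> R) : Prop :=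
  C_infty u /\ C_infty g /\
  exists phi : nat -> R -> R, (forall n, schwartz (phi n)) /\
    unif_cvg phi u /\ unif_cvg (fun n => Lop delta rho (phi n)) g.

Definition solves (Lrel : (R -> R) -> (R -> R) -> Prop) (k : R -> R -> R)
    (u0 : R -> R) (u : R -> R -> R) : Prop :=
  exists G : R -> R -> R,
    (forall s : R, 0 < s -> Lrel (u s) (G s)) /\
    (forall t x : R, 0 < t ->
       leb.-integrable `]0, t[ (fun s => (k t s * G s x)%:E) /\
       u t x = u0 x + Rintegral leb `]0, t[ (fun s => k t s * G s x)) /\
    (forall x : R, u t x @[t --> 0^'+] --> u0 x).

Definition kernel_measurable (k : R -> R -> R) : Prop :=
  measurable_fun [set z : R * R | 0 < z.1 /\ 0 < z.2] (fun z => k z.1 z.2).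
Definition homogeneous (k : R -> R -> R) (beta : R) : Prop :=
  forall t s : R, 0 < t -> 0 < s < 1 -> k t (t * s) = t `^ (beta - 1) * k 1 s.
Definition in_L1eps (k : R -> R -> R) (eps : R) : Prop :=
  measurable_fun (`]0, 1[ : set R) (k 1) /\
  (\int[leb]_(s in (`]0%R, 1%R[ : set R)) (`|k 1 s| `^ (1 + eps))%:E < +oo)%E.

Fixpoint chat (k : R -> R -> R) (beta : R) (n : nat) : R :=
  match n with
  | 0 => 1
  | n'.+1 => chat k beta n' *
      Rintegral leb `]0, 1[ (fun s => k 1 s * s `^ (beta * n'%:R))
  end.

Definition Phi_partial (k : R -> R -> R) (beta lam : R) (N : nat) : R :=
  \sum_(n < N) chat k beta n * lam ^+ n.
Definition Phihat (k : R -> R -> R) (beta lam : R) : R :=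
  lim (Phi_partial k beta lam @ \oo).

Definition completely_monotone (f : R -> R) : Prop :=
  forall (n : nat) (x : R), 0 < x ->
    derivable (derive1n n f) x 1 /\ 0 <= (-1) ^+ n * derive1n n f x.

Definition rho0 (delta beta rho : R) : R :=
  if 1 < beta then rho else
  let I := Rintegral leb `]0, +oo[
      (fun x => (x `^ ((beta - 1) / delta) - (1 + x) `^ ((beta - 1) / delta)) `^ delta) in
  rho * ((beta^-1 - I) / (beta^-1 + I)).

Definition KdH (delta H : R) : R :=
  (Rintegral leb `]0, +oo[
     (fun x => `|(1 + x) `^ (H - delta^-1) - x `^ (H - delta^-1)| `^ delta)
   + (delta * H)^-1) `^ (delta^-1).

Definition lfsm_kernel (delta H t : R) (x : R) : R :=
  pospow (t - x) (H - delta^-1) - pospow (- x) (H - delta^-1).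

End Analytic.

Section Probabilistic.
Variables (R : realType) (d : measure_display) (T : measurableType d)
  (P : probability T R).
Local Notation leb := (@lebesgue_measure R).

Definition expect (f : T -> R) : R := fine (\int[P]_w (f w)%:E).

Definition mutually_indep (n : nat) (X : 'I_n -> T -> R) : Prop :=
  forall B : 'I_n -> set R, (forall i, measurable (B i)) ->
    P (\bigcap_(i in [set: 'I_n]) (X i @^-1` B i)) = (\prod_(i < n) P (X i @^-1` B i))%E.

Definition stable_random_measure (delta rho : R) (M : set R -> T -> R) : Prop :=
  (forall A, measurable A -> (leb A < +oo)%E -> measurable_fun setT (M A)) /\
  (forall F : nat -> set R, (forall n, measurable (F n)) -> trivIset setT F ->
     (leb (\bigcup_n F n) < +oo)%E ->
     {ae P, forall w, (fun N => \sum_(i < N) M (F i) w) @ \oo --> M (\bigcup_n F n) w}) /\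
  (forall (n : nat) (F : 'I_n -> set R),
     (forall i, measurable (F i) /\ (leb (F i) < +oo)%E) -> trivIset setT F ->
     mutually_indep (fun i => M (F i))) /\
  (forall A, measurable A -> (leb A < +oo)%E -> forall p : R,
     let l := fine (leb A) in
     expect (fun w => cos (p * M A w)) =
       expR (- (l * psiRe delta p)) * cos (l * psiIm delta rho p) /\
     expect (fun w => sin (p * M A w)) =
       - (expR (- (l * psiRe delta p)) * sin (l * psiIm delta rho p))).

Definition simple_adm (s : seq (R * set R)) : Prop :=
  forall c, c \in s -> measurable c.2 /\ (leb c.2 < +oo)%E.
Definition sf_eval (s : seq (R * set R)) (x : R) : R :=
  \sum_(c <- s) c.1 * \1_(c.2) x.
Definition sf_int (M : set R -> T -> R) (s : seq (R * set R)) (w : T) : R :=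
  \sum_(c <- s) c.1 * M c.2 w.

Definition stoch_int (M : set R -> T -> R) (delta : R) (f : R -> R) (X : T -> R) : Prop :=
  measurable_fun setT X /\
  exists s : nat -> seq (R * set R), (forall n, simple_adm (s n)) /\
    (fun n => (\int[leb]_x (`|sf_eval (s n) x - f x| `^ delta)%:E)%E) @ \oo --> 0%E /\
    (forall e : R, 0 < e ->
       (fun n => P [set w | e < `|sf_int M (s n) w - X w|]) @ \oo --> 0%E).

Definition is_lfsm (M : set R -> T -> R) (delta H : R) (Y : R -> T -> R) : Prop :=
  forall t : R, 0 <= t ->
    stoch_int M delta (lfsm_kernel delta H t) (fun w => KdH delta H * Y t w).

Definition indep_rv_process (A : T -> R) (Y : R -> T -> R) : Prop :=
  forall (n : nat) (ts : 'I_n -> R) (B : set R) (Bs : 'I_n -> set R),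
    (forall i, 0 <= ts i) -> measurable B -> (forall i, measurable (Bs i)) ->
    P (A @^-1` B `&` \bigcap_(i in [set: 'I_n]) (Y (ts i) @^-1` Bs i)) =
    (P (A @^-1` B) * P (\bigcap_(i in [set: 'I_n]) (Y (ts i) @^-1` Bs i)))%E.

Definition nonneg_rv_laplace (A : T -> R) (Lap : R -> R) : Prop :=
  measurable_fun setT A /\ (forall w, 0 <= A w) /\
  forall x : R, 0 < x -> expect (fun w => expR (- (x * A w))) = Lap x.

Definition stochastic_solution (X : R -> T -> R)
    (Lrel : (R -> R) -> (R -> R) -> Prop) (k : R -> R -> R) : Prop :=
  {ae P, forall w, X 0 w = 0} /\
  forall u0 : R -> R, schwartz u0 ->
    solves Lrel k u0 (fun t x => expect (fun w => u0 (x + X t w))).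

End Probabilistic.

(* Main.v *)
(** The process enters the equation only through its one-dimensional
    characteristic functions.  If, for every [s > 0], [E e^(ip X_s)] is the
    power series [sum_n chat_n s^(beta n) (- psi p)^n], then integrating this
    series against [k t s] term by term and using homogeneity,
    [chat_n * int_0^t k(t,s) s^(beta n) ds = chat_(n+1) t^(beta (n+1))],
    so that [E e^(ip X_t) = 1 - psi p * int_0^t k(t,s) E e^(ip X_s) ds].
    Fourier inversion of [u0] turns this into the integral equation, with
    [G s x = E ((L u0) (x + X_s))]; truncating [X_s] to [-n, n] gives Schwartz
    functions approximating [u s] in the graph norm of [L].

    The characteristic function of [Y_t] is obtained from simple integrands by
    independence and a limit in probability; the scale [t^(delta H)] and the
    skewness come from the integrals of [|f_1|^delta] and
    [sign f_1 * |f_1|^delta] of the kernel.  Conditioning on [A], in case (i)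
    the Laplace transform of [A] gives the series at once.  In case (ii) the
    argument is complex, so one first extracts the moments [E A^n = n! chat_n]
    from the behaviour of the Laplace transform at [0] (Fatou and the
    alternating Taylor remainders of [e^(-y)]) and then sums the complex
    exponential series; this also identifies the skewness as [rho0]. *)
Require Import Defs.
From HB Require Import structures.
From mathcomp Require Import all_boot all_order all_algebra.
From mathcomp Require Import all_classical all_reals all_analysis.
Import Order.TTheory GRing.Theory Num.Theory.
Import numFieldNormedType.Exports.
Local Open Scope classical_set_scope.
Local Open Scope ring_scope.
From mathcomp Require Import measurable_realfun ring lra.
Set Implicit Arguments.
Unset Strict Implicit.
Unset Printing Implicit Defensive.

(** Complex identities are carried as pairs of real ones, the characteristic function being split
    into a cosine and a sine part; this is why so many statements come in twos. The analytic half
    knows the process only through its laws at single times. These have few moments, so x -> E u0(x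
    + X_s) need not decay rapidly: hence the truncation before any approximation by Schwartz
    functions. Nor is [X] jointly measurable in time and chance; measurability of the characteristic
    function in (s, p) is recovered from its power series. On the probabilistic side, the stochastic
    integral is given by simple functions over possibly overlapping sets, converging in L^delta and
    in probability. They are rewritten over disjoint sets before independence can act. Since L^delta
    has no norm for delta < 1, a single two-regime estimate for |a|^delta and sign(a)|a|^delta
    replaces the triangle inequality for all 0 < delta <= 2. Integrability of the moving-average
    kernel also comes out of this passage to the limit. In case (i) the variable [A] may have
    infinite mean, but the symbol is real; in case (ii) [A] has moments of every order, and they are
    used. *)

(** * Real-valued Lebesgue integrals: domination and Fubini *)

Section real_integrals.
Context d (T : measurableType d) (R : realType).
Variable mu : {measure set T -> \bar R}.
Implicit Types (D : set T) (f g : T -> R).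

Lemma integrable_dominated D f g : measurable D -> measurable_fun D f ->
  (forall x, D x -> `|f x| <= g x) -> mu.-integrable D (EFin \o g) ->
  mu.-integrable D (EFin \o f).
Proof.
move=> mD mf fg ig; apply: (le_integrable mD _ _ ig).
  exact/measurable_EFinP.
by move=> x Dx /=; rewrite lee_fin (le_trans (fg _ Dx))// ler_norm.
Qed.

Lemma integrable_measurable D f : mu.-integrable D (EFin \o f) ->
  measurable_fun D f.
Proof. by move=> /integrableP[/measurable_EFinP]. Qed.

Lemma integrable_mulZl D (r : R) f : measurable D ->
  mu.-integrable D (EFin \o f) ->
  mu.-integrable D (EFin \o (fun x => r * f x)).
Proof.
by move=> mD /(integrableZl mD r); apply: eq_integrable.
Qed.

Lemma integrable_add D f g : measurable D ->
  mu.-integrable D (EFin \o f) -> mu.-integrable D (EFin \o g) ->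
  mu.-integrable D (EFin \o (fun x => f x + g x)).
Proof.
by move=> mD intf intg; have := integrableD mD intf intg; apply: eq_integrable.
Qed.

Lemma integrable_sub D f g : measurable D ->
  mu.-integrable D (EFin \o f) -> mu.-integrable D (EFin \o g) ->
  mu.-integrable D (EFin \o (fun x => f x - g x)).
Proof.
by move=> mD intf intg; have := integrableB mD intf intg; apply: eq_integrable.
Qed.

Lemma integrable_normr D f : measurable D -> mu.-integrable D (EFin \o f) ->
  mu.-integrable D (EFin \o (fun x => `|f x|)).
Proof.
move=> mD intf; have := integrable_abse intf.
by apply: eq_integrable.
Qed.

Lemma normr_Rintegral_le D f g : measurable D -> measurable_fun D f ->
  (forall x, D x -> `|f x| <= g x) -> mu.-integrable D (EFin \o g) ->
  `|\int[mu]_(x in D) f x| <= \int[mu]_(x in D) g x.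
Proof.
move=> mD mf fg ig; have intf := integrable_dominated mD mf fg ig.
apply: (le_trans (le_normr_Rintegral mD intf)).
by apply: le_Rintegral => //; exact: integrable_normr.
Qed.

Lemma Rintegral_dominated_cvg D (f_ : nat -> T -> R) f g : measurable D ->
  (forall n, measurable_fun D (f_ n)) ->
  (forall x, D x -> f_ n x @[n --> \oo] --> f x) ->
  mu.-integrable D (EFin \o g) ->
  (forall n x, D x -> `|f_ n x| <= g x) ->
  \int[mu]_(x in D) f_ n x @[n --> \oo] --> \int[mu]_(x in D) f x.
Proof.
move=> mD mf_ f_f ig f_g.
have mf : measurable_fun D f by exact: (measurable_fun_cvg mf_ f_f).
have [||||intf _ h] := @dominated_convergence _ _ _ mu D mD
    (fun n => EFin \o f_ n) (EFin \o f) (EFin \o g) _ _ _ ig.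
- by move=> n; exact/measurable_EFinP.
- exact/measurable_EFinP.
- by apply: aeW => x Dx; apply: cvg_EFin; [exact: nearW|exact: f_f].
- by apply: aeW => x n Dx /=; rewrite lee_fin f_g.
apply: fine_cvg; rewrite fineK//.
exact: integrable_fin_num.
Qed.

Lemma integrable_mul_bounded D f g (C : R) : measurable D ->
  measurable_fun D g -> (forall x, D x -> `|g x| <= C) ->
  mu.-integrable D (EFin \o f) ->
  mu.-integrable D (EFin \o (fun x => g x * f x)).
Proof.
move=> mD mg gC intf.
apply: (@integrable_dominated D _ (fun x => C * `|f x|)) => //.
- by apply: measurable_funM => //; exact: integrable_measurable.
- by move=> x Dx; rewrite normrM ler_wpM2r// gC.
- by apply: integrable_mulZl => //; exact: integrable_normr.
Qed.

End real_integrals.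

Section real_fubini.
Context d1 d2 (T1 : measurableType d1) (T2 : measurableType d2) (R : realType).
Variables (m1 : {sigma_finite_measure set T1 -> \bar R})
  (m2 : {sigma_finite_measure set T2 -> \bar R}).
Variables (F : T1 -> T2 -> R) (f : T1 -> R) (g : T2 -> R).
Hypothesis mF : measurable_fun setT (fun z : T1 * T2 => F z.1 z.2).
Hypothesis intf : m1.-integrable setT (EFin \o f).
Hypothesis intg : m2.-integrable setT (EFin \o g).
Hypothesis Ffg : forall x y, `|F x y| <= f x * g y.

(** Tonelli bounds the double integral of |F| by the product of the integrals of |f| and |g|. The
    exchanges of Fourier integrals below all have such a product majorant. *)
Let intF : (m1 \x m2)%E.-integrable setT (fun z : T1 * T2 => (F z.1 z.2)%:E).
Proof.
apply/integrable12ltyP; first exact/measurable_EFinP.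
have absfg x y : `|F x y| <= `|f x| * `|g y|.
  by rewrite (le_trans (Ffg x y))// -normrM ler_norm.
have mabsg : measurable_fun setT (fun y => (`|g y|)%:E).
  by apply/measurable_EFinP; apply: measurableT_comp => //;
    exact: integrable_measurable intg.
apply: (@le_lt_trans _ _ (\int[m1]_x (\int[m2]_y (`|f x| * `|g y|)%:E))%E).
  apply: ge0_le_integral => //.
  - by move=> x _; exact: integral_ge0.
  - apply: (@measurable_fun_fubini_tonelli_F _ _ _ _ _ _
      (fun z : T1 * T2 => `|(F z.1 z.2)%:E|%E)) => //=.
    by apply/measurable_EFinP; apply: measurableT_comp.
  - apply: (@measurable_fun_fubini_tonelli_F _ _ _ _ _ _
      (fun z : T1 * T2 => (`|f z.1| * `|g z.2|)%:E)) => /=.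
      apply/measurable_EFinP; apply: measurable_funM; apply: measurableT_comp => //.
        by apply: measurableT_comp; [exact: integrable_measurable intf|].
      by apply: measurableT_comp; [exact: integrable_measurable intg|].
    by move=> z; rewrite lee_fin mulr_ge0.
  - move=> x _; apply: ge0_le_integral => //.
    + by apply: measurableT_comp => //; apply/measurable_EFinP;
        exact: (measurable_fun_pair2 x mF).
    + apply/measurable_EFinP; apply: measurable_funM => //; exact/measurable_EFinP.
    + by move=> y _; rewrite lee_fin absfg.
under eq_integral do under eq_integral do rewrite EFinM.
under eq_integral do rewrite ge0_integralZl//.
have [_ gfin] := integrableP _ _ _ intg.
have [_ ffin] := integrableP _ _ _ intf.
rewrite ge0_integralZr//.
- by apply: lte_mul_pinfty => //; [exact: integral_ge0|
    rewrite ge0_fin_numE//; exact: integral_ge0].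
- by apply/measurable_EFinP; apply: measurableT_comp => //;
    exact: integrable_measurable intf.
- exact: integral_ge0.
Qed.

Let intF2 x : m2.-integrable setT (EFin \o (F x)).
Proof.
apply: (@integrable_dominated _ _ _ _ _ _ (fun y => f x * g y)) => //.
  exact: (measurable_fun_pair2 x mF).
exact: integrable_mulZl.
Qed.

Let intF1 y : m1.-integrable setT (EFin \o (F ^~ y)).
Proof.
apply: (@integrable_dominated _ _ _ _ _ _ (fun x => g y * f x)) => //.
  exact: (measurable_fun_pair1 y mF).
  by move=> x _; rewrite mulrC Ffg.
exact: integrable_mulZl.
Qed.

Lemma integrable_Rintegral_snd :
  m1.-integrable setT (EFin \o (fun x => \int[m2]_y F x y)).
Proof.
have := integrable_fubini_F intF; apply: eq_integrable => // x _ /=.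
rewrite /fubini_F /Rintegral fineK//.
exact: (integrable_fin_num measurableT (intF2 x)).
Qed.

Lemma Rintegral_fubini :
  \int[m1]_x \int[m2]_y F x y = \int[m2]_y \int[m1]_x F x y.
Proof.
rewrite [LHS]/Rintegral [RHS]/Rintegral.
have -> : (\int[m1]_x (\int[m2]_y F x y)%:E =
           \int[m1]_x \int[m2]_y (F (x, y).1 (x, y).2)%:E)%E.
  apply: eq_integral => x _; rewrite /Rintegral fineK//.
  exact: (integrable_fin_num measurableT (intF2 x)).
rewrite (Fubini intF) /=; congr fine; apply: eq_integral => y _.
rewrite /Rintegral fineK//.
exact: (integrable_fin_num measurableT (intF1 y)).
Qed.

End real_fubini.

(** * Affine substitution on the line *)

Section affine_change_of_variables.
Variable R : realType.
Local Notation leb := (@lebesgue_measure R).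

Let measurable_affine (a b : R) :
  measurable_fun (setT : set R) (fun x : R => a * x + b).
Proof.
by apply: measurable_funD => //; exact: measurable_funM.
Qed.

(** The pushforward of Lebesgue measure under the affine map, scaled by [a], agrees with Lebesgue
    measure on half-open intervals, hence everywhere by uniqueness. *)
Let lebesgue_affine_pos (a b : R) (A : set R) : 0 < a -> measurable A ->
  (a%:E * leb ((fun x => a * x + b)%R @^-1` A) = leb A)%E.
Proof.
move=> a0 mA.
pose phi : R -> measurableTypeR R := fun x => a * x + b.
have mphi : measurable_fun setT phi by exact: measurable_affine.
have [m mE] : exists m : measure (measurableTypeR R) R,
    forall A, m A = (a%:E * leb (phi @^-1` A))%E.
  unshelve eexists (mscale (NngNum (ltW a0)) (pushforward leb phi)).
    exact: mphi.
  by [].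
rewrite -[LHS]mE; apply/esym/lebesgue_measure_unique => // X [[u v]] _ <-.
rewrite mE.
have -> : phi @^-1` `]u, v] = `]((u - b) / a), ((v - b) / a)]%classic.
  apply/seteqP; split => x /=; rewrite !in_itv /= /phi;
    rewrite ltr_pdivrMr// ler_pdivlMr// ltrBlDr lerBrDr (mulrC x) //.
rewrite !lebesgue_measure_itv /= !lte_fin ltr_pM2r ?invr_gt0// ltrD2r.
case: ifPn => uv; last by rewrite mule0.
rewrite -!EFinD -EFinM; congr EFin.
by field; rewrite gt_eqF.
Qed.

Lemma ge0_integral_affine (a b : R) (f : R -> \bar R) : a != 0 ->
  measurable_fun setT f -> (forall x, 0 <= f x)%E ->
  (`|a|%:E * \int[leb]_x f (a * x + b)%R = \int[leb]_x f x)%E.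
Proof.
move=> a0 mf f0.
(* A negative slope is a positive one composed with the reflection x -> -x, which preserves Lebesgue
   measure. *)
wlog : a f b a0 mf f0 / 0 < a => [h|apos].
  have [apos|aneg] := ltP 0 a; first exact: h.
  have {}aneg : a < 0 by rewrite lt_neqAle a0.
  have mN : measurable_fun (setT : set (measurableTypeR R))
      (-%R : measurableTypeR R -> measurableTypeR R).
    exact: oppr_measurable.
  have refl (g : R -> \bar R) : measurable_fun setT g -> (forall x, 0 <= g x)%E ->
      (\int[leb]_x g (- x)%R = \int[leb]_x g x)%E.
    move=> mg g0.
    rewrite -[LHS](@ge0_integral_pushforward _ _ _ _ _ (-%R : measurableTypeR R -> measurableTypeR R)
      mN leb setT g)//.
    apply: eq_measure_integral => A mA _; exact: lebesgue_measureN.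
  rewrite -(refl f)// -(h (- a) (fun x => f (- x)) (- b))//.
  - by rewrite normrN; congr (_ * _)%E; apply: eq_integral => x _; congr f; ring.
  - by rewrite oppr_eq0.
  - exact: measurableT_comp.
  - by rewrite oppr_gt0.
rewrite gtr0_norm//.
have mphi : measurable_fun (setT : set (measurableTypeR R))
    ((fun x => a * x + b) : measurableTypeR R -> measurableTypeR R).
  exact: measurable_affine.
rewrite -(@ge0_integral_pushforward _ _ _ _ _
  ((fun x => a * x + b) : measurableTypeR R -> measurableTypeR R) mphi leb setT f)//.
have -> (m : measure (measurableTypeR R) R) :
    (a%:E * \int[m]_x f x = \int[mscale (NngNum (ltW apos)) m]_x f x)%E.
  by rewrite ge0_integral_mscale.
by apply: eq_measure_integral => A mA _; exact: lebesgue_affine_pos.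
Qed.

Lemma integrable_affine (a b : R) (f : R -> R) : a != 0 ->
  leb.-integrable setT (EFin \o f) ->
  leb.-integrable setT (EFin \o (fun x => f (a * x + b))).
Proof.
move=> a0 /integrableP[mf fy]; apply/integrableP; split.
  apply/measurable_EFinP; apply: measurableT_comp; first exact/measurable_EFinP.
  exact: measurable_affine.
move: fy; rewrite -(@ge0_integral_affine a b)//=; last first.
  apply/measurable_EFinP; apply: measurableT_comp => //; exact/measurable_EFinP.
rewrite -[in X in _ -> X](@lte_pmul2l _ `|a|%:E)// ?lte_fin ?normr_gt0//.
by rewrite mulry gtr0_sg ?normr_gt0// mul1e.
Qed.

(** Holds for every measurable [f]: multiplication by [|a|] keeps infinite integrals infinite, and
    [fine] then sends both sides to 0. The final case analysis runs through these values. *)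
Lemma Rintegral_affine (a b : R) (f : R -> R) : a != 0 ->
  measurable_fun setT f ->
  `|a| * \int[leb]_x f (a * x + b) = \int[leb]_x f x.
Proof.
move=> a0 mf.
have mg : measurable_fun setT (EFin \o f) by exact/measurable_EFinP.
rewrite /Rintegral -[`|a|]/(fine `|a|%:E).
rewrite [in RHS]integralE [in LHS]integralE.
rewrite -(@ge0_integral_affine a b (fun x => (EFin \o f)^\+ x))%E//; last first.
  exact: measurable_funepos.
rewrite -(@ge0_integral_affine a b (fun x => (EFin \o f)^\- x))%E//; last first.
  exact: measurable_funeneg.
have apos : 0 < `|a| by rewrite normr_gt0.
have ymul : (`|a|%:E * +oo = +oo)%E by rewrite mulry gtr0_sg// mul1e.
have Nymul : (`|a|%:E * -oo = -oo)%E by rewrite mulrNy gtr0_sg// mul1e.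
set I1 := (\int[_]_x _)%E; set I2 := (\int[_]_x _)%E.
have <- : (\int[leb]_x (EFin \o f)^\+ (a * x + b)%R = I1)%E.
  by apply: eq_integral => x _; rewrite !funeposE.
have <- : (\int[leb]_x (EFin \o f)^\- (a * x + b)%R = I2)%E.
  by apply: eq_integral => x _; rewrite !funenegE.
move: (\int[leb]_x _)%E (\int[leb]_x _)%E => {}I2 {}I1.
case: I1 => [r1| |]; case: I2 => [r2| |] /=; rewrite ?(ymul, Nymul) /= ?mulr0//.
by ring.
Qed.

End affine_change_of_variables.

(** * Integrals over the line by antiderivatives; the Cauchy weight and the Abel kernel *)

Section line_integrals.
Variable R : realType.
Local Notation leb := (@lebesgue_measure R).
Implicit Types (f F : R -> R).

Lemma is_derive_continuous F f : (forall x : R, is_derive x 1 F (f x)) ->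
  continuous F.
Proof.
move=> dF x; apply: differentiable_continuous; apply/derivable1_diffP.
by have [] := dF x.
Qed.

Lemma Rintegral_itv_derive F f (a b : R) :
  (forall x : R, is_derive x 1 F (f x)) -> continuous f -> a <= b ->
  \int[leb]_(x in `[a, b]) f x = F b - F a.
Proof.
move=> dF cf; rewrite le_eqVlt => /predU1P[<-|ab].
  by rewrite set_itv1 Rintegral_set1 subrr.
have cF := is_derive_continuous dF.
rewrite /Rintegral (@continuous_FTC2 _ f F)//.
- by apply: continuous_subspaceT.
- split.
  + by move=> x _; have [] := dF x.
  + exact/cvg_at_right_filter/cF.
  + exact/cvg_at_left_filter/cF.
- by move=> x _; rewrite derive1E; have [] := dF x.
Qed.

Lemma Rintegral_itvNnn_cvg f : leb.-integrable setT (EFin \o f) ->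
  \int[leb]_(x in `[- n%:R, n%:R]) f x @[n --> \oo] --> \int[leb]_x f x.
Proof.
move=> intf; under eq_cvg do rewrite Rintegral_mkcond.
apply: (@Rintegral_dominated_cvg _ _ _ leb _ _ _ (fun x => `|f x|)) => //.
- move=> n; apply/(measurable_restrictT _ _).1 => //.
  by apply: measurable_funTS; exact: integrable_measurable intf.
- move=> x _; apply: cvg_near_cst; near=> n.
  rewrite patchE ifT//; apply/mem_set; rewrite /= in_itv/= -ler_norml.
  by near: n; exact: nbhs_infty_ger.
- exact: integrable_normr.
- by move=> n x _; rewrite patchE; case: ifPn => //; rewrite normr0.
Unshelve. all: by end_near. Qed.

Lemma Rintegral_itv0n_cvg f : leb.-integrable `[0, +oo[ (EFin \o f) ->
  \int[leb]_(x in `[0, n%:R]) f x @[n --> \oo] -->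
  \int[leb]_(x in `[0, +oo[) f x.
Proof.
move=> intf.
have E n : \int[leb]_(x in `[0, n%:R]) f x =
    \int[leb]_(x in `[0, +oo[) (f \_ `[0, n%:R]) x.
  rewrite -Rintegral_mkcondr; congr Rintegral; apply/seteqP; split => x /=.
    by rewrite !in_itv/= andbT => /andP[-> ->].
  by case.
under eq_cvg do rewrite E.
apply: (@Rintegral_dominated_cvg _ _ _ leb _ _ _ (fun x => `|f x|)) => //.
- move=> n; have /integrable_measurable mf := intf.
  apply: (measurable_restrict _ _ _).1 => //.
  by apply: measurable_funS mf => // x [].
- move=> x /=; rewrite in_itv/= andbT => x0; apply: cvg_near_cst; near=> n.
  rewrite patchE ifT//; apply/mem_set; rewrite /= in_itv/= x0/=.
  by near: n; exact: nbhs_infty_ger.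
- exact: integrable_normr.
- by move=> n x _; rewrite patchE; case: ifPn => //; rewrite normr0.
Unshelve. all: by end_near. Qed.

Lemma Rintegral_line_derive F f (l : R) :
  (forall x : R, is_derive x 1 F (f x)) -> continuous f ->
  leb.-integrable setT (EFin \o f) ->
  F n%:R - F (- n%:R) @[n --> \oo] --> l -> \int[leb]_x f x = l.
Proof.
move=> dF cf intf Fl; apply: (cvg_unique _ (Rintegral_itvNnn_cvg intf)) => //.
rewrite /=; under eq_cvg.
  move=> n; rewrite (Rintegral_itv_derive dF cf); last first.
    by rewrite lerNl (le_trans _ (ler0n _ _))// oppr_le0.
  over.
exact: Fl.
Qed.

Lemma Rintegral_halfline_derive F f (l : R) :
  (forall x : R, is_derive x 1 F (f x)) -> continuous f ->
  leb.-integrable `[0, +oo[ (EFin \o f) ->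
  F n%:R @[n --> \oo] --> l -> \int[leb]_(x in `[0, +oo[) f x = l - F 0.
Proof.
move=> dF cf intf Fl; apply: (cvg_unique _ (Rintegral_itv0n_cvg intf)) => //.
rewrite /=; under eq_cvg do rewrite (Rintegral_itv_derive dF cf)//.
by apply: cvgB => //; exact: cvg_cst.
Qed.

Lemma Rintegral_fold f : leb.-integrable setT (EFin \o f) ->
  \int[leb]_x f x = \int[leb]_(x in `[0, +oo[) (f x + f (- x)).
Proof.
move=> intf.
have intNf : leb.-integrable setT (EFin \o (fun x => f (- x))).
  have := @integrable_affine R (-1) 0 f _ intf.
  under eq_fun do rewrite mulN1r addr0.
  by apply; rewrite oppr_eq0 oner_eq0.
rewrite RintegralD//; last 2 first.
- exact: integrableS intf.
- exact: integrableS intNf.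
have -> : \int[leb]_(x in `[0, +oo[) f (- x) = \int[leb]_(x in `]-oo, 0]) f x.
  rewrite [RHS]Rintegral_mkcond -(@Rintegral_affine _ (-1) 0) ?oppr_eq0 ?oner_eq0//.
    rewrite normrN1 mul1r Rintegral_mkcond; apply: eq_Rintegral => x _.
    rewrite mulN1r addr0 !patchE; congr (if _ then _ else _).
    apply/idP/idP; rewrite !inE/= !in_itv/= ?andbT; lra.
  apply/(measurable_restrictT _ _).1 => //.
  by apply: measurable_funTS; exact: integrable_measurable intf.
rewrite -Rintegral_itv_bndo_bndc; last exact: integrableS intf.
rewrite addrC -Rintegral_setU//.
- by rewrite -itv_bndbnd_setU// set_itvNyy.
- by rewrite -itv_bndbnd_setU// set_itvNyy.
- apply/disj_setPS => y [/=]; rewrite !in_itv/= andbT; lra.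
Qed.

Lemma integrable_cauchy :
  leb.-integrable setT (EFin \o (fun x : R => (1 + x ^+ 2)^-1)).
Proof.
have mc : measurable_fun (setT : set R) (fun x : R => (1 + x ^+ 2)^-1).
  apply: continuous_measurable_fun => x.
  by apply: cvgV; [rewrite gt_eqF// ltr_wpDr// sqr_ge0|
    apply: cvgD; [exact: cvg_cst|exact: exprn_continuous]].
apply/integrableP; split; first exact/measurable_EFinP.
have c0 x : 0 <= (1 + x ^+ 2)^-1 :> R by rewrite invr_ge0 addr_ge0// sqr_ge0.
under eq_integral do rewrite /= ger0_norm//.
rewrite ge0_symfun_integralT//=; last 2 first.
- move=> x; apply: cvgV; first by rewrite gt_eqF// ltr_wpDr// sqr_ge0.
  by apply: cvgD; [exact: cvg_cst|exact: exprn_continuous].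
- by move=> x /=; rewrite sqrrN.
rewrite (_ : [set x | 0 <= x] = `[0, +oo[%classic); last first.
  by apply/seteqP; split => x /=; rewrite in_itv/= andbT.
by have := integral0y_oneDsqr R; rewrite /oneDsqr => ->; rewrite -EFinM ltry.
Qed.

Lemma Rintegral_cauchy : \int[leb]_x (1 + x ^+ 2)^-1 = pi :> R.
Proof.
rewrite Rintegral_fold; last exact: integrable_cauchy.
under eq_Rintegral do rewrite sqrrN -mulr2n -mulr_natl.
rewrite RintegralZl//; last exact: integrableS integrable_cauchy.
have := integral0y_oneDsqr R; rewrite /oneDsqr /Rintegral => -> /=.
by rewrite mulrC divfK.
Qed.

Lemma integrable_cauchy_bound f (C : R) : measurable_fun setT f ->
  (forall x, `|f x| <= C * (1 + x ^+ 2)^-1) ->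
  leb.-integrable setT (EFin \o f).
Proof.
move=> mf fC; apply: (@integrable_dominated _ _ _ leb _ _
  (fun x => C * (1 + x ^+ 2)^-1)) => //.
by apply: integrable_mulZl => //; exact: integrable_cauchy.
Qed.

(** By squaring exp(ex/2) >= 1 + ex/2 one gets exp(ex) >= 1 + e^2 x^2 / 4. The constant 1 + 4/e^2 is
    chosen so that its product with this bound exceeds 1 + x^2 by a sum of two squares. *)
Lemma expR_cauchy_bound (e : R) : 0 < e -> exists C : R, forall x : R, 0 <= x ->
  expR (- (e * x)) <= C * (1 + x ^+ 2)^-1.
Proof.
move=> e0; exists (1 + 4 / e ^+ 2) => x x0.
have p0 : 0 < 1 + x ^+ 2 by rewrite ltr_wpDr// sqr_ge0.
rewrite expRN -ler_pdivrMr ?invr_gt0// invrK mulrC -ler_pdivlMr; last first.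
  by rewrite invr_gt0 expR_gt0.
rewrite invrK.
have h : 1 + e ^+ 2 * x ^+ 2 / 4 <= expR (e * x).
  have -> : e * x = e * x / 2 + e * x / 2 by field.
  have ex0 : 0 <= e * x by rewrite mulr_ge0// ltW.
  rewrite expRD; apply: (@le_trans _ _ ((1 + e * x / 2) * (1 + e * x / 2))).
    rewrite -subr_ge0.
    have -> : (1 + e * x / 2) * (1 + e * x / 2) - (1 + e ^+ 2 * x ^+ 2 / 4) = e * x.
      by field.
    by [].
  by apply: ler_pM; rewrite ?expR_ge1Dx// addr_ge0// divr_ge0.
apply: (@le_trans _ _ ((1 + 4 / e ^+ 2) * (1 + e ^+ 2 * x ^+ 2 / 4))).
  rewrite -subr_ge0.
  have -> : (1 + 4 / e ^+ 2) * (1 + e ^+ 2 * x ^+ 2 / 4) - (1 + x ^+ 2) =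
      (e * x / 2) ^+ 2 + (2 / e) ^+ 2 by field; rewrite gt_eqF.
  by rewrite addr_ge0 ?sqr_ge0.
by rewrite ler_wpM2l// addr_ge0// divr_ge0 ?sqr_ge0 ?ler0n.
Qed.

Lemma is_derive_mul f g (x f' g' : R) : is_derive x 1 f f' ->
  is_derive x 1 g g' -> is_derive x 1 (fun y => f y * g y) (f' * g x + f x * g').
Proof.
move=> df dg; have /is_derive_eq := is_deriveM df dg; apply.
by rewrite /GRing.scale/= addrC (mulrC f').
Qed.

Lemma is_derive_add f g (x f' g' : R) : is_derive x 1 f f' ->
  is_derive x 1 g g' -> is_derive x 1 (fun y => f y + g y) (f' + g').
Proof. by move=> df dg; exact: is_deriveD. Qed.

Lemma is_derive_sub f g (x f' g' : R) : is_derive x 1 f f' ->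
  is_derive x 1 g g' -> is_derive x 1 (fun y => f y - g y) (f' - g').
Proof. by move=> df dg; exact: is_deriveB. Qed.

Lemma is_derive_mull (c : R) f (x f' : R) : is_derive x 1 f f' ->
  is_derive x 1 (fun y => c * f y) (c * f').
Proof. by move=> df; exact: is_deriveZ. Qed.

Lemma is_derive_cosM (z x : R) :
  is_derive x 1 (fun y => cos (z * y)) (- (z * sin (z * x))).
Proof.
have h : is_derive x 1 (fun y : R => z * y) (z * 1) by exact: is_derive_mull.
have := is_derive1_comp (is_derive_cos (z * x)) h.
by move=> /is_derive_eq; apply; ring.
Qed.

Lemma is_derive_sinM (z x : R) :
  is_derive x 1 (fun y => sin (z * y)) (z * cos (z * x)).
Proof.
have h : is_derive x 1 (fun y : R => z * y) (z * 1) by exact: is_derive_mull.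
have := is_derive1_comp (is_derive_sin (z * x)) h.
by move=> /is_derive_eq; apply; ring.
Qed.

Lemma is_derive_expRM (e x : R) :
  is_derive x 1 (fun y => expR (e * y)) (e * expR (e * x)).
Proof.
have h : is_derive x 1 (fun y : R => e * y) (e * 1) by exact: is_derive_mull.
have := is_derive1_comp (is_derive_expR (e * x)) h.
by move=> /is_derive_eq; apply; ring.
Qed.

Lemma measurable_cosR (D : set R) : measurable_fun D cos.
Proof. by apply: measurable_funTS; apply: continuous_measurable_fun; exact: continuous_cos. Qed.

Lemma measurable_sinR (D : set R) : measurable_fun D sin.
Proof. by apply: measurable_funTS; apply: continuous_measurable_fun; exact: continuous_sin. Qed.

Lemma normr_cos_le1 (x : R) : `|cos x| <= 1.
Proof. by rewrite ler_norml cos_geN1 cos_le1. Qed.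

Lemma normr_sin_le1 (x : R) : `|sin x| <= 1.
Proof. by rewrite ler_norml sin_geN1 sin_le1. Qed.

(** The Fourier transform of the two-sided exponential is 2 pi times the Poisson kernel of width
    [e]; it is the summation kernel behind Fourier inversion. *)
Lemma Rintegral_abel_kernel (e z : R) : 0 < e ->
  \int[leb]_x (expR (- (e * `|x|)) * cos (z * x)) = 2 * e / (e ^+ 2 + z ^+ 2).
Proof.
move=> e0.
have ez0 : e ^+ 2 + z ^+ 2 != 0 by rewrite gt_eqF// ltr_wpDr ?sqr_ge0// exprn_gt0.
have [C hC] := expR_cauchy_bound e0.
have int0 : leb.-integrable setT (EFin \o (fun x => expR (- (e * `|x|)) * cos (z * x))).
  apply: (@integrable_cauchy_bound _ C).
    apply: measurable_funM; apply: measurableT_comp => //.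
    - by apply: measurableT_comp => //; apply: measurable_funM.
    - exact: measurable_cosR.
  move=> x; rewrite normrM ger0_norm ?expR_ge0//.
  rewrite (le_trans (ler_piMr _ (normr_cos_le1 _))) ?expR_ge0//.
  by rewrite (le_trans (hC _ (normr_ge0 x)))// real_normK ?num_real.
rewrite Rintegral_fold//.
pose f (x : R) := expR (- e * x) * cos (z * x).
(* An antiderivative of exp(-ex) cos(zx) that vanishes at infinity and equals -e / (e^2 + z^2) at
   0. *)
pose F (x : R) := (e ^+ 2 + z ^+ 2)^-1 * (expR (- e * x) * (z * sin (z * x) - e * cos (z * x))).
have dF (x : R) : is_derive x 1 F (f x).
  have := is_derive_mull (e ^+ 2 + z ^+ 2)^-1 (is_derive_mul (is_derive_expRM (- e) x)
    (is_derive_sub (is_derive_mull z (is_derive_sinM z x))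
      (is_derive_mull e (is_derive_cosM z x)))).
  by move=> /is_derive_eq; apply; rewrite /f; field.
have cf : continuous f.
  move=> x; apply: (@is_derive_continuous f (fun x => - e * expR (- e * x) * cos (z * x)
    + expR (- e * x) * - (z * sin (z * x)))) => y.
  by apply: is_derive_mul; [exact: is_derive_expRM|exact: is_derive_cosM].
have intf : leb.-integrable `[0, +oo[ (EFin \o f).
  apply: (@eq_integrable _ _ _ leb _ _ (EFin \o (fun x => expR (- (e * `|x|)) * cos (z * x)))) => //.
    by move=> x; rewrite inE/= in_itv/= andbT => x0; rewrite /f ger0_norm// mulNr.
  exact: integrableS int0.
have -> : \int[leb]_(x in `[0, +oo[)
    (expR (- (e * `|x|)) * cos (z * x) + expR (- (e * `|- x|)) * cos (z * - x)) =
    2 * \int[leb]_(x in `[0, +oo[) f x.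
  rewrite -RintegralZl//; apply: eq_Rintegral => x; rewrite inE/= in_itv/= andbT => x0.
  by rewrite normrN ger0_norm// mulrN cosN /f !mulNr; ring.
rewrite (@Rintegral_halfline_derive F f 0)//.
  by rewrite /F !mulr0 sin0 cos0 expR0; field.
have h (n : nat) : `|F n%:R| <= ((e ^+ 2 + z ^+ 2)^-1 * (`|z| + e) * C) * (n.+1%:R)^-1.
  rewrite /F normrM ger0_norm ?invr_ge0 ?addr_ge0 ?sqr_ge0// -!mulrA ler_wpM2l//.
    by rewrite invr_ge0 addr_ge0 ?sqr_ge0.
  rewrite normrM mulrC ler_pM//.
    apply: (le_trans (ler_normB _ _)); rewrite !normrM (ger0_norm (ltW e0)).
    by apply: lerD; apply: ler_piMr; rewrite ?normr_sin_le1 ?normr_cos_le1// ltW.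
  rewrite ger0_norm ?expR_ge0// mulNr (le_trans (hC _ (ler0n _ _)))//.
  have C0 : 0 <= C.
    by have := hC 0 (lexx _); rewrite mulr0 oppr0 expR0 expr0n/= addr0 invr1 mulr1; lra.
  rewrite ler_wpM2l// lef_pV2 ?posrE ?ltr_wpDr ?sqr_ge0//.
  rewrite -addn1 natrD addrC lerD2l.
  case: n => [|n]; first by rewrite expr0n.
  by rewrite expr2 ler_peMr// ler1n.
apply: (@norm_cvg0 _ R^o).
apply: (@squeeze_cvgr _ _ _ _ (fun=> 0) (fun n : nat => ((e ^+ 2 + z ^+ 2)^-1 * (`|z| + e) * C) * (n.+1%:R)^-1)).
- by apply: nearW => n; rewrite normr_ge0 h.
- exact: cvg_cst.
- rewrite -[X in _ --> X](mulr0 ((e ^+ 2 + z ^+ 2)^-1 * (`|z| + e) * C)).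
  by apply: cvgMr; exact: cvg_harmonic.
Qed.

End line_integrals.

Section parametric.
Context d (T : measurableType d) (R : realType).
Variable mu : {measure set T -> \bar R}.

Lemma continuous_Rintegral_param (F : R -> T -> R) (g : T -> R) :
  (forall x, measurable_fun setT (F x)) ->
  (forall y, continuous (F ^~ y)) ->
  (forall x y, `|F x y| <= g y) ->
  mu.-integrable setT (EFin \o g) ->
  continuous (fun x => \int[mu]_y F x y).
Proof.
move=> mF cF Fg intg x; apply/(@cvg_nbhsP _ R^o) => u ux.
apply: (@Rintegral_dominated_cvg _ _ _ mu _ _ _ g) => //.
by move=> y _; apply: (cvg_comp u (F ^~ y) ux); exact: cF.
Qed.

End parametric.

(** * Decay and continuity of the Fourier transform of a Schwartz function *)

Section fourier.
Variable R : realType.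
Local Notation leb := (@lebesgue_measure R).
Local Notation w x := ((1 + x ^+ 2)^-1).
Implicit Types (f u g : R -> R).

Lemma cauchy_weight_gt0 (x : R) : 0 < w x.
Proof. by rewrite invr_gt0 ltr_wpDr// sqr_ge0. Qed.

Lemma cauchy_weight_le1 (x : R) : w x <= 1.
Proof. by rewrite invf_le1 ?lerDl ?sqr_ge0// ltr_wpDr// sqr_ge0. Qed.

Lemma cauchy_weight_nat_cvg (C : R) : C * w (n%:R : R) @[n --> \oo] --> 0.
Proof.
rewrite -[X in _ --> X](mulr0 C); apply: cvgMr.
apply: (@squeeze_cvgr _ _ _ _ (fun=> 0) (fun n : nat => n.+1%:R^-1)).
- apply: nearW => n; rewrite ltW ?cauchy_weight_gt0//=.
  rewrite lef_pV2 ?posrE ?ltr_wpDr ?sqr_ge0//.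
  rewrite -addn1 natrD addrC lerD2l.
  case: n => [|n]; first by rewrite expr0n.
  by rewrite expr2 ler_peMr// ler1n.
- exact: cvg_cst.
- exact: cvg_harmonic.
Qed.

Lemma schwartz_is_derive u n (x : R) : schwartz u ->
  is_derive x 1 (derive1n n u) (derive1n n.+1 u x).
Proof.
by move=> [su _]; apply: DeriveDef; [exact: su|rewrite derive1nS derive1E].
Qed.

Lemma schwartz_continuous u n : schwartz u -> continuous (derive1n n u).
Proof.
move=> su; apply: (@is_derive_continuous _ _ (derive1n n.+1 u)) => x.
exact: schwartz_is_derive.
Qed.

(** Add the seminorms with weights 1 and x^2. The weight 1/(1 + x^2) serves as the integrable
    majorant in the Fourier integrals below. *)
Lemma schwartz_cauchy_bound u n : schwartz u ->
  exists C : R, 0 <= C /\ forall x, `|derive1n n u x| <= C * w x.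
Proof.
move=> [_ su]; have [C0 h0] := su 0 n; have [C2 h2] := su 2 n.
have C00 : 0 <= C0 by rewrite (le_trans _ (h0 0)).
have C20 : 0 <= C2 by rewrite (le_trans _ (h2 0)).
exists (C0 + C2); split; first exact: addr_ge0.
move=> x; rewrite ler_pdivlMr ?ltr_wpDr ?sqr_ge0// mulrDr mulr1.
apply: lerD; first by have := h0 x; rewrite expr0 mul1r.
by have := h2 x; rewrite normrM ger0_norm ?sqr_ge0// mulrC.
Qed.

Section by_parts.
Variables (f f1 f2 : R -> R) (C : R).
Hypothesis df : forall x : R, is_derive x 1 f (f1 x).
Hypothesis df1 : forall x : R, is_derive x 1 f1 (f2 x).
Hypothesis cf2 : continuous f2.
Hypothesis fC : forall x, `|f x| <= C * w x.
Hypothesis f1C : forall x, `|f1 x| <= C * w x.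
Hypothesis f2C : forall x, `|f2 x| <= C * w x.

Let cf := is_derive_continuous df.

Let integrable_trig (h g : R -> R) : measurable_fun setT h -> continuous g ->
  (forall x, `|h x| <= 1) -> (forall x, `|g x| <= C * w x) ->
  leb.-integrable setT (EFin \o (fun x => h x * g x)).
Proof.
move=> mh cg h1 gC; apply: (@integrable_cauchy_bound _ _ C).
  by apply: measurable_funM => //; exact: continuous_measurable_fun.
move=> x; rewrite normrM (le_trans _ (gC x))// ler_piMl//.
Qed.

Let boundary (h1 h2 : R -> R) (p : R) :
  (forall x, `|h1 x| <= 1) -> (forall x, `|h2 x| <= 1) ->
  (h1 n%:R * f1 n%:R + p * (h2 n%:R * f n%:R)) -
  (h1 (- n%:R) * f1 (- n%:R) + p * (h2 (- n%:R) * f (- n%:R)))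
    @[n --> \oo] --> (0 : R).
Proof.
move=> b1 b2.
have b x : `|h1 x * f1 x + p * (h2 x * f x)| <= (1 + `|p|) * C * w x.
  rewrite (le_trans (ler_normD _ _))// -mulrA mulrDl mul1r lerD//.
    by rewrite normrM (le_trans _ (f1C x))// ler_piMl.
  by rewrite !normrM ler_wpM2l// (le_trans _ (fC x))// ler_piMl.
apply: (@norm_cvg0 _ R^o).
apply: (@squeeze_cvgr _ _ _ _ (fun=> 0) (fun n : nat => 2 * ((1 + `|p|) * C) * w (n%:R : R))).
- apply: nearW => n; rewrite normr_ge0/= (le_trans (ler_normB _ _))//.
  by have := b n%:R; have := b (- n%:R); rewrite sqrrN; lra.
- exact: cvg_cst.
- exact: cauchy_weight_nat_cvg.
Qed.

(** Both integrations by parts are done at once: cos(px) f' + p sin(px) f has derivative cos(px)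
    (f'' + p^2 f) and tends to 0 at both ends. *)
Lemma Rintegral_cos_parts (p : R) :
  \int[leb]_x (cos (p * x) * f2 x) = - (p ^+ 2 * \int[leb]_x (cos (p * x) * f x)).
Proof.
have mc : measurable_fun setT (fun x : R => cos (p * x)).
  by apply: measurableT_comp; [exact: measurable_cosR|exact: measurable_funM].
have i2 := integrable_trig mc cf2 (fun=> normr_cos_le1 _) f2C.
have i0 := integrable_trig mc cf (fun=> normr_cos_le1 _) fC.
apply/eqP; rewrite -addr_eq0 -RintegralZl// -RintegralD//; last exact: integrable_mulZl.
apply/eqP; pose F x := cos (p * x) * f1 x + p * (sin (p * x) * f x).
apply: (@Rintegral_line_derive _ F) => [x| | |].
- have := is_derive_add (is_derive_mul (is_derive_cosM p x) (df1 x))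
    (is_derive_mull p (is_derive_mul (is_derive_sinM p x) (df x))).
  by move=> /is_derive_eq; apply; ring.
- move=> x; apply: cvgD; [apply: cvgM|apply: cvgM; [exact: cvg_cst|apply: cvgM]];
    try exact: cf2; try exact: cf.
    exact: (is_derive_continuous (is_derive_cosM p)).
  exact: (is_derive_continuous (is_derive_cosM p)).
- by apply: integrable_add => //; exact: integrable_mulZl.
- exact: (@boundary (fun x => cos (p * x)) (fun x => sin (p * x)) p
    (fun=> normr_cos_le1 _) (fun=> normr_sin_le1 _)).
Qed.

Lemma Rintegral_sin_parts (p : R) :
  \int[leb]_x (sin (p * x) * f2 x) = - (p ^+ 2 * \int[leb]_x (sin (p * x) * f x)).
Proof.
have mc : measurable_fun setT (fun x : R => sin (p * x)).
  by apply: measurableT_comp; [exact: measurable_sinR|exact: measurable_funM].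
have i2 := integrable_trig mc cf2 (fun=> normr_sin_le1 _) f2C.
have i0 := integrable_trig mc cf (fun=> normr_sin_le1 _) fC.
apply/eqP; rewrite -addr_eq0 -RintegralZl// -RintegralD//; last exact: integrable_mulZl.
apply/eqP; pose F x := sin (p * x) * f1 x + (- p) * (cos (p * x) * f x).
apply: (@Rintegral_line_derive _ F) => [x| | |].
- have := is_derive_add (is_derive_mul (is_derive_sinM p x) (df1 x))
    (is_derive_mull (- p) (is_derive_mul (is_derive_cosM p x) (df x))).
  by move=> /is_derive_eq; apply; ring.
- move=> x; apply: cvgD; [apply: cvgM|apply: cvgM; [exact: cvg_cst|apply: cvgM]];
    try exact: cf2; try exact: cf.
    exact: (is_derive_continuous (is_derive_sinM p)).
  exact: (is_derive_continuous (is_derive_sinM p)).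
- by apply: integrable_add => //; exact: integrable_mulZl.
- exact: (@boundary (fun x => sin (p * x)) (fun x => cos (p * x)) (- p)
    (fun=> normr_sin_le1 _) (fun=> normr_cos_le1 _)).
Qed.

End by_parts.

Lemma normr_Rintegral_cauchy f (C : R) : measurable_fun setT f ->
  (forall x, `|f x| <= C * w x) -> `|\int[leb]_x f x| <= C * pi.
Proof.
move=> mf fC; rewrite -(Rintegral_cauchy R) -RintegralZl//; last exact: integrable_cauchy.
apply: normr_Rintegral_le => //; apply: integrable_mulZl => //; exact: integrable_cauchy.
Qed.

Lemma measurable_cos_scale (p : R) : measurable_fun setT (fun x : R => cos (p * x)).
Proof. by apply: measurableT_comp; [exact: measurable_cosR|exact: measurable_funM]. Qed.

Lemma measurable_sin_scale (p : R) : measurable_fun setT (fun x : R => sin (p * x)).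
Proof. by apply: measurableT_comp; [exact: measurable_sinR|exact: measurable_funM]. Qed.

(** The square of the weight is wanted because the symbol may grow like 1 + p^2, and one factor must
    survive to keep the product integrable. Two uses of [parts] bound p^4 times the integral, hence
    the derivatives up to order four. [h] is the cosine or the sine. *)
Lemma schwartz_trig_decay u (h : R -> R -> R) : schwartz u ->
  (forall p, measurable_fun setT (h p)) -> (forall p x, `|h p x| <= 1) ->
  (forall f f1 f2 C, (forall x : R, is_derive x 1 f (f1 x)) ->
    (forall x : R, is_derive x 1 f1 (f2 x)) -> continuous f2 ->
    (forall x, `|f x| <= C * w x) -> (forall x, `|f1 x| <= C * w x) ->
    (forall x, `|f2 x| <= C * w x) -> forall p,
    \int[leb]_x (h p x * f2 x) = - (p ^+ 2 * \int[leb]_x (h p x * f x))) ->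
  exists C : R, 0 <= C /\ forall p, `|\int[leb]_x (h p x * u x)| <= C * w p ^+ 2.
Proof.
move=> su mh h1 parts.
have [C0 [C00 b0]] := schwartz_cauchy_bound 0 su.
have [C1 [C10 b1]] := schwartz_cauchy_bound 1 su.
have [C2 [C20 b2]] := schwartz_cauchy_bound 2 su.
have [C3 [C30 b3]] := schwartz_cauchy_bound 3 su.
have [C4 [C40 b4]] := schwartz_cauchy_bound 4 su.
pose C := C0 + C1 + C2 + C3 + C4.
have C_ge0 : 0 <= C by rewrite /C !addr_ge0.
have bC Ci i : Ci <= C -> (forall x, `|derive1n i u x| <= Ci * w x) ->
    forall x, `|derive1n i u x| <= C * w x.
  move=> CiC bi x; apply: (le_trans (bi x)).
  by rewrite ler_wpM2r// ltW// cauchy_weight_gt0.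
have {}b0 := bC _ _ _ b0; have {}b1 := bC _ _ _ b1; have {}b2 := bC _ _ _ b2.
have {}b3 := bC _ _ _ b3; have {}b4 := bC _ _ _ b4.
have E02 p := parts _ _ _ C (fun x => schwartz_is_derive 0 x su)
  (fun x => schwartz_is_derive 1 x su) (@schwartz_continuous _ 2 su)
  (b0 ltac:(rewrite /C; lra)) (b1 ltac:(rewrite /C; lra)) (b2 ltac:(rewrite /C; lra)) p.
have E24 p := parts _ _ _ C (fun x => schwartz_is_derive 2 x su)
  (fun x => schwartz_is_derive 3 x su) (@schwartz_continuous _ 4 su)
  (b2 ltac:(rewrite /C; lra)) (b3 ltac:(rewrite /C; lra)) (b4 ltac:(rewrite /C; lra)) p.
have B i p : (forall x, `|derive1n i u x| <= C * w x) ->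
    `|\int[leb]_x (h p x * derive1n i u x)| <= C * pi.
  move=> bi; apply: normr_Rintegral_cauchy.
    apply: measurable_funM => //; apply: continuous_measurable_fun.
    exact: schwartz_continuous.
  by move=> x; rewrite normrM (le_trans _ (bi x))// ler_piMl.
exists (2 * (C * pi + C * pi)); split.
  by rewrite mulr_ge0// addr_ge0// mulr_ge0// pi_ge0.
move=> p.
have := B 0 p (b0 ltac:(rewrite /C; lra)).
have := B 4 p (b4 ltac:(rewrite /C; lra)).
rewrite E24 E02 derive1n0; set I := \int[leb]_x _ => B4 B0.
rewrite exprVn ler_pdivlMr ?exprn_gt0 ?ltr_wpDr ?sqr_ge0//.
have B4' : p ^+ 4 * `|I| <= C * pi.
  apply: le_trans B4.
  have -> : - (p ^+ 2 * - (p ^+ 2 * I)) = p ^+ 4 * I by ring.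
  by rewrite normrM ler_wpM2r// ler_norm.
have p4 : (1 + p ^+ 2) ^+ 2 <= 2 * (1 + p ^+ 4).
  have := sqr_ge0 (1 - p ^+ 2); have -> : p ^+ 4 = (p ^+ 2) ^+ 2 by ring.
  by rewrite !expr2; lra.
apply: (@le_trans _ _ (`|I| * (2 * (1 + p ^+ 4)))); first by rewrite ler_wpM2l.
by rewrite mulrCA ler_wpM2l// mulrDr mulr1 lerD// mulrC.
Qed.

Lemma fourier_decay u : schwartz u -> exists C : R, 0 <= C /\ forall p,
  `|Fc u p| <= C * w p ^+ 2 /\ `|Fs u p| <= C * w p ^+ 2.
Proof.
move=> su.
have [C [C0 hC]] := schwartz_trig_decay su measurable_cos_scale
  (fun p x => normr_cos_le1 _) Rintegral_cos_parts.
have [S [S0 hS]] := schwartz_trig_decay su measurable_sin_scale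
  (fun p x => normr_sin_le1 _) Rintegral_sin_parts.
pose c := (Num.sqrt (2 * pi) : R)^-1.
have c0 : 0 <= c by rewrite invr_ge0 sqrtr_ge0.
exists (c * C + c * S); split; first by rewrite addr_ge0// mulr_ge0.
move=> p; rewrite /Fc /Fs -/c !normrM (ger0_norm c0) mulrDl -!mulrA.
have W0 : 0 <= w p ^+ 2 by rewrite sqr_ge0.
split; [rewrite ler_wpDr//|rewrite ler_wpDl//]; rewrite ?ler_wpM2l//.
  by apply: mulr_ge0 => //; exact: mulr_ge0.
by apply: mulr_ge0 => //; exact: mulr_ge0.
Qed.

Lemma fourier_continuous u (C : R) : continuous u ->
  (forall x, `|u x| <= C * w x) -> continuous (Fc u) /\ continuous (Fs u).
Proof.
move=> cu uC; have mu' := continuous_measurable_fun cu.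
have iw : leb.-integrable setT (EFin \o (fun x => C * w x)).
  by apply: integrable_mulZl => //; exact: integrable_cauchy.
split=> p; apply: cvgMr.
- apply: (@continuous_Rintegral_param _ _ _ leb (fun p x => cos (p * x) * u x)
    (fun x => C * w x)) => //.
  + by move=> q; apply: measurable_funM => //; exact: measurable_cos_scale.
  + move=> y q; apply: cvgMl; apply: (cvg_comp (fun q => q * y) cos); last exact: continuous_cos.
    by apply: cvgMl; exact: cvg_id.
  + by move=> q x; rewrite normrM (le_trans _ (uC x))// ler_piMl// normr_cos_le1.
- apply: (@continuous_Rintegral_param _ _ _ leb (fun p x => sin (p * x) * u x)
    (fun x => C * w x)) => //.
  + by move=> q; apply: measurable_funM => //; exact: measurable_sin_scale.
  + move=> y q; apply: cvgMl; apply: (cvg_comp (fun q => q * y) sin); last exact: continuous_sin.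
    by apply: cvgMl; exact: cvg_id.
  + by move=> q x; rewrite normrM (le_trans _ (uC x))// ler_piMl// normr_sin_le1.
Qed.

End fourier.

(** * Fourier inversion by Abel summation *)

Section fourier_inversion.
Variable R : realType.
Local Notation leb := (@lebesgue_measure R).
Local Notation w x := ((1 + x ^+ 2)^-1).
Local Notation c := ((Num.sqrt (2 * pi) : R)^-1).

Lemma fourier_constant_sqr : c * c = (2 * pi)^-1.
Proof. by rewrite -invfM -expr2 sqr_sqrtr// mulr_ge0// pi_ge0. Qed.

Lemma continuous_trig_scale (h : R -> R) (x : R) : continuous h ->
  continuous (fun p : R => h (p * x)).
Proof.
move=> ch p; apply: (cvg_comp (fun q => q * x) h); last exact: ch.
by apply: cvgMl; exact: cvg_id.
Qed.

Lemma measurable_trig_scale (h : R -> R) (x : R) : continuous h ->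
  measurable_fun setT (fun p : R => h (p * x)).
Proof. by move=> ch; apply: continuous_measurable_fun; exact: continuous_trig_scale. Qed.

Section inversion.
Variables (u : R -> R) (C D : R).
Hypothesis cu : continuous u.
Hypothesis uC : forall x, `|u x| <= C * w x.
Hypothesis FcD : forall p, `|Fc u p| <= D * w p.
Hypothesis FsD : forall p, `|Fs u p| <= D * w p.
Variable x : R.

Let mU : measurable_fun setT u := continuous_measurable_fun cu.
Let mFc : measurable_fun setT (Fc u) :=
  continuous_measurable_fun (fourier_continuous cu uC).1.
Let mFs : measurable_fun setT (Fs u) :=
  continuous_measurable_fun (fourier_continuous cu uC).2.
Let g p := cos (p * x) * Fc u p + sin (p * x) * Fs u p.

Let mg : measurable_fun setT g.
Proof.
by apply: measurable_funD; apply: measurable_funM => //; apply: measurable_trig_scale;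
  [exact: continuous_cos|exact: continuous_sin].
Qed.

Let gD p : `|g p| <= 2 * D * w p.
Proof.
have A : `|cos (p * x) * Fc u p| <= D * w p.
  by rewrite normrM (le_trans _ (FcD p))// ler_piMl// normr_cos_le1.
have B : `|sin (p * x) * Fs u p| <= D * w p.
  by rewrite normrM (le_trans _ (FsD p))// ler_piMl// normr_sin_le1.
by apply: (le_trans (ler_normD _ _)); lra.
Qed.

Let intu : leb.-integrable setT (EFin \o u) := integrable_cauchy_bound mU uC.

Let gE p : g p = c * \int[leb]_y (cos (p * (x - y)) * u y).
Proof.
rewrite /g /Fc /Fs mulrCA (mulrCA (sin _)) -mulrDr; congr (_ * _).
have ic : leb.-integrable setT (EFin \o (fun y => cos (p * y) * u y)).
  apply: (@integrable_mul_bounded _ _ _ leb _ _ _ 1) => //.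
    exact: measurable_cos_scale.
  by move=> y _; exact: normr_cos_le1.
have is_ : leb.-integrable setT (EFin \o (fun y => sin (p * y) * u y)).
  apply: (@integrable_mul_bounded _ _ _ leb _ _ _ 1) => //.
    exact: measurable_sin_scale.
  by move=> y _; exact: normr_sin_le1.
rewrite -!RintegralZl// -RintegralD//; [|exact: integrable_mulZl..].
by apply: eq_Rintegral => y _; rewrite mulrBr cosB; ring.
Qed.

(** The damping factor exp(-e|p|) makes the double integral absolutely convergent, so Fubini applies
    and the Abel kernel appears. The substitution y = ez + x then gives a Cauchy average of [u] in
    which [e] occurs only inside the argument of [u]. *)
Let abel_sum (e : R) : 0 < e ->
  c * \int[leb]_p (expR (- (e * `|p|)) * g p) =
  (2 * pi)^-1 * \int[leb]_z (2 * u (e * z + x) * w z).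
Proof.
move=> e0.
have [B hB] := expR_cauchy_bound e0.
have me : measurable_fun setT (fun p : R => expR (- (e * `|p|))).
  by apply: measurableT_comp => //; apply: measurableT_comp => //; apply: measurable_funM.
have ie : leb.-integrable setT (EFin \o (fun p : R => expR (- (e * `|p|)))).
  apply: (@integrable_cauchy_bound _ _ B) => // p.
  by rewrite ger0_norm ?expR_ge0// (le_trans (hB _ (normr_ge0 p)))// real_normK ?num_real.
have -> : \int[leb]_p (expR (- (e * `|p|)) * g p) =
    c * \int[leb]_p \int[leb]_y (expR (- (e * `|p|)) * cos (p * (x - y)) * u y).
  have E p : expR (- (e * `|p|)) * g p =
     c * \int[leb]_y (expR (- (e * `|p|)) * cos (p * (x - y)) * u y).
    rewrite gE mulrCA; congr (_ * _); rewrite -RintegralZl//.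
      by apply: eq_Rintegral => y _; rewrite mulrA.
    apply: (@integrable_mul_bounded _ _ _ leb _ _ _ 1) => //.
      apply: measurableT_comp; first exact: measurable_cosR.
      by apply: measurable_funM => //; apply: measurable_funB.
    by move=> y _; exact: normr_cos_le1.
  under eq_Rintegral do rewrite E.
  rewrite RintegralZl//.
  apply: (@integrable_Rintegral_snd _ _ _ _ _ leb leb
    (fun p y => expR (- (e * `|p|)) * cos (p * (x - y)) * u y)
    (fun p => expR (- (e * `|p|))) (fun y => `|u y|)) => //.
  - apply: measurable_funM; last exact: measurableT_comp.
    apply: measurable_funM; first exact: (measurableT_comp me).
    apply: measurableT_comp; first exact: measurable_cosR.
    by apply: measurable_funM => //; apply: measurable_funB.
  - exact: integrable_normr.
  - move=> p y; rewrite !normrM ler_wpM2r// ger0_norm ?expR_ge0//.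
    by rewrite ler_piMr ?expR_ge0// normr_cos_le1.
rewrite (@Rintegral_fubini _ _ _ _ _ leb leb
    (fun p y => expR (- (e * `|p|)) * cos (p * (x - y)) * u y)
    (fun p => expR (- (e * `|p|))) (fun y => `|u y|)) //; last 3 first.
- apply: measurable_funM; last exact: measurableT_comp.
  apply: measurable_funM; first exact: (measurableT_comp me).
  apply: measurableT_comp; first exact: measurable_cosR.
  by apply: measurable_funM => //; apply: measurable_funB.
- exact: integrable_normr.
- move=> p y; rewrite !normrM ler_wpM2r// ger0_norm ?expR_ge0//.
  by rewrite ler_piMr ?expR_ge0// normr_cos_le1.
rewrite mulrA fourier_constant_sqr; congr (_ * _).
have E y : \int[leb]_p (expR (- (e * `|p|)) * cos (p * (x - y)) * u y) =
    2 * e / (e ^+ 2 + (x - y) ^+ 2) * u y.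
  rewrite -Rintegral_abel_kernel// -RintegralZr//.
    by apply: eq_Rintegral => p _; rewrite (mulrC p).
  under eq_fun do rewrite mulrC.
  apply: (@integrable_mul_bounded _ _ _ leb _ _ _ 1) => //.
    exact: measurable_cos_scale.
  by move=> p _; exact: normr_cos_le1.
under eq_Rintegral do rewrite E.
pose h y := 2 * e / (e ^+ 2 + (x - y) ^+ 2).
have p0 y : 0 < e ^+ 2 + (x - y) ^+ 2 by rewrite ltr_wpDr ?sqr_ge0 ?exprn_gt0.
have h_bound y : `|h y| <= 2 / e.
  rewrite ger0_norm /h; last by apply: divr_ge0; apply: ltW; rewrite ?p0// mulr_gt0.
  rewrite ler_pdivrMr// mulrDr.
  have -> : 2 / e * e ^+ 2 = 2 * e by field; rewrite gt_eqF.
  by rewrite lerDl mulr_ge0 ?sqr_ge0// divr_ge0// ltW.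
have mh : measurable_fun setT h.
  apply: continuous_measurable_fun => y; apply: cvgMr; apply: cvgV; first by rewrite gt_eqF.
  apply: cvgD; first exact: cvg_cst.
  apply: (cvg_comp (fun y => x - y) (fun z => z ^+ 2)); last exact: exprn_continuous.
  by apply: cvgB; [exact: cvg_cst|exact: cvg_id].
have ihu : leb.-integrable setT (EFin \o (fun y => h y * u y)).
  by apply: (@integrable_mul_bounded _ _ _ leb _ _ _ (2 / e)).
have e_neq0 : e != 0 by rewrite gt_eqF.
rewrite -[LHS](@Rintegral_affine _ e x)//; last exact: measurable_funM.
rewrite -RintegralZl//; last exact: (@integrable_affine _ e x (fun y => h y * u y)).
apply: eq_Rintegral => z _; rewrite (gtr0_norm e0) /h.
have -> : e ^+ 2 + (x - (e * z + x)) ^+ 2 = e ^+ 2 * (1 + z ^+ 2) by ring.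
have zn : 1 + z ^+ 2 != 0 by rewrite gt_eqF// ltr_wpDr// sqr_ge0.
by field; rewrite zn.
Qed.

(** Let e = 1/(n+1) in [abel_sum]. On the left [g] dominates; on the right [u] is bounded and
    continuous, and the Cauchy weight has mass pi. *)
Lemma fourier_inversion_bounded : u x = c * \int[leb]_p g p.
Proof.
have mw := integrable_measurable (@integrable_cauchy R).
pose e (n : nat) : R := n.+1%:R^-1.
have e0 n : 0 < e n by rewrite invr_gt0.
have L : c * \int[leb]_p (expR (- (e n * `|p|)) * g p) @[n --> \oo] -->
    c * \int[leb]_p g p.
  apply: cvgMr.
  apply: (@Rintegral_dominated_cvg _ _ _ leb _ _ _ (fun p => 2 * D * w p)) => //.
  - move=> n; apply: measurable_funM => //.
    by apply: measurableT_comp => //; apply: measurableT_comp => //; apply: measurable_funM.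
  - move=> p _; rewrite -[X in _ --> X]mul1r; apply: cvgMl.
    rewrite -expR0; apply: (cvg_comp _ expR); last exact: continuous_expR.
    rewrite -oppr0; apply: cvgN; rewrite -(mul0r `|p|); apply: cvgMl.
    exact: cvg_harmonic.
  - by apply: integrable_mulZl => //; exact: integrable_cauchy.
  - move=> n p _; rewrite normrM ger0_norm ?expR_ge0// (le_trans _ (gD p))// ler_piMl//.
    by rewrite -expR0 ler_expR oppr_le0 mulr_ge0// ltW.
apply/esym/(cvg_unique _ L) => //.
rewrite /=; under eq_cvg do rewrite abel_sum//.
have -> : u x = (2 * pi)^-1 * \int[leb]_z (2 * u x * w z).
  rewrite RintegralZl ?Rintegral_cauchy; [|by []|exact: integrable_cauchy].
  have pn : pi != 0 :> R by rewrite gt_eqF// pi_gt0.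
  by rewrite mulrAC mulrA mulVf ?mul1r// mulf_neq0// pnatr_eq0.
apply: cvgMr.
have bu y : `|u y| <= `|C|.
  rewrite (le_trans (uC y))// (le_trans (ler_norm _))// normrM ler_piMr//.
  by rewrite gtr0_norm ?cauchy_weight_gt0// cauchy_weight_le1.
apply: (@Rintegral_dominated_cvg _ _ _ leb _ _ _ (fun z => 2 * `|C| * w z)) => //.
- move=> n; apply: measurable_funM => //; apply: measurable_funM => //.
  apply: measurableT_comp => //.
  by apply: measurable_funD => //; exact: measurable_funM.
- move=> z _; apply: cvgMl; apply: cvgMr.
  have ez : e n * z + x @[n --> \oo] --> x.
    rewrite -[X in _ --> X]add0r; apply: cvgD; last exact: cvg_cst.
    by rewrite -(mul0r z); apply: cvgMl; exact: cvg_harmonic.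
  by apply: (cvg_comp _ u ez); exact: cu.
- by apply: integrable_mulZl => //; exact: integrable_cauchy.
- move=> n z _; rewrite !normrM gtr0_norm// (gtr0_norm (cauchy_weight_gt0 z)).
  by rewrite ler_wpM2r ?ler_wpM2l// ltW// cauchy_weight_gt0.
Qed.

End inversion.

Lemma fourier_inversion (u : R -> R) (x : R) : schwartz u ->
  u x = c * \int[leb]_p (cos (p * x) * Fc u p + sin (p * x) * Fs u p).
Proof.
move=> su; have [C [C0 uC]] := schwartz_cauchy_bound 0 su.
have [D [D0 FD]] := fourier_decay su.
have ww p : D * w p ^+ 2 <= D * w p.
  by rewrite ler_wpM2l// expr2 ler_piMl ?cauchy_weight_le1// ltW// cauchy_weight_gt0.
apply: (@fourier_inversion_bounded u C D) => //.
- exact: (@schwartz_continuous _ _ 0 su).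
- by move=> p; exact: le_trans (FD p).1 (ww p).
- by move=> p; exact: le_trans (FD p).2 (ww p).
Qed.

End fourier_inversion.

(** * The Riemann-Lebesgue lemma *)

Section riemann_lebesgue.
Variable R : realType.
Local Notation leb := (@lebesgue_measure R).
Local Notation w x := ((1 + x ^+ 2)^-1).

(** Translating p by pi/x flips the sign of h(px), so twice the integral equals that of h(px) (g(p)
    - g(p + pi/x)). It is bounded by the L^1 modulus of continuity [om] of [g], which is continuous
    and vanishes at 0. *)
Lemma riemann_lebesgue (h g : R -> R) (C : R) : continuous h ->
  (forall x, h (x + pi) = - h x) -> (forall x, `|h x| <= 1) ->
  continuous g -> (forall p, `|g p| <= C * w p) ->
  forall e : R, 0 < e -> exists M : R, forall x : R, M < `|x| ->
    `|\int[leb]_p (h (p * x) * g p)| < e.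
Proof.
move=> ch hpi h1 cg gC e e0.
have C0 : 0 <= C.
  by have := gC 0; rewrite expr0n/= addr0 invr1 mulr1; apply: le_trans.
have mg := continuous_measurable_fun cg.
have mshift (a : R) : measurable_fun setT (fun p : R => g (p + a)).
  by apply: measurableT_comp => //; exact: measurable_funD.
have ig : leb.-integrable setT (EFin \o g) by exact: integrable_cauchy_bound gC.
pose om a := \int[leb]_p `|g p - g (p + a)|.
have om0 : om 0 = 0.
  rewrite /om; under eq_Rintegral do rewrite addr0 subrr normr0.
  by rewrite Rintegral_cst// mul0r.
(* For |a| <= 1, p^2 <= 2 (p+a)^2 + 2 gives 1 + p^2 <= 3 (1 + (p+a)^2); the constant 4 is 1 + 3. *)
have bd (a p : R) : `|a| <= 1 -> `|g p - g (p + a)| <= 4 * C * w p.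
  move=> a1; rewrite (le_trans (ler_normB _ _))//.
  have : w (p + a) <= 3 * w p.
    rewrite -ler_pdivrMr ?cauchy_weight_gt0// invrK mulrC ler_pdivrMr; last first.
      by rewrite ltr_wpDr ?sqr_ge0.
    have : `|a| ^+ 2 <= 1 by rewrite expr_le1.
    rewrite real_normK ?num_real// => aa.
    have := sqr_ge0 (p + a + a); have := sqr_ge0 (p + a - a); have := sqr_ge0 p.
    have := sqr_ge0 (2 * (p + a) - p).
    by rewrite !expr2 in aa *; nra.
  have := gC p; have := gC (p + a) => A1 A2 A3.
  by have := ler_wpM2l C0 A3; lra.
have iw : leb.-integrable setT (EFin \o (fun p => 4 * C * w p)).
  by apply: integrable_mulZl => //; exact: integrable_cauchy.
have cd : {in `](-1), 1[%classic, continuous om}.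
  apply: (@continuity_under_integral _ _ _ leb (fun a p => `|g p - g (p + a)|) _
    measurableT (-1) 1 _ _ (fun p => 4 * C * w p) iw).
  - move=> a; rewrite /= in_itv/= => /andP[a1 a2].
    apply: (@integrable_dominated _ _ _ leb _ _ (fun p => 4 * C * w p)) => //.
      apply: measurableT_comp => //.
      exact: (measurable_funB mg (mshift a)).
    by move=> p _; rewrite normr_id bd// ler_norml !ltW.
  - apply: aeW => p _ a _; apply: cvg_norm; apply: cvgB; first exact: cvg_cst.
    apply: (cvg_comp (fun a => p + a) g); last exact: cg.
    by apply: cvgD; [exact: cvg_cst|exact: cvg_id].
  - move=> a; rewrite /= in_itv/= => /andP[a1 a2]; apply: aeW => p _.
    by rewrite normr_id bd// ler_norml !ltW.
have /cvgrPdist_lt /(_ e e0) : om a @[a --> 0] --> om 0.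
  by apply: cd; rewrite inE/= in_itv/= ltrN10 ltr01.
rewrite om0 => /nbhs_ballP[r/= r0 hr].
(* [om] stays below [e] on the ball of radius [r], and |x| > pi/r puts pi/x inside it. *)
exists (pi / r) => x Mx.
have x0 : 0 < `|x| by rewrite (lt_trans _ Mx)// divr_gt0// pi_gt0.
have xn0 : x != 0 by rewrite -normr_gt0.
have ax : `|pi / x| < r.
  rewrite normrM normfV gtr0_norm ?pi_gt0// ltr_pdivrMr// mulrC -ltr_pdivrMr//.
have {hr} := hr (pi / x); rewrite /ball/= sub0r normrN => /(_ ax).
rewrite sub0r normrN ger0_norm; last by apply: Rintegral_ge0.
move=> omx.
have mh : measurable_fun setT (fun p : R => h (p * x)).
  apply: measurableT_comp; first exact: continuous_measurable_fun.
  exact: measurable_funM.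
pose I := \int[leb]_p (h (p * x) * g p).
have igs : leb.-integrable setT (EFin \o (fun p => g (p + pi / x))).
  have := @integrable_affine R 1 (pi / x) g (oner_neq0 _) ig.
  by under eq_fun do rewrite mul1r.
have hI (g' : R -> R) : leb.-integrable setT (EFin \o g') ->
    leb.-integrable setT (EFin \o (fun p => h (p * x) * g' p)).
  by apply: (@integrable_mul_bounded _ _ _ leb _ _ _ 1).
have E : I = - \int[leb]_p (h (p * x) * g (p + pi / x)).
  rewrite /I -(@Rintegral_affine _ 1 (pi / x)) ?oner_neq0//; last exact: measurable_funM.
  rewrite normr1 mul1r -mulN1r -RintegralZl//; last exact: hI.
  apply: eq_Rintegral => p _; rewrite mul1r mulrDl divfK// hpi; ring.
have E2 : 2 * I = \int[leb]_p (h (p * x) * (g p - g (p + pi / x))).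
  under eq_Rintegral do rewrite mulrBr.
  by rewrite RintegralB ?hI//; move: E; rewrite -/I; lra.
have : `|2 * I| < e.
  apply: le_lt_trans omx; rewrite E2; apply: normr_Rintegral_le => //.
  - apply: measurable_funM => //; exact: (measurable_funB mg (mshift _)).
  - by move=> p _; rewrite normrM ler_piMl.
  - by apply: integrable_normr => //; exact: integrable_sub.
by rewrite normrM normr_nat; have := normr_ge0 I; rewrite /I; lra.
Qed.

End riemann_lebesgue.

(** * The stable symbol and the operator on Schwartz functions *)

Section stable_symbol.
Variable R : realType.
Local Notation leb := (@lebesgue_measure R).
Local Notation w x := ((1 + x ^+ 2)^-1).
Local Notation c := ((Num.sqrt (2 * pi) : R)^-1).
Variable delta : R.
Hypothesis delta_gt0 : 0 < delta.
Hypothesis delta_le2 : delta <= 2.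

Lemma continuous_normr_powR : continuous (fun p : R => `|p| `^ delta).
Proof.
move=> p; rewrite /continuous_at; have [->|p0] := eqVneq p 0.
  rewrite normr0 powR0 ?gt_eqF//; apply/cvgrPdist_lt => e e0.
  have r0 : 0 < e `^ delta^-1 by exact: powR_gt0.
  apply/nbhs_ballP; exists (e `^ delta^-1) => //= q; rewrite /ball/= sub0r normrN.
  rewrite sub0r normrN (ger0_norm (powR_ge0 _ _)).
  move=> /(@gt0_ltr_powR _ delta delta_gt0); rewrite -powRrM mulVf ?gt_eqF//.
  by rewrite powRr1 ?ltW//; apply; rewrite nnegrE// ltW.
apply: (cvg_trans _ (_ : expR (delta * ln `|q|) @[q --> p] --> `|p| `^ delta)).
  apply: near_eq_cvg; near=> q.
  rewrite /powR gt_eqF// normr_gt0.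
  near: q; apply/nbhs_ballP; exists `|p|; rewrite /= ?normr_gt0// => q.
  by rewrite /ball/=; apply: contraTneq => ->; rewrite subr0 ltxx.
rewrite /powR gt_eqF ?normr_gt0//.
apply: (cvg_comp _ expR); last exact: continuous_expR.
apply: cvgMr; apply: (cvg_comp _ (@ln R)); last by apply: continuous_ln; rewrite normr_gt0.
exact: norm_continuous.
Unshelve. all: by end_near. Qed.

(** The signed power is the difference of the powers of the positive and the negative part, so
    continuity at 0 reduces to that of |p|^delta. *)
Lemma continuous_sgr_powR : continuous (fun p : R => Num.sg p * `|p| `^ delta).
Proof.
have -> : (fun p : R => Num.sg p * `|p| `^ delta) =
    (fun p => `|(p + `|p|) / 2| `^ delta - `|(`|p| - p) / 2| `^ delta).
  apply/funext => p; have [p0|p0|->] := ltgtP p 0.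
  - rewrite ltr0_sg// (ltr0_norm p0) subrr mul0r normr0 powR0 ?gt_eqF// sub0r mulN1r.
    congr (- (_ `^ _)); rewrite (_ : _ / 2 = - p); last by field.
    by rewrite gtr0_norm// oppr_gt0.
  - rewrite gtr0_sg// (gtr0_norm p0) subrr mul0r normr0 powR0 ?gt_eqF// subr0 mul1r.
    by rewrite (_ : _ / 2 = p) ?gtr0_norm//; field.
  - by rewrite sgr0 mul0r !normr0 addr0 subr0 mul0r subrr.
move=> p; apply: cvgB.
  apply: (cvg_comp _ (fun p : R => `|p| `^ delta)); last exact: continuous_normr_powR.
  by apply: cvgMl; apply: cvgD; [exact: cvg_id|exact: norm_continuous].
apply: (cvg_comp _ (fun p : R => `|p| `^ delta)); last exact: continuous_normr_powR.
by apply: cvgMl; apply: cvgB; [exact: norm_continuous|exact: cvg_id].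
Qed.

Lemma psiRe_continuous : continuous (psiRe delta : R -> R).
Proof. exact: continuous_normr_powR. Qed.

Lemma psiIm_continuous (rho : R) : continuous (psiIm delta rho : R -> R).
Proof.
have -> : psiIm delta rho = fun p : R => (- (rho * tan (pi * delta / 2))) *
    (Num.sg p * `|p| `^ delta).
  by apply/funext => p; rewrite /psiIm; ring.
by move=> p; apply: cvgMr; exact: continuous_sgr_powR.
Qed.

Lemma normr_powR_le (p : R) : `|p| `^ delta <= 1 + p ^+ 2.
Proof.
have [p1|p1] := leP `|p| 1.
  have := @ge0_ler_powR _ delta (ltW delta_gt0) `|p| 1.
  rewrite !nnegrE => /(_ _ _ p1); rewrite powR1 => h.
  by rewrite (le_trans (h _ _))// lerDl sqr_ge0.
have := ler_powR (ltW p1) delta_le2.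
rewrite (_ : 2 = 2%:R :> R)// powR_mulrn// real_normK ?num_real//.
by move=> h; rewrite (le_trans h)// lerDr.
Qed.

Lemma psiRe_bound (p : R) : `|psiRe delta p| <= 1 + p ^+ 2.
Proof. by rewrite ger0_norm ?powR_ge0// normr_powR_le. Qed.

Lemma psiIm_bound (rho p : R) :
  `|psiIm delta rho p| <= `|rho * tan (pi * delta / 2)| * (1 + p ^+ 2).
Proof.
have -> : psiIm delta rho p = - (rho * tan (pi * delta / 2)) *
    (Num.sg p * `|p| `^ delta) by rewrite /psiIm; ring.
rewrite normrM normrN ler_wpM2l// normrM normr_sg ger0_norm ?powR_ge0//.
by rewrite (le_trans _ (normr_powR_le p))// ler_piMl ?powR_ge0//; case: (p != 0).
Qed.

Definition symbol_re (rho : R) (u : R -> R) (p : R) : R :=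
  - psiRe delta p * Fc u p - psiIm delta rho p * Fs u p.
Definition symbol_im (rho : R) (u : R -> R) (p : R) : R :=
  - psiIm delta rho p * Fc u p + psiRe delta p * Fs u p.

Lemma symbol_spec (rho : R) (u : R -> R) : schwartz u ->
  [/\ continuous (symbol_re rho u), continuous (symbol_im rho u) &
   exists C : R, forall p, `|symbol_re rho u p| <= C * w p /\
                  `|symbol_im rho u p| <= C * w p].
Proof.
move=> su; have [D [D0 FD]] := fourier_decay su.
have [C0 [_ uC0]] := schwartz_cauchy_bound 0 su.
have [cc cs] := fourier_continuous (@schwartz_continuous _ _ 0 su) uC0.
split.
- move=> p; apply: cvgB; apply: cvgM; [|exact: cc|exact: psiIm_continuous|exact: cs].
  by apply: cvgN; exact: psiRe_continuous.
- move=> p; apply: cvgD; apply: cvgM; [|exact: cc|exact: psiRe_continuous|exact: cs].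
  by apply: cvgN; exact: psiIm_continuous.
pose B := `|rho * tan (pi * delta / 2)|.
have prod (a b K p : R) : 0 <= K -> `|a| <= K * (1 + p ^+ 2) -> `|b| <= D * w p ^+ 2 ->
    `|a * b| <= K * D * w p.
  move=> K0 ha hb; rewrite normrM.
  apply: (le_trans (ler_pM (normr_ge0 _) (normr_ge0 _) ha hb)).
  rewrite le_eqVlt; apply/orP; left; apply/eqP.
  have ? : 1 + p ^+ 2 != 0 by rewrite gt_eqF// ltr_wpDr// sqr_ge0.
  by field.
exists (1 * D + B * D) => p; rewrite mulrDl.
have hr : `|psiRe delta p| <= 1 * (1 + p ^+ 2) by rewrite mul1r psiRe_bound.
have hi := psiIm_bound rho p.
split.
  apply: (le_trans (ler_normB _ _)); apply: lerD.
    by apply: prod; [exact: ler01|rewrite normrN|exact: (FD p).1].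
  by apply: prod; [exact: normr_ge0|exact: hi|exact: (FD p).2].
apply: (le_trans (ler_normD _ _)); rewrite addrC; apply: lerD.
  by apply: prod; [exact: ler01|exact: hr|exact: (FD p).2].
by apply: prod; [exact: normr_ge0|rewrite normrN; exact: hi|exact: (FD p).1].
Qed.

(** Continuity is dominated convergence; decay is the Riemann-Lebesgue lemma for the cosine and the
    sine part separately. *)
Lemma inverse_fourier_C_infty (a b : R -> R) (C : R) :
  continuous a -> continuous b ->
  (forall p, `|a p| <= C * w p) -> (forall p, `|b p| <= C * w p) ->
  C_infty (fun x => c * \int[leb]_p (cos (p * x) * a p - sin (p * x) * b p)) /\
  forall x, `|c * \int[leb]_p (cos (p * x) * a p - sin (p * x) * b p)| <=
    c * (2 * C * pi).
Proof.
move=> ca cb aC bC.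
have c0 : 0 < c by rewrite invr_gt0 sqrtr_gt0 mulr_gt0// pi_gt0.
have mcos x : measurable_fun setT (fun p : R => cos (p * x)).
  by apply: measurable_trig_scale; exact: continuous_cos.
have msin x : measurable_fun setT (fun p : R => sin (p * x)).
  by apply: measurable_trig_scale; exact: continuous_sin.
have ma := continuous_measurable_fun ca; have mb := continuous_measurable_fun cb.
have bnd x p : `|cos (p * x) * a p - sin (p * x) * b p| <= 2 * C * w p.
  have A : `|cos (p * x) * a p| <= C * w p.
    by rewrite normrM (le_trans _ (aC p))// ler_piMl// normr_cos_le1.
  have B : `|sin (p * x) * b p| <= C * w p.
    by rewrite normrM (le_trans _ (bC p))// ler_piMl// normr_sin_le1.
  by apply: (le_trans (ler_normB _ _)); lra.
have mF (x : R) : measurable_fun setT (fun p : R => cos (p * x) * a p - sin (p * x) * b p).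
  by apply: measurable_funB; apply: measurable_funM.
split; last first.
  move=> x; rewrite normrM (gtr0_norm c0); apply: (ler_wpM2l (ltW c0)).
  exact: (normr_Rintegral_cauchy (mF x) (bnd x)).
split.
  move=> x; apply: cvgMr.
  apply: (@continuous_Rintegral_param _ _ _ leb
    (fun x p => cos (p * x) * a p - sin (p * x) * b p) (fun p => 2 * C * w p)) => //.
    move=> p y; apply: cvgB; apply: cvgMl.
      apply: (cvg_comp (fun x => p * x) cos); last exact: continuous_cos.
      by apply: cvgMr; exact: cvg_id.
    apply: (cvg_comp (fun x => p * x) sin); last exact: continuous_sin.
    by apply: cvgMr; exact: cvg_id.
  by apply: integrable_mulZl => //; exact: integrable_cauchy.
move=> e e0.
have e2 : 0 < e / c / 2 by rewrite !divr_gt0.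
have sinpi (x : R) : sin (x + pi) = - sin x by exact: sinDpi.
have [M1 h1] := riemann_lebesgue (@continuous_cos R) (@cosDpi R) (@normr_cos_le1 R) ca aC e2.
have [M2 h2] := riemann_lebesgue (@continuous_sin R) sinpi (@normr_sin_le1 R) cb bC e2.
exists (Num.max M1 M2) => x; rewrite gt_max => /andP[x1 x2].
have {h1} := h1 x x1; have {h2} := h2 x x2 => h2 h1.
rewrite normrM (gtr0_norm c0) -ltr_pdivlMl// mulrC.
have ia : leb.-integrable setT (EFin \o (fun p => cos (p * x) * a p)).
  apply: (@integrable_mul_bounded _ _ _ leb _ _ _ 1) => //.
  - exact: mcos.
  - by move=> p _; exact: normr_cos_le1.
  - exact: integrable_cauchy_bound aC.
have ib : leb.-integrable setT (EFin \o (fun p => sin (p * x) * b p)).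
  apply: (@integrable_mul_bounded _ _ _ leb _ _ _ 1) => //.
  - exact: msin.
  - by move=> p _; exact: normr_sin_le1.
  - exact: integrable_cauchy_bound bC.
rewrite RintegralB//; apply: (le_lt_trans (ler_normB _ _)).
by rewrite -/(e / c) (splitr (e / c)) ltrD.
Qed.

Lemma LopE (rho : R) (u : R -> R) x : Lop delta rho u x =
  c * \int[leb]_p (cos (p * x) * symbol_re rho u p - sin (p * x) * symbol_im rho u p).
Proof. by []. Qed.

Lemma Lop_C_infty (rho : R) (u : R -> R) : schwartz u ->
  C_infty (Lop delta rho u) /\ exists B : R, forall x, `|Lop delta rho u x| <= B.
Proof.
move=> su; have [cr ci [C hC]] := symbol_spec rho su.
have [h1 h2] := inverse_fourier_C_infty cr ci (fun p => (hC p).1) (fun p => (hC p).2).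
by split; [exact: h1|exists (c * (2 * C * pi))].
Qed.

Lemma schwartz_C_infty (u : R -> R) : schwartz u ->
  C_infty u /\ exists B : R, forall x, `|u x| <= B.
Proof.
move=> su; have [C0 [C00 uC]] := schwartz_cauchy_bound 0 su.
split; last first.
  by exists C0 => x; rewrite (le_trans (uC x))// ler_piMr// cauchy_weight_le1.
split; first exact: (@schwartz_continuous _ _ 0 su).
move=> e e0; exists (1 + C0 / e) => x Mx.
apply: (le_lt_trans (uC x)); rewrite ltr_pdivrMr ?ltr_wpDr ?sqr_ge0//.
rewrite mulrC -ltr_pdivrMr//.
have Ce : 0 <= C0 / e by rewrite divr_ge0// ltW.
have : `|x| <= `|x| ^+ 2 by rewrite expr2 ler_peMr// ltW// (le_lt_trans _ Mx)// lerDl.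
by rewrite real_normK ?num_real//; lra.
Qed.

End stable_symbol.

(** * Averages over random shifts and their truncation *)

Section expectation.
Context (R : realType) (d : measure_display) (T : measurableType d).
Variable P : probability T R.

Lemma integrable_prob_bounded (f : T -> R) (B : R) : measurable_fun setT f ->
  (forall t, `|f t| <= B) -> P.-integrable setT (EFin \o f).
Proof.
move=> mf fB; apply: (@integrable_dominated _ _ _ P _ _ (cst B)) => //.
exact: finite_measure_integrable_cst.
Qed.

Lemma Rintegral_prob_cst (r : R) : \int[P]_w r = r.
Proof. by rewrite Rintegral_cst// (congr1 fine (probability_setT P)) mulr1. Qed.

Lemma normr_expect_le (f : T -> R) (B : R) : measurable_fun setT f ->
  (forall t, `|f t| <= B) -> `|\int[P]_w f w| <= B.
Proof.
move=> mf fB; rewrite -[leRHS]Rintegral_prob_cst; apply: normr_Rintegral_le => //.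
exact: finite_measure_integrable_cst.
Qed.

End expectation.

Section convolution.
Context (R : realType) (d : measure_display) (T : measurableType d).
Variables (P : probability T R) (X : T -> R).
Hypothesis mX : measurable_fun setT X.
Local Notation leb := (@lebesgue_measure R).
Local Notation w x := ((1 + x ^+ 2)^-1).
Local Notation c := ((Num.sqrt (2 * pi) : R)^-1).

(** Restricting the law of [X] to a compact interval makes the averaged function rapidly decreasing
    whatever the tails of [X]. *)
Definition trunc (n : nat) (t : T) : R := \1_(X @^-1` `[- n%:R, n%:R]) t.

Lemma truncE n t : trunc n t = ((`|X t| <= n%:R)%R)%:R.
Proof.
rewrite /trunc indicE; congr (nat_of_bool _)%:R.
by apply/idP/idP; rewrite inE/= in_itv/= -ler_norml.
Qed.

Lemma measurable_trunc n : measurable_fun setT (trunc n).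
Proof.
by apply: measurable_indic; rewrite -[_ @^-1` _]setTI; apply: mX => //; exact: measurable_itv.
Qed.

Lemma trunc_ge0 n t : 0 <= trunc n t. Proof. by rewrite truncE ler0n. Qed.
Lemma trunc_le1 n t : trunc n t <= 1. Proof. by rewrite truncE lern1 leq_b1. Qed.
Lemma normr_trunc_le1 n t : `|trunc n t| <= 1.
Proof. by rewrite ger0_norm ?trunc_ge0 ?trunc_le1. Qed.

Lemma tail_cvg : \int[P]_t (1 - trunc n t) @[n --> \oo] --> (0 : R).
Proof.
rewrite -[X in _ --> X](Rintegral_prob_cst P).
apply: (@Rintegral_dominated_cvg _ _ _ P _ _ _ (cst 1)) => //.
- by move=> n; apply: measurable_funB => //; exact: measurable_trunc.
- move=> t _; apply: cvg_near_cst; near=> n.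
  rewrite truncE (_ : _ <= _) ?subrr//; near: n; exact: nbhs_infty_ger.
- exact: finite_measure_integrable_cst.
- move=> n t _; rewrite ger0_norm ?subr_ge0 ?trunc_le1// lerBlDr lerDl.
  exact: trunc_ge0.
Unshelve. all: by end_near. Qed.

Lemma measurable_shift (v : R -> R) x : measurable_fun setT v ->
  measurable_fun setT (fun t => v (x + X t)).
Proof. by move=> mv; apply: measurableT_comp => //; exact: measurable_funD. Qed.

(** The bound is free of x: the tail mass of [X] controls the error in the supremum norm, for any
    bounded measurable [v]. *)
Lemma trunc_expect_bound (v : R -> R) (B : R) (n : nat) x :
  measurable_fun setT v -> (forall x, `|v x| <= B) ->
  `|\int[P]_t (trunc n t * v (x + X t)) - \int[P]_t v (x + X t)| <=
  B * \int[P]_t (1 - trunc n t).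
Proof.
move=> mv vB.
have B0 : 0 <= B by exact: le_trans (vB 0).
have mvs := @measurable_shift v x mv.
have iv : P.-integrable setT (EFin \o (fun t => v (x + X t))).
  exact: integrable_prob_bounded.
have mtr := measurable_trunc n.
have i1 : P.-integrable setT (EFin \o (fun t => 1 - trunc n t)).
  apply: (@integrable_prob_bounded _ _ _ _ _ 1).
    exact: measurable_funB.
  move=> t; rewrite ger0_norm ?subr_ge0 ?trunc_le1// lerBlDr lerDl.
  exact: trunc_ge0.
rewrite -RintegralB//; last first.
  by apply: (@integrable_mul_bounded _ _ _ P _ _ _ 1) => // t _; exact: normr_trunc_le1.
rewrite -RintegralZl//; apply: normr_Rintegral_le => //.
- by apply: measurable_funB => //; exact: measurable_funM.
- move=> t _; rewrite -[X in _ - X]mul1r -mulrBl normrM mulrC distrC.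
  by rewrite (ger0_norm (_ : 0 <= 1 - _)) ?subr_ge0 ?trunc_le1// ler_wpM2r// subr_ge0 trunc_le1.
- exact: integrable_mulZl.
Qed.

(** The tail of [X] beyond some N contributes at most e/4. On the rest the shift is at most N, so
    |x| > M + N keeps x + X where [v] is small. *)
Lemma expect_shift_C_infty (v : R -> R) (B : R) : C_infty v ->
  (forall x, `|v x| <= B) -> C_infty (fun x => \int[P]_t v (x + X t)).
Proof.
move=> [cv v0] vB.
have B0 : 0 <= B by exact: le_trans (vB 0).
have mv := continuous_measurable_fun cv.
split.
  apply: (@continuous_Rintegral_param _ _ _ P (fun x t => v (x + X t)) (cst B)) => //.
  - by move=> x; exact: measurable_shift.
  - move=> t x; apply: (cvg_comp (fun x => x + X t) v); last exact: cv.
    by apply: cvgD; [exact: cvg_id|exact: cvg_cst].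
  - exact: finite_measure_integrable_cst.
move=> e e0.
have e4 : 0 < e / 4 / (B + 1) by rewrite !divr_gt0// ltr_wpDl.
have /cvgrPdist_lt /(_ _ e4) [N _ /(_ N (leqnn _))] := tail_cvg.
rewrite sub0r normrN => tN.
have [M hM] := v0 _ (divr_gt0 e0 (ltr0n _ 4)).
exists (M + N%:R) => x Mx.
set I := \int[P]_t _; pose J := \int[P]_t (trunc N t * v (x + X t)).
have h1 : `|J - I| <= B * \int[P]_t (1 - trunc N t) by exact: trunc_expect_bound.
have h2 : B * \int[P]_t (1 - trunc N t) <= e / 4.
  apply: (@le_trans _ _ (B * (e / 4 / (B + 1)))).
    by rewrite ler_wpM2l// ltW// (le_lt_trans (ler_norm _)).
  have -> : B * (e / 4 / (B + 1)) = e / 4 * (B / (B + 1)) by ring.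
  rewrite ler_piMr ?(ltW (divr_gt0 e0 _))//.
  by rewrite ler_pdivrMr ?ltr_wpDl// mul1r lerDl.
have h3 : `|J| <= e / 4.
  apply: normr_expect_le.
    by apply: measurable_funM; [exact: measurable_trunc|exact: measurable_shift].
  move=> t; rewrite truncE; case: (leP `|X t| N%:R) => [XN|_]; last first.
    by rewrite mul0r normr0 ltW// divr_gt0.
  rewrite mul1r ltW//; apply: hM.
  have := ler_normB (x + X t) (X t); rewrite addrK; lra.
have := ler_distD J 0 I; rewrite sub0r normrN sub0r normrN.
lra.
Qed.

Lemma is_derive_expect_shift (v v' : R -> R) (B : R) (g : T -> R) :
  (forall x : R, is_derive x 1 v (v' x)) -> measurable_fun setT v' ->
  (forall x, `|v x| <= B) -> (forall x, `|v' x| <= B) ->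
  measurable_fun setT g -> (forall t, `|g t| <= 1) ->
  forall x : R, is_derive x 1 (fun x => \int[P]_t (g t * v (x + X t)))
    (\int[P]_t (g t * v' (x + X t))).
Proof.
move=> dv mv' vB v'B mg g1 x.
have B0 : 0 <= B by exact: le_trans (vB 0).
have mv : measurable_fun setT v.
  by apply: continuous_measurable_fun; exact: (is_derive_continuous dv).
pose f x t := g t * v (x + X t).
have df (y : R) (t : T) : is_derive y 1 (f ^~ t) (g t * v' (y + X t)).
  apply: is_derive_mull.
  have h : is_derive y 1 (fun x : R => x + X t) (1 + 0) by exact: is_derive_add.
  have := @is_derive1_comp _ v _ y _ _ (dv (y + X t)) h.
  by move=> /is_derive_eq; apply; rewrite addr0 mulr1.
have d1 y t : partial1of2 f y t = g t * v' (y + X t).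
  by rewrite partial1of2E; have [] := df y t.
have xI : `](x - 1), (x + 1)[%classic x by rewrite /= in_itv/=; lra.
have intf y : `](x - 1), (x + 1)[%classic y -> P.-integrable setT (EFin \o f y).
  move=> _; apply: (@integrable_prob_bounded _ _ _ _ _ B).
    by apply: measurable_funM => //; exact: measurable_shift.
  by move=> t; rewrite normrM (le_trans _ (vB (y + X t)))// ler_piMl.
have derf y t : `](x - 1), (x + 1)[%classic y -> setT t -> derivable (f ^~ t) y 1.
  by move=> _ _; have [] := df y t.
have intB : P.-integrable setT (EFin \o (cst B)) by exact: finite_measure_integrable_cst.
have bd y t : `](x - 1), (x + 1)[%classic y -> setT t -> `|partial1of2 f y t| <= cst B t.
  by move=> _ _; rewrite d1 normrM (le_trans _ (v'B (y + X t)))// ler_piMl.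
apply: DeriveDef.
  exact: (derivable_under_integral measurableT xI intf derf (fun=> B0) intB bd).
rewrite -derive1E (differentiation_under_integral measurableT xI intf derf (fun=> B0) intB bd).
by apply: eq_Rintegral => t _; rewrite d1.
Qed.

Lemma schwartz_trunc_expect (u : R -> R) (n : nat) : schwartz u ->
  schwartz (fun x => \int[P]_t (trunc n t * u (x + X t))).
Proof.
move=> su.
have mu' j : measurable_fun setT (derive1n j u).
  by apply: continuous_measurable_fun; exact: schwartz_continuous.
pose phi j x := \int[P]_t (trunc n t * derive1n j u (x + X t)).
have dphi j (x : R) : is_derive x 1 (phi j) (phi j.+1 x).
  have [C1 [C10 h1]] := schwartz_cauchy_bound j su.
  have [C2 [C20 h2]] := schwartz_cauchy_bound j.+1 su.
  have W (C y : R) : 0 <= C -> C * w y <= C.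
    by move=> ?; rewrite ler_piMr// cauchy_weight_le1.
  apply: (@is_derive_expect_shift _ _ (C1 + C2)) => //.
  - by move=> y; exact: schwartz_is_derive.
  - by move=> y; have := h1 y; have := W C1 y C10; lra.
  - by move=> y; have := h2 y; have := W C2 y C20; lra.
  - exact: measurable_trunc.
  - by move=> t; exact: normr_trunc_le1.
have phiE j : derive1n j (phi 0) = phi j.
  elim: j => [|j IH]; first by rewrite derive1n0.
  by rewrite derive1nS IH; apply/funext => x; rewrite derive1E; have [] := dphi j x.
split=> [j x|m j].
  by rewrite -/(phi 0) phiE; have [] := dphi j x.
rewrite -/(phi 0) phiE.
have [C1 hC1] := su.2 m j; have [C2 hC2] := su.2 0 j.
(* On |X| <= n one has |x|^m <= (2 max(|x+X|, n))^m <= 2^m (|x+X|^m + n^m); [C1] and [C2] bound the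
   two resulting terms. *)
exists (2 ^+ m * (C1 + n%:R ^+ m * C2)) => x.
rewrite /phi -RintegralZl//; last first.
  apply: (@integrable_prob_bounded _ _ _ _ _ C2).
    by apply: measurable_funM; [exact: measurable_trunc|exact: measurable_shift].
  move=> t; rewrite normrM; have := hC2 (x + X t); rewrite expr0 mul1r.
  by apply: le_trans; rewrite ler_piMl// normr_trunc_le1.
apply: normr_expect_le.
  apply: measurable_funM => //.
  by apply: measurable_funM; [exact: measurable_trunc|exact: measurable_shift].
move=> t; rewrite truncE; case: (leP `|X t| n%:R) => [Xn|_]; last first.
  rewrite mul0r mulr0 normr0 mulr_ge0// addr_ge0//.
    by have := hC1 0; apply: le_trans.
  by rewrite mulr_ge0//; have := hC2 0; apply: le_trans.
rewrite mul1r normrM normrX.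
have := hC1 (x + X t); have := hC2 (x + X t); rewrite expr0 mul1r normrM normrX.
set D := `|derive1n j u _| => H2 H1.
have D0 : 0 <= D by exact: normr_ge0.
have xm : `|x| ^+ m <= 2 ^+ m * (`|x + X t| ^+ m + n%:R ^+ m).
  have : `|x| <= `|x + X t| + n%:R.
    by have := ler_normB (x + X t) (X t); rewrite addrK; lra.
  move=> xle.
  pose mx := Num.max `|x + X t| n%:R.
  have mx0 : 0 <= mx by rewrite le_max normr_ge0.
  have : `|x| ^+ m <= (2 * mx) ^+ m.
    rewrite lerXn2r ?nnegrE ?mulr_ge0//.
    by rewrite (le_trans xle)// mulr_natl mulr2n lerD// le_max lexx ?orbT.
  rewrite exprMn => h; apply: (le_trans h); rewrite ler_wpM2l ?exprn_ge0//.
  rewrite /mx; case: (leP `|x + X t| n%:R) => _.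
    by rewrite lerDr exprn_ge0.
  by rewrite lerDl exprn_ge0.
apply: (le_trans (ler_wpM2r D0 xm)); rewrite -mulrA ler_wpM2l ?exprn_ge0//.
by rewrite mulrDl lerD// ler_wpM2l// exprn_ge0.
Qed.

End convolution.

(** * Fourier multipliers commute with random shifts *)

Section fourier_of_convolution.
Context (R : realType) (d : measure_display) (T : measurableType d).
Variables (P : probability T R) (X : T -> R).
Hypothesis mX : measurable_fun setT X.
Local Notation leb := (@lebesgue_measure R).
Local Notation w x := ((1 + x ^+ 2)^-1).
Local Notation c := ((Num.sqrt (2 * pi) : R)^-1).

Lemma measurable_trigX (h : R -> R) (p : R) : continuous h ->
  measurable_fun setT (fun t => h (p * X t)).
Proof.
move=> ch; apply: measurableT_comp; first exact: continuous_measurable_fun.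
exact: measurable_funM.
Qed.

(** In complex form, E g e^(ipX) = Cg + i Sg multiplies a + ib under the inverse transform; this is
    Fubini and the addition formulas. The weight [g] covers both the truncated and the full
    expectation. *)
Lemma expect_inverse_fourier (g : T -> R) (a b : R -> R) (C x : R) :
  measurable_fun setT g -> (forall t, `|g t| <= 1) ->
  measurable_fun setT a -> measurable_fun setT b ->
  (forall p, `|a p| <= C * w p) -> (forall p, `|b p| <= C * w p) ->
  let Cg p := \int[P]_t (g t * cos (p * X t)) in
  let Sg p := \int[P]_t (g t * sin (p * X t)) in
  \int[P]_t (g t * \int[leb]_p (cos (p * (x + X t)) * a p - sin (p * (x + X t)) * b p)) =
  \int[leb]_p (cos (p * x) * (Cg p * a p - Sg p * b p) -
               sin (p * x) * (Sg p * a p + Cg p * b p)).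
Proof.
move=> mg g1 ma mb aC bC Cg Sg.
have mcX (h : R -> R) (ch : continuous h) :
    measurable_fun setT (fun z : T * R => h (z.2 * (x + X z.1))).
  apply: measurableT_comp; first exact: continuous_measurable_fun.
  apply: measurable_funM => //; apply: measurable_funD => //.
  exact: measurableT_comp.
pose F t p := g t * (cos (p * (x + X t)) * a p - sin (p * (x + X t)) * b p).
have mF : measurable_fun setT (fun z : T * R => F z.1 z.2).
  apply: measurable_funM; first exact: measurableT_comp.
  apply: measurable_funB; apply: measurable_funM; try exact: measurableT_comp.
    by apply: mcX; exact: continuous_cos.
  by apply: mcX; exact: continuous_sin.
have bnd t p : `|cos (p * (x + X t)) * a p - sin (p * (x + X t)) * b p| <= 2 * C * w p.
  have A : `|cos (p * (x + X t)) * a p| <= C * w p.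
    by rewrite normrM (le_trans _ (aC p))// ler_piMl// normr_cos_le1.
  have B : `|sin (p * (x + X t)) * b p| <= C * w p.
    by rewrite normrM (le_trans _ (bC p))// ler_piMl// normr_sin_le1.
  by apply: (le_trans (ler_normB _ _)); lra.
have Fb t p : `|F t p| <= cst 1 t * (2 * C * w p).
  by rewrite normrM mul1r (le_trans _ (bnd t p))// ler_piMl.
have iw : leb.-integrable setT (EFin \o (fun p => 2 * C * w p)).
  by apply: integrable_mulZl => //; exact: integrable_cauchy.
have i1 : P.-integrable setT (EFin \o (cst 1)) by exact: finite_measure_integrable_cst.
transitivity (\int[P]_t \int[leb]_p F t p).
  apply: eq_Rintegral => t _; rewrite -RintegralZl//.
  apply: (@integrable_cauchy_bound _ _ (2 * C)); last exact: bnd.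
  have mtr (h : R -> R) (ch : continuous h) : measurable_fun setT (fun p : R => h (p * (x + X t))).
    exact: measurable_trig_scale.
  by apply: measurable_funB; apply: measurable_funM => //; apply: mtr;
    [exact: continuous_cos|exact: continuous_sin].
rewrite (@Rintegral_fubini _ _ _ _ _ P leb F _ _ mF i1 iw Fb); apply: eq_Rintegral => p _.
have ic : P.-integrable setT (EFin \o (fun t => g t * cos (p * X t))).
  apply: (@integrable_prob_bounded _ _ _ _ _ 1).
    by apply: measurable_funM => //; apply: measurable_trigX; exact: continuous_cos.
  by move=> t; rewrite normrM -[leRHS]mulr1 ler_pM// normr_cos_le1.
have is_ : P.-integrable setT (EFin \o (fun t => g t * sin (p * X t))).
  apply: (@integrable_prob_bounded _ _ _ _ _ 1).
    by apply: measurable_funM => //; apply: measurable_trigX; exact: continuous_sin.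
  by move=> t; rewrite normrM -[leRHS]mulr1 ler_pM// normr_sin_le1.
transitivity (\int[P]_t ((cos (p * x) * a p - sin (p * x) * b p) * (g t * cos (p * X t)) +
    (- (sin (p * x) * a p) - cos (p * x) * b p) * (g t * sin (p * X t)))).
  by apply: eq_Rintegral => t _; rewrite /F (mulrDr p) cosD sinD; ring.
rewrite RintegralD//; [|exact: integrable_mulZl..].
by rewrite !RintegralZl// -/(Cg p) -/(Sg p); ring.
Qed.

Section truncated.
Variables (u : R -> R) (n : nat).
Hypothesis su : schwartz u.
Let phi x := \int[P]_t (trunc X n t * u (x + X t)).
Let Cn p := \int[P]_t (trunc X n t * cos (p * X t)).
Let Sn p := \int[P]_t (trunc X n t * sin (p * X t)).

Let trig_trunc (h : R -> R) (p : R) : continuous h -> (forall x, `|h x| <= 1) ->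
  \int[leb]_x (h (p * x) * phi x) =
  \int[P]_t (trunc X n t * \int[leb]_y (h (p * y - p * X t) * u y)).
Proof.
move=> ch h1.
have [C [C0 uC]] := schwartz_cauchy_bound 0 su.
have cu : continuous u := @schwartz_continuous _ _ 0 su.
have mu' : measurable_fun setT u := continuous_measurable_fun cu.
have mtr := measurable_trunc mX n.
have mh : measurable_fun setT h := continuous_measurable_fun ch.
pose F (x : R) t := h (p * x) * (trunc X n t * u (x + X t)).
have mF : measurable_fun setT (fun z : R * T => F z.1 z.2).
  apply: measurable_funM.
    by apply: measurableT_comp => //; exact: measurable_funM.
  apply: measurable_funM; first exact: measurableT_comp.
  apply: measurableT_comp => //; apply: measurable_funD => //.
  exact: measurableT_comp.
have Fb x t : `|F x t| <= (2 * (1 + n%:R ^+ 2) * C * w x) * cst 1 t.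
  rewrite mulr1 /F normrM (le_trans (ler_piMl _ (h1 _)))// truncE.
  case: (leP `|X t| n%:R) => [Xn|_]; last first.
    rewrite mul0r normr0; apply: mulr_ge0; last by rewrite ltW ?cauchy_weight_gt0.
    by apply: mulr_ge0 => //; apply: mulr_ge0 => //; rewrite addr_ge0// sqr_ge0.
  rewrite mul1r (le_trans (uC _))//.
  (* On |X| <= n, x^2 <= 2 (x+X)^2 + 2 n^2, whence 1 + x^2 <= 2 (1 + n^2) (1 + (x+X)^2). *)
  rewrite (_ : 2 * _ * C * _ = C * (2 * (1 + n%:R ^+ 2) * w x)); last by ring.
  rewrite ler_wpM2l// -ler_pdivrMr ?cauchy_weight_gt0// invrK mulrC.
  rewrite ler_pdivrMr ?ltr_wpDr ?sqr_ge0//.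
  have : `|X t| ^+ 2 <= n%:R ^+ 2 by rewrite lerXn2r ?nnegrE.
  rewrite real_normK ?num_real//.
  have := sqr_ge0 (x + 2 * X t); have := sqr_ge0 ((x + X t) * n%:R).
  have := sqr_ge0 (x + X t).
  by rewrite !expr2; nra.
have iw : leb.-integrable setT (EFin \o (fun x => 2 * (1 + n%:R ^+ 2) * C * w x)).
  by apply: integrable_mulZl => //; exact: integrable_cauchy.
have i1 : P.-integrable setT (EFin \o (cst 1)) by exact: finite_measure_integrable_cst.
transitivity (\int[leb]_x \int[P]_t F x t).
  apply: eq_Rintegral => x _; rewrite -RintegralZl//.
  apply: (@integrable_prob_bounded _ _ _ _ _ C).
    by apply: measurable_funM => //; exact: measurable_shift.
  move=> t; rewrite normrM (le_trans (ler_piMl _ (normr_trunc_le1 _ _ _)))//.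
  by rewrite (le_trans (uC _))// ler_piMr// cauchy_weight_le1.
rewrite (@Rintegral_fubini _ _ _ _ _ leb P F _ _ mF iw i1 Fb); apply: eq_Rintegral => t _.
have mhs : measurable_fun setT (fun y : R => h (p * y - p * X t)).
  by apply: measurableT_comp => //; apply: measurable_funB => //; exact: measurable_funM.
rewrite -[in RHS](@Rintegral_affine _ 1 (X t)) ?oner_neq0//; last exact: measurable_funM.
rewrite normr1 mul1r -RintegralZl//.
  apply: eq_Rintegral => x _; rewrite /F mul1r mulrDr addrK; ring.
apply: (@integrable_affine _ 1 (X t) (fun y => h (p * y - p * X t) * u y)) => //.
apply: (@integrable_cauchy_bound _ _ C); first exact: measurable_funM.
by move=> y; rewrite normrM (le_trans _ (uC y))// ler_piMl.
Qed.

Let trig_shift (h : R -> R) (p q : R) : continuous h -> (forall x, `|h x| <= 1) ->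
  leb.-integrable setT (EFin \o (fun y => h (p * y) * u y)).
Proof.
move=> ch h1; have [C [C0 uC]] := schwartz_cauchy_bound 0 su.
apply: (@integrable_cauchy_bound _ _ C).
  apply: measurable_funM; last first.
    exact: continuous_measurable_fun (@schwartz_continuous _ _ 0 su).
  apply: measurableT_comp; first exact: continuous_measurable_fun.
  exact: measurable_funM.
by move=> y; rewrite normrM (le_trans _ (uC y))// ler_piMl.
Qed.

Let iC p : P.-integrable setT (EFin \o (fun t => trunc X n t * cos (p * X t))).
Proof.
apply: (@integrable_prob_bounded _ _ _ _ _ 1).
  apply: measurable_funM; first exact: measurable_trunc.
  by apply: measurable_trigX; exact: continuous_cos.
by move=> t; rewrite normrM -[leRHS]mulr1 ler_pM// ?normr_cos_le1// normr_trunc_le1.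
Qed.

Let iS p : P.-integrable setT (EFin \o (fun t => trunc X n t * sin (p * X t))).
Proof.
apply: (@integrable_prob_bounded _ _ _ _ _ 1).
  apply: measurable_funM; first exact: measurable_trunc.
  by apply: measurable_trigX; exact: continuous_sin.
by move=> t; rewrite normrM -[leRHS]mulr1 ler_pM// ?normr_sin_le1// normr_trunc_le1.
Qed.

(** Together with [Fs_trunc], this is the convolution theorem F phi = (Cn + i Sn) F u in real
    coordinates, with F = Fc - i Fs. *)
Lemma Fc_trunc p : Fc phi p = Cn p * Fc u p + Sn p * Fs u p.
Proof.
rewrite /Fc /Fs trig_trunc; [|exact: continuous_cos|exact: normr_cos_le1].
have ic := @trig_shift cos p 0 (@continuous_cos R) (@normr_cos_le1 R).
have is_ := @trig_shift sin p 0 (@continuous_sin R) (@normr_sin_le1 R).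
set Ic := \int[leb]_x (cos (p * x) * u x); set Is := \int[leb]_x (sin (p * x) * u x).
transitivity (c * \int[P]_t (Ic * (trunc X n t * cos (p * X t)) +
    Is * (trunc X n t * sin (p * X t)))).
  congr (_ * _); apply: eq_Rintegral => t _.
  rewrite (_ : \int[leb]_y _ = cos (p * X t) * Ic + sin (p * X t) * Is); first by ring.
  rewrite -!RintegralZl// -RintegralD//; [|exact: integrable_mulZl..].
  by apply: eq_Rintegral => y _; rewrite cosB; ring.
rewrite RintegralD//; [|exact: integrable_mulZl..].
by rewrite !RintegralZl// -/(Cn p) -/(Sn p); ring.
Qed.

Lemma Fs_trunc p : Fs phi p = Cn p * Fs u p - Sn p * Fc u p.
Proof.
rewrite /Fc /Fs trig_trunc; [|exact: continuous_sin|exact: normr_sin_le1].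
have ic := @trig_shift cos p 0 (@continuous_cos R) (@normr_cos_le1 R).
have is_ := @trig_shift sin p 0 (@continuous_sin R) (@normr_sin_le1 R).
set Ic := \int[leb]_x (cos (p * x) * u x); set Is := \int[leb]_x (sin (p * x) * u x).
transitivity (c * \int[P]_t (Is * (trunc X n t * cos (p * X t)) -
    Ic * (trunc X n t * sin (p * X t)))).
  congr (_ * _); apply: eq_Rintegral => t _.
  rewrite (_ : \int[leb]_y _ = cos (p * X t) * Is - sin (p * X t) * Ic); first by ring.
  rewrite -!RintegralZl// -RintegralB//; [|exact: integrable_mulZl..].
  by apply: eq_Rintegral => y _; rewrite sinB; ring.
rewrite RintegralB//; [|exact: integrable_mulZl..].
by rewrite !RintegralZl// -/(Cn p) -/(Sn p); ring.
Qed.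

(** Both sides multiply F u by -psi and by the truncated characteristic function, in either order.
    This identity makes the truncated averages approximate in the graph norm. *)
Lemma Lop_trunc (delta rho x : R) : 0 < delta -> delta <= 2 ->
  Lop delta rho phi x = \int[P]_t (trunc X n t * Lop delta rho u (x + X t)).
Proof.
move=> d0 d2; have [cr ci [C hC]] := symbol_spec d0 d2 rho su.
transitivity (c * \int[P]_t (trunc X n t *
    \int[leb]_p (cos (p * (x + X t)) * symbol_re delta rho u p -
      sin (p * (x + X t)) * symbol_im delta rho u p))).
  rewrite (@expect_inverse_fourier _ _ _ C) //; first last.
  - by move=> p; exact: (hC p).2.
  - by move=> p; exact: (hC p).1.
  - exact: continuous_measurable_fun.
  - exact: continuous_measurable_fun.
  - by move=> t; exact: normr_trunc_le1.
  - exact: measurable_trunc.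
  rewrite /Lop; congr (_ * _); apply: eq_Rintegral => p _.
  by rewrite Fc_trunc Fs_trunc -/(Cn p) -/(Sn p) /symbol_re /symbol_im; ring.
have mL : measurable_fun setT (Lop delta rho u).
  by apply: continuous_measurable_fun; have [[]] := Lop_C_infty d0 d2 rho su.
rewrite -RintegralZl//.
  by apply: eq_Rintegral => t _; rewrite LopE; ring.
have c0 : 0 < c by rewrite invr_gt0 sqrtr_gt0 mulr_gt0// pi_gt0.
have [_ [B hB]] := Lop_C_infty d0 d2 rho su.
have := @integrable_mulZl _ _ _ P setT c^-1 (fun t => trunc X n t * Lop delta rho u (x + X t)) measurableT.
have -> : (fun t => c^-1 * (trunc X n t * Lop delta rho u (x + X t))) =
  (fun t => trunc X n t * \int[leb]_p (cos (p * (x + X t)) * symbol_re delta rho u p -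
      sin (p * (x + X t)) * symbol_im delta rho u p)).
  apply/funext => t; rewrite LopE mulrCA (mulrA c^-1) mulVf ?mul1r// gt_eqF//.
apply; apply: (@integrable_prob_bounded _ _ _ _ _ B).
  by apply: measurable_funM; [exact: measurable_trunc|exact: measurable_shift].
by move=> t; rewrite normrM (le_trans (ler_piMl _ (normr_trunc_le1 _ _ _))).
Qed.

End truncated.

(** Used twice in [Lbar_expect]: for [u] and, through [Lop_trunc], for its image under the
    operator. *)
Lemma unif_cvg_trunc (v : R -> R) (B : R) : measurable_fun setT v ->
  (forall x, `|v x| <= B) ->
  unif_cvg (fun n x => \int[P]_t (trunc X n t * v (x + X t)))
    (fun x => \int[P]_t v (x + X t)).
Proof.
move=> mv vB e e0.
have B0 : 0 <= B by exact: le_trans (vB 0).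
have B1 : 0 < B + 1 by rewrite ltr_wpDl.
have e4 : 0 < e / (B + 1) by rewrite divr_gt0.
have /cvgrPdist_lt /(_ _ e4) [N _ hN] := tail_cvg P mX.
exists N => n Nn x; have {hN} := hN n Nn; rewrite sub0r normrN => tn.
apply: (le_lt_trans (trunc_expect_bound _ mX _ _ mv vB)).
apply: (@le_lt_trans _ _ (B * (e / (B + 1)))).
  by rewrite ler_wpM2l// ltW// (le_lt_trans (ler_norm _)).
rewrite mulrCA gtr_pMr// ltr_pdivrMr// mul1r ltrDl//.
Qed.

Lemma Lbar_expect (delta rho : R) (u : R -> R) : 0 < delta -> delta <= 2 ->
  schwartz u ->
  Lbar delta rho (fun x => \int[P]_t u (x + X t))
    (fun x => \int[P]_t Lop delta rho u (x + X t)).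
Proof.
move=> d0 d2 su.
have [Cu [Bu hBu]] := schwartz_C_infty su.
have [CL [BL hBL]] := Lop_C_infty d0 d2 rho su.
split; first exact: expect_shift_C_infty Cu hBu.
split; first exact: expect_shift_C_infty CL hBL.
exists (fun n x => \int[P]_t (trunc X n t * u (x + X t))); split.
  by move=> n; exact: schwartz_trunc_expect.
split.
  by apply: (@unif_cvg_trunc _ Bu) => //; apply: continuous_measurable_fun; case: Cu.
have -> : (fun n => Lop delta rho (fun x => \int[P]_t (trunc X n t * u (x + X t)))) =
    (fun n x => \int[P]_t (trunc X n t * Lop delta rho u (x + X t))).
  by apply/funext => n; apply/funext => x; exact: Lop_trunc.
by apply: (@unif_cvg_trunc _ BL) => //; apply: continuous_measurable_fun; case: CL.
Qed.

End fourier_of_convolution.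

(** * Complex powers in real coordinates; the homogeneous kernel *)

Lemma powR_le_base (R : realType) (s t a : R) : 0 <= a -> 0 <= s -> s <= t ->
  s `^ a <= t `^ a.
Proof.
move=> a0 s0 st; apply: ge0_ler_powR => //; rewrite nnegrE//.
exact: le_trans st.
Qed.

Section complex_powers.
Variable R : realType.

(* [cpow a b n] is the pair of the real and imaginary parts of [(a + i b)^n]. *)
Fixpoint cpow (a b : R) (n : nat) : R * R :=
  if n is m.+1 then
    (a * (cpow a b m).1 - b * (cpow a b m).2, a * (cpow a b m).2 + b * (cpow a b m).1)
  else (1, 0).

Lemma cpow_bound (a b : R) n :
  `|(cpow a b n).1| <= (`|a| + `|b|) ^+ n /\ `|(cpow a b n).2| <= (`|a| + `|b|) ^+ n.
Proof.
elim: n => [|n [IH1 IH2]] /=; first by rewrite normr1 normr0 expr0.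
rewrite exprS mulrDl; split.
  by apply: (le_trans (ler_normB _ _)); rewrite !normrM lerD// ler_wpM2l.
by apply: (le_trans (ler_normD _ _)); rewrite !normrM lerD// ler_wpM2l.
Qed.

Lemma measurable_cpow d (T : measurableType d) (a b : T -> R) n :
  measurable_fun setT a -> measurable_fun setT b ->
  measurable_fun setT (fun x => (cpow (a x) (b x) n).1) /\
  measurable_fun setT (fun x => (cpow (a x) (b x) n).2).
Proof.
move=> ma mb; elim: n => [|n [IH1 IH2]] /=; first by split; exact: measurable_cst.
by split; [apply: measurable_funB|apply: measurable_funD]; apply: measurable_funM.
Qed.

Lemma cpow_scale (r a b : R) n : (cpow (r * a) (r * b) n).1 = r ^+ n * (cpow a b n).1 /\
  (cpow (r * a) (r * b) n).2 = r ^+ n * (cpow a b n).2.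
Proof.
elim: n => [|n [IH1 IH2]] /=; first by rewrite expr0 !mul1r.
by rewrite IH1 IH2 exprS; split; ring.
Qed.

End complex_powers.

Section homogeneous_kernel.
Variable R : realType.
Local Notation leb := (@lebesgue_measure R).
Variables (k : R -> R -> R) (beta : R).
Hypothesis beta_gt0 : 0 < beta.
Hypothesis hom : homogeneous k beta.
Hypothesis intk : leb.-integrable `]0, 1[ (EFin \o k 1).

(** Extension by zero from ]0, t[ to the line, where the affine substitution applies. It also hides
    the default values of powers of s <= 0. *)
Definition kcut (t s : R) : R := if 0 < s < t then k t s else 0.

Lemma kcut_patch (t : R) : kcut t = k t \_ `]0, t[.
Proof.
apply/funext => s; rewrite /kcut patchE.
by congr (if _ then _ else _); apply/idP/idP; rewrite inE/= in_itv.
Qed.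

Lemma kcut1_integrable : leb.-integrable setT (EFin \o kcut 1).
Proof. by rewrite kcut_patch -restrict_EFin -integrable_mkcond. Qed.

Lemma kcutE (t s : R) : 0 < t -> kcut t s = t `^ (beta - 1) * kcut 1 (t^-1 * s + 0).
Proof.
move=> t0; rewrite addr0 /kcut pmulr_rgt0 ?invr_gt0// (mulrC t^-1) ltr_pdivrMr// mul1r.
case: ifPn => [st|_]; last by rewrite mulr0.
have st' : 0 < s / t < 1.
  by case/andP: st => s0 st; rewrite divr_gt0// ltr_pdivrMr// mul1r.
by rewrite -(hom t0 st') mulrCA mulfV ?mulr1// gt_eqF.
Qed.

(** The Jacobian supplies the missing factor t. Serves the kernel [k] and, with exponent delta H,
    the self-similar kernel of the stable motion. *)
Lemma Rintegral_scaling (g : R -> R) (t a : R) : 0 < t ->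
  leb.-integrable setT (EFin \o g) ->
  \int[leb]_s (t `^ (a - 1) * g (t^-1 * s + 0)) = t `^ a * \int[leb]_s g s.
Proof.
move=> t0 ig; have tV0 : t^-1 != 0 by rewrite invr_eq0 gt_eqF.
rewrite RintegralZl//; last exact: integrable_affine.
rewrite -[in RHS](Rintegral_affine 0 tV0); last exact: integrable_measurable ig.
rewrite gtr0_norm ?invr_gt0// mulrA; congr (_ * _).
rewrite powRD; first by rewrite powR_inv1// ltW.
by rewrite (gt_eqF t0) implybT.
Qed.

Lemma kcut_integrable (t : R) : 0 < t -> leb.-integrable setT (EFin \o kcut t).
Proof.
move=> t0.
have -> : kcut t = fun s => t `^ (beta - 1) * kcut 1 (t^-1 * s + 0).
  by apply/funext => s; exact: kcutE.
apply: integrable_mulZl => //.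
by apply: (integrable_affine _ _ kcut1_integrable); rewrite invr_eq0 gt_eqF.
Qed.

Lemma Rintegral_normr_kcut (t : R) : 0 < t ->
  \int[leb]_s `|kcut t s| = t `^ beta * \int[leb]_s `|kcut 1 s|.
Proof.
move=> t0; rewrite -Rintegral_scaling//; last first.
  by apply: integrable_normr => //; exact: kcut1_integrable.
by apply: eq_Rintegral => s _; rewrite kcutE// normrM ger0_norm ?powR_ge0.
Qed.

Lemma kcut_moment (t : R) (n : nat) : 0 < t ->
  chat k beta n * \int[leb]_s (kcut t s * s `^ (beta * n%:R)) =
  t `^ (beta * n.+1%:R) * chat k beta n.+1.
Proof.
move=> t0 /=.
have bn0 : 0 <= beta * n%:R by rewrite mulr_ge0// ltW.
pose g r := kcut 1 r * r `^ (beta * n%:R).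
have ig : leb.-integrable setT (EFin \o g).
  apply: (@integrable_dominated _ _ _ leb _ _ (fun s => `|kcut 1 s|)) => //.
  - apply: measurable_funM; first exact: integrable_measurable kcut1_integrable.
    exact: measurable_powR.
  - move=> s _; rewrite normrM /kcut; case: ifPn => [/andP[s0 s1]|_]; last first.
      by rewrite normr0 mul0r.
    rewrite ler_piMr// ger0_norm ?powR_ge0//.
    by have := powR_le_base bn0 (ltW s0) (ltW s1); rewrite powR1.
  - by apply: integrable_normr => //; exact: kcut1_integrable.
have -> : \int[leb]_(s in `]0, 1[) (k 1 s * s `^ (beta * n%:R)) = \int[leb]_s g s.
  rewrite Rintegral_mkcond; apply: eq_Rintegral => s _.
  rewrite /g kcut_patch !patchE; case: ifPn => //; by rewrite mul0r.
rewrite mulrCA -Rintegral_scaling//; congr (_ * _); apply: eq_Rintegral => s _.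
rewrite /g kcutE// addr0.
have -> : t `^ (beta * n.+1%:R - 1) = t `^ (beta - 1) * t `^ (beta * n%:R).
  rewrite -powRD; last by rewrite (gt_eqF t0) implybT.
  by congr (_ `^ _); rewrite -natr1; ring.
rewrite -!mulrA; congr (_ * _); rewrite /kcut.
case: ifPn => [/andP[s0 s1]|_]; last by rewrite !mul0r mulr0.
rewrite mulrCA; congr (_ * _); rewrite -powRM ?ltW//.
by rewrite mulrA mulfV ?gt_eqF// mul1r.
Qed.

(** [e n] will be the real or imaginary part of z^(n+1), of geometric growth [m]. Since s < t on the
    support of [kcut t], all partial sums are dominated by K S |k(t,s)|, with [S] bounding the
    absolute series at radius t^beta m. *)
Lemma kcut_series (t K m : R) (e : nat -> R) (f : R -> R) : 0 < t -> 0 <= m ->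
  (forall r : R, 0 <= r -> exists S : R, forall N,
    \sum_(n < N) `|chat k beta n| * r ^+ n <= S) ->
  (forall n, `|e n| <= K * m ^+ n) ->
  (forall s : R, 0 < s ->
    \sum_(n < N) chat k beta n * s `^ (beta * n%:R) * e n @[N --> \oo] --> f s) ->
  \sum_(n < N) chat k beta n.+1 * t `^ (beta * n.+1%:R) * e n @[N --> \oo] -->
  \int[leb]_s (kcut t s * f s).
Proof.
move=> t0 m0 sumb eK fE.
have K0 : 0 <= K by have := eK 0%N; rewrite expr0 mulr1; exact: le_trans.
have [S hS] := sumb (t `^ beta * m) (mulr_ge0 (powR_ge0 _ _) m0).
have ik := kcut_integrable t0.
have mk := integrable_measurable ik.
have ikn n : leb.-integrable setT (EFin \o (fun s => kcut t s * s `^ (beta * n%:R))).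
  have bn0 : 0 <= beta * n%:R by rewrite mulr_ge0// ltW.
  apply: (@integrable_dominated _ _ _ leb _ _
    (fun s => t `^ (beta * n%:R) * `|kcut t s|)) => //.
  - by apply: measurable_funM => //; exact: measurable_powR.
  - move=> s _; rewrite normrM mulrC /kcut; case: ifPn => [/andP[s0 s1]|_]; last first.
      by rewrite normr0 !mulr0.
    by rewrite ler_wpM2r// ger0_norm ?powR_ge0// powR_le_base// ltW.
  - by apply: integrable_mulZl => //; exact: integrable_normr.
have -> : (fun N => \sum_(n < N) chat k beta n.+1 * t `^ (beta * n.+1%:R) * e n) =
  (fun N => \int[leb]_s (kcut t s * \sum_(n < N) chat k beta n * s `^ (beta * n%:R) * e n)).
  apply/funext; elim => [|N IH].
    rewrite big_ord0; under eq_Rintegral do rewrite big_ord0 mulr0.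
    by rewrite Rintegral_cst// mul0r.
  rewrite big_ord_recr/= IH.
  have E s : kcut t s * \sum_(n < N.+1) chat k beta n * s `^ (beta * n%:R) * e n =
      kcut t s * \sum_(n < N) chat k beta n * s `^ (beta * n%:R) * e n +
      (e N * chat k beta N) * (kcut t s * s `^ (beta * N%:R)).
    by rewrite big_ord_recr/=; ring.
  under [RHS]eq_Rintegral do rewrite E.
  rewrite RintegralD//; last exact: integrable_mulZl.
    congr (_ + _); rewrite RintegralZl// -[_ * _ * \int[_]_s _]mulrA kcut_moment//=.
    by ring.
  elim: N {IH E} => [|N IH].
    under eq_fun do rewrite big_ord0 mulr0.
    by apply: (@integrable_dominated _ _ _ leb _ _ (fun s => `|kcut t s|)) => //;
      [move=> s _; rewrite normr0|exact: integrable_normr].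
  have E : (fun s => kcut t s * \sum_(n < N.+1) chat k beta n * s `^ (beta * n%:R) * e n) =
      (fun s => kcut t s * \sum_(n < N) chat k beta n * s `^ (beta * n%:R) * e n +
      (e N * chat k beta N) * (kcut t s * s `^ (beta * N%:R))).
    by apply/funext => s; rewrite big_ord_recr/=; ring.
  by rewrite E; apply: integrable_add => //; exact: integrable_mulZl.
apply: (@Rintegral_dominated_cvg _ _ _ leb _ _ _ (fun s => K * S * `|kcut t s|)) => //.
- move=> N; apply: measurable_funM => //; apply: measurable_sum => n.
  by apply: measurable_funM => //; apply: measurable_funM => //; exact: measurable_powR.
- move=> s _; rewrite /kcut; case: ifPn => [/andP[s0 _]|_].
    by apply: cvgMr; exact: fE.
  by rewrite mul0r; under eq_fun do rewrite mul0r; exact: cvg_cst.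
- by apply: integrable_mulZl => //; exact: integrable_normr.
- move=> N s _; rewrite normrM mulrC /kcut; case: ifPn => [/andP[s0 s1]|_]; last first.
    by rewrite normr0 !mulr0.
  rewrite ler_wpM2r// (le_trans (ler_norm_sum _ _ _))//.
  rewrite (le_trans _ (ler_wpM2l K0 (hS N)))// mulr_sumr ler_sum// => n _.
  rewrite !normrM mulrCA -mulrA ler_wpM2l//.
  rewrite (ger0_norm (powR_ge0 _ _)) exprMn -powR_mulrn ?powR_ge0// -powRrM.
  rewrite mulrCA ler_pM ?powR_ge0//.
  by apply: powR_le_base; rewrite ?mulr_ge0// ltW.
Qed.

End homogeneous_kernel.

(** * From the power series of the characteristic function to the integral equation *)

Section integral_equation.
Context (R : realType) (d : measure_display) (T : measurableType d).
Variables (P : probability T R) (X : R -> T -> R).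
Local Notation leb := (@lebesgue_measure R).
Local Notation w x := ((1 + x ^+ 2)^-1).
Local Notation c := ((Num.sqrt (2 * pi) : R)^-1).
Variables (k : R -> R -> R) (beta delta rho : R).
Hypothesis beta_gt0 : 0 < beta.
Hypothesis delta_gt0 : 0 < delta.
Hypothesis delta_le2 : delta <= 2.
Hypothesis hom : homogeneous k beta.
Hypothesis intk : leb.-integrable `]0, 1[ (EFin \o k 1).
Hypothesis sum_chat : forall r : R, 0 <= r -> exists S : R, forall N,
  \sum_(n < N) `|chat k beta n| * r ^+ n <= S.
Hypothesis mX : forall s, 0 < s -> measurable_fun setT (X s).

Let zr p := - psiRe delta p.
Let zi p := - psiIm delta rho p.
Let a s p := \int[P]_t cos (p * X s t).
Let b s p := \int[P]_t sin (p * X s t).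

Hypothesis char_re : forall s p : R, 0 < s ->
  \sum_(n < N) chat k beta n * s `^ (beta * n%:R) * (cpow (zr p) (zi p) n).1
    @[N --> \oo] --> a s p.
Hypothesis char_im : forall s p : R, 0 < s ->
  \sum_(n < N) chat k beta n * s `^ (beta * n%:R) * (cpow (zr p) (zi p) n).2
    @[N --> \oo] --> b s p.

Let m p := `|zr p| + `|zi p|.
Let m_ge0 p : 0 <= m p. Proof. by rewrite addr_ge0. Qed.

Lemma kernel_char_re (t p : R) : 0 < t ->
  \int[leb]_s (kcut k t s * (zr p * a s p - zi p * b s p)) = a t p - 1.
Proof.
move=> t0.
have h := @kcut_series _ k beta beta_gt0 hom intk t (m p) (m p)
  (fun n => (cpow (zr p) (zi p) n.+1).1)
  (fun s => zr p * a s p - zi p * b s p) t0 (m_ge0 p) sum_chat.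
apply: (cvg_unique _ (h _ _)) => //.
- by move=> n; rewrite -exprS; have [] := cpow_bound (zr p) (zi p) n.+1.
- move=> s s0.
  have -> : (fun N => \sum_(n < N) chat k beta n * s `^ (beta * n%:R) * (cpow (zr p) (zi p) n.+1).1) =
    (fun N => zr p * (\sum_(n < N) chat k beta n * s `^ (beta * n%:R) * (cpow (zr p) (zi p) n).1)
    - zi p * (\sum_(n < N) chat k beta n * s `^ (beta * n%:R) * (cpow (zr p) (zi p) n).2)).
    apply/funext => N; rewrite !mulr_sumr -sumrB; apply: eq_bigr => n _ /=; ring.
  by apply: cvgB; apply: cvgMr; [exact: char_re|exact: char_im].
- rewrite /=.
  (* The shifted series lacks only the constant term, which is 1 because [chat] starts at 1 and t^0
     = 1. *)
  have -> : (fun N => \sum_(n < N) chat k beta n.+1 * t `^ (beta * n.+1%:R) * (cpow (zr p) (zi p) n.+1).1) =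
    (fun N => \sum_(n < N.+1) chat k beta n * t `^ (beta * n%:R) * (cpow (zr p) (zi p) n).1 - 1).
    apply/funext => N; rewrite big_ord_recl /= mulr0 powRr0 !mulr1 addrC addKr.
    by apply: eq_bigr => n _; rewrite /bump /= add1n.
  apply: cvgB; last exact: cvg_cst.
  by rewrite (cvg_shiftS (fun N => \sum_(n < N) chat k beta n * t `^ (beta * n%:R) * (cpow (zr p) (zi p) n).1)); exact: char_re.
Qed.

Lemma kernel_char_im (t p : R) : 0 < t ->
  \int[leb]_s (kcut k t s * (zr p * b s p + zi p * a s p)) = b t p.
Proof.
move=> t0.
have h := @kcut_series _ k beta beta_gt0 hom intk t (m p) (m p)
  (fun n => (cpow (zr p) (zi p) n.+1).2)
  (fun s => zr p * b s p + zi p * a s p) t0 (m_ge0 p) sum_chat.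
apply: (cvg_unique _ (h _ _)) => //.
- by move=> n; rewrite -exprS; have [] := cpow_bound (zr p) (zi p) n.+1.
- move=> s s0.
  have -> : (fun N => \sum_(n < N) chat k beta n * s `^ (beta * n%:R) * (cpow (zr p) (zi p) n.+1).2) =
    (fun N => zr p * (\sum_(n < N) chat k beta n * s `^ (beta * n%:R) * (cpow (zr p) (zi p) n).2)
    + zi p * (\sum_(n < N) chat k beta n * s `^ (beta * n%:R) * (cpow (zr p) (zi p) n).1)).
    apply/funext => N; rewrite !mulr_sumr -big_split; apply: eq_bigr => n _ /=; ring.
  by apply: cvgD; apply: cvgMr; [exact: char_im|exact: char_re].
- rewrite /=.
  have -> : (fun N => \sum_(n < N) chat k beta n.+1 * t `^ (beta * n.+1%:R) * (cpow (zr p) (zi p) n.+1).2) =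
    (fun N => \sum_(n < N.+1) chat k beta n * t `^ (beta * n%:R) * (cpow (zr p) (zi p) n).2).
    apply/funext => N; rewrite big_ord_recl /= !mulr0 add0r.
    by apply: eq_bigr => n _; rewrite /bump /= add1n.
  by rewrite (cvg_shiftS (fun N => \sum_(n < N) chat k beta n * t `^ (beta * n%:R) * (cpow (zr p) (zi p) n).2)); exact: char_im.
Qed.

(** The characteristic function as a function of (s, p), with value 0 for s <= 0. Its joint
    measurability, required by Fubini, comes from the power series: it is a pointwise limit of
    functions measurable in (s, p). *)
Let chi (s p : R) : R * R := if 0 < s then (a s p, b s p) else (0, 0).

Let measurable_chi :
  measurable_fun setT (fun z : R * R => (chi z.1 z.2).1) /\
  measurable_fun setT (fun z : R * R => (chi z.1 z.2).2).
Proof.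
have mzr : measurable_fun setT (fun z : R * R => zr z.2).
  apply: measurableT_comp => //; apply: measurableT_comp => //.
  by apply: continuous_measurable_fun; exact: psiRe_continuous.
have mzi : measurable_fun setT (fun z : R * R => zi z.2).
  apply: measurableT_comp => //; apply: measurableT_comp => //.
  by apply: continuous_measurable_fun; exact: psiIm_continuous.
pose pos : R -> R := \1_(`]0%R, +oo[%classic).
have mpos : measurable_fun setT (fun z : R * R => pos z.1).
  by apply: measurableT_comp => //; apply: measurable_indic; exact: measurable_itv.
have posE z : pos z = ((0 < z)%R)%:R.
  rewrite /pos indicE; congr (nat_of_bool _)%:R.
  by apply/idP/idP; rewrite inE/= in_itv/= andbT.
split.
- apply: (@measurable_fun_cvg _ _ _ _ (fun N (z : R * R) => pos z.1 *
    \sum_(n < N) chat k beta n * z.1 `^ (beta * n%:R) * (cpow (zr z.2) (zi z.2) n).1)).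
    move=> N; apply: measurable_funM => //; apply: measurable_sum => n.
    apply: measurable_funM; last by have [] := measurable_cpow n mzr mzi.
    by apply: measurable_funM => //; apply: (measurableT_comp (measurable_powR _)).
  move=> [s p] _ /=; rewrite /chi posE; case: ltP => s0 /=.
    by under eq_fun do rewrite mul1r; exact: char_re.
  by under eq_fun do rewrite mul0r; exact: cvg_cst.
- apply: (@measurable_fun_cvg _ _ _ _ (fun N (z : R * R) => pos z.1 *
    \sum_(n < N) chat k beta n * z.1 `^ (beta * n%:R) * (cpow (zr z.2) (zi z.2) n).2)).
    move=> N; apply: measurable_funM => //; apply: measurable_sum => n.
    apply: measurable_funM; last by have [] := measurable_cpow n mzr mzi.
    by apply: measurable_funM => //; apply: (measurableT_comp (measurable_powR _)).
  move=> [s p] _ /=; rewrite /chi posE; case: ltP => s0 /=.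
    by under eq_fun do rewrite mul1r; exact: char_im.
  by under eq_fun do rewrite mul0r; exact: cvg_cst.
Qed.

Let a_le1 s p : 0 < s -> `|a s p| <= 1.
Proof.
move=> s0; apply: normr_expect_le; last by move=> t; exact: normr_cos_le1.
by apply: measurable_trigX; [exact: mX|exact: continuous_cos].
Qed.

Let b_le1 s p : 0 < s -> `|b s p| <= 1.
Proof.
move=> s0; apply: normr_expect_le; last by move=> t; exact: normr_sin_le1.
by apply: measurable_trigX; [exact: mX|exact: continuous_sin].
Qed.

Variable u0 : R -> R.
Hypothesis su : schwartz u0.
Let Lr := symbol_re delta rho u0.
Let Li := symbol_im delta rho u0.
Let G s x := \int[P]_t Lop delta rho u0 (x + X s t).
Let u s x := \int[P]_t u0 (x + X s t).

(** Stated for any [v] with transform va + i vb: it is applied to L u0, and to u0 itself with vb = -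
    Fs because F = Fc - i Fs. *)
Lemma expect_fourierE (v va vb : R -> R) (B C s x : R) : 0 < s ->
  measurable_fun setT v -> (forall y, `|v y| <= B) ->
  measurable_fun setT va -> measurable_fun setT vb ->
  (forall p, `|va p| <= C * w p) -> (forall p, `|vb p| <= C * w p) ->
  (forall y, v y = c * \int[leb]_p (cos (p * y) * va p - sin (p * y) * vb p)) ->
  \int[P]_t v (x + X s t) =
  c * \int[leb]_p (cos (p * x) * (a s p * va p - b s p * vb p) -
                   sin (p * x) * (b s p * va p + a s p * vb p)).
Proof.
move=> s0 mv vB mva mvb vaC vbC vE.
have c0 : 0 < c by rewrite invr_gt0 sqrtr_gt0 mulr_gt0// pi_gt0.
have g1 (t : T) : `|cst 1 t : R| <= 1 by rewrite normr1.
have := @expect_inverse_fourier _ _ _ P (X s) (mX s0) (cst 1) va vb C x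
  (measurable_cst _) g1 mva mvb vaC vbC.
have E (f : R -> R) p : \int[P]_t (cst 1 t * f (p * X s t)) = \int[P]_t f (p * X s t).
  by apply: eq_Rintegral => t _; rewrite mul1r.
move=> /=; under [X in _ = X -> _]eq_Rintegral do rewrite (E cos) (E sin).
move=> <-.
have -> : \int[P]_t (1 * \int[leb]_p (cos (p * (x + X s t)) * va p - sin (p * (x + X s t)) * vb p)) =
    \int[P]_t (c^-1 * v (x + X s t)).
  by apply: eq_Rintegral => t _; rewrite mul1r vE mulrA mulVf ?mul1r// gt_eqF.
rewrite RintegralZl// ?mulrA ?mulfV ?mul1r// ?gt_eqF//.
apply: (@integrable_prob_bounded _ _ _ _ _ B) => //.
by apply: measurable_shift => //; exact: mX.
Qed.

Let kG t s x : kcut k t s * G s x = (fun s => k t s * G s x) \_ `]0, t[ s.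
Proof. by rewrite kcut_patch !patchE; case: ifPn => //; rewrite mul0r. Qed.

Lemma expect_integral_equation (t x : R) : 0 < t ->
  leb.-integrable `]0, t[ (fun s => (k t s * G s x)%:E) /\
  u t x = u0 x + \int[leb]_(s in `]0, t[) (k t s * G s x).
Proof.
move=> t0.
have [cu [Bu hBu]] := schwartz_C_infty su.
have [CL [BL hBL]] := Lop_C_infty delta_gt0 delta_le2 rho su.
have [cLr cLi [K hK]] := symbol_spec delta_gt0 delta_le2 rho su.
have [C0 [_ uC0]] := schwartz_cauchy_bound 0 su.
have [cFc cFs] := fourier_continuous cu.1 uC0.
have [D [D0 hD]] := fourier_decay su.
have mLr : measurable_fun setT Lr := continuous_measurable_fun cLr.
have mLi : measurable_fun setT Li := continuous_measurable_fun cLi.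
have mFc := continuous_measurable_fun cFc.
have mFs := continuous_measurable_fun cFs.
have mNFs : measurable_fun setT (fun p => - Fs u0 p) by exact: measurableT_comp.
have FcD p : `|Fc u0 p| <= D * w p.
  apply: (le_trans (hD p).1); rewrite ler_wpM2l// expr2 ler_piMl ?cauchy_weight_le1//.
  by rewrite ltW// cauchy_weight_gt0.
have FsD p : `|Fs u0 p| <= D * w p.
  apply: (le_trans (hD p).2); rewrite ler_wpM2l// expr2 ler_piMl ?cauchy_weight_le1//.
  by rewrite ltW// cauchy_weight_gt0.
have GE s : 0 < s -> G s x = c * \int[leb]_p (cos (p * x) * (a s p * Lr p - b s p * Li p) -
    sin (p * x) * (b s p * Lr p + a s p * Li p)).
  move=> s0; apply: (@expect_fourierE _ _ _ BL K) => //.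
  - exact: continuous_measurable_fun CL.1.
  - by move=> p; exact: (hK p).1.
  - by move=> p; exact: (hK p).2.
have uE : u t x = c * \int[leb]_p (cos (p * x) * (a t p * Fc u0 p - b t p * - Fs u0 p) -
    sin (p * x) * (b t p * Fc u0 p + a t p * - Fs u0 p)).
  apply: (@expect_fourierE _ _ _ Bu D) => //.
  - exact: continuous_measurable_fun cu.1.
  - by move=> p; rewrite normrN.
  - move=> y; rewrite (fourier_inversion y su); congr (_ * _).
    by apply: eq_Rintegral => p _; ring.
pose J s p := cos (p * x) * ((chi s p).1 * Lr p - (chi s p).2 * Li p) -
    sin (p * x) * ((chi s p).2 * Lr p + (chi s p).1 * Li p).
pose F s p := kcut k t s * J s p.
have [mchi1 mchi2] := measurable_chi.
have ik := kcut_integrable hom intk t0.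
have mk := integrable_measurable ik.
have mJ : measurable_fun setT (fun z : R * R => J z.1 z.2).
  have mc (h : R -> R) : continuous h -> measurable_fun setT (fun z : R * R => h (z.2 * x)).
    move=> ch; apply: measurableT_comp; first exact: continuous_measurable_fun.
    exact: measurable_funM.
  have mL (h : R -> R) : measurable_fun setT h -> measurable_fun setT (fun z : R * R => h z.2).
    by move=> mh; exact: measurableT_comp.
  apply: measurable_funB; apply: measurable_funM.
  - by apply: mc; exact: continuous_cos.
  - by apply: measurable_funB; apply: measurable_funM => //; exact: mL.
  - by apply: mc; exact: continuous_sin.
  - by apply: measurable_funD; apply: measurable_funM => //; exact: mL.
have mF : measurable_fun setT (fun z : R * R => F z.1 z.2).
  by apply: measurable_funM => //; exact: measurableT_comp.
have chib s p : `|(chi s p).1| <= 1 /\ `|(chi s p).2| <= 1.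
  rewrite /chi; case: ifPn => s0 /=; first by split; [exact: a_le1|exact: b_le1].
  by rewrite normr0.
have rot_bound (C y z v1 v2 p : R) : `|y| <= 1 -> `|z| <= 1 ->
    `|v1| <= C * w p -> `|v2| <= C * w p ->
    `|cos (p * x) * (y * v1 - z * v2) - sin (p * x) * (z * v1 + y * v2)| <= 4 * C * w p.
  move=> x1 x2 h1 h2.
  have M (y' z' : R) : `|y'| <= 1 -> `|z'| <= C * w p -> `|y' * z'| <= C * w p.
    by move=> y1 zK; rewrite normrM (le_trans (ler_piMl _ y1)).
  have A1 := M _ _ x1 h1; have A2 := M _ _ x2 h2.
  have A3 := M _ _ x2 h1; have A4 := M _ _ x1 h2.
  apply: (le_trans (ler_normB _ _)); rewrite (normrM (cos _)) (normrM (sin _)).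
  apply: (le_trans (lerD (ler_piMl _ (normr_cos_le1 _)) (ler_piMl _ (normr_sin_le1 _)))) => //.
  by apply: (le_trans (lerD (ler_normB _ _) (ler_normD _ _))); lra.
have Jb s p : `|J s p| <= 4 * K * w p.
  by have [h1 h2] := hK p; have [x1 x2] := chib s p; exact: rot_bound.
have Fb s p : `|F s p| <= `|kcut k t s| * (4 * K * w p).
  by rewrite normrM ler_wpM2l.
have iF2 : leb.-integrable setT (EFin \o (fun p => 4 * K * w p)).
  by apply: integrable_mulZl => //; exact: integrable_cauchy.
have iF1 : leb.-integrable setT (EFin \o (fun s => `|kcut k t s|)) by exact: integrable_normr.
have kGE s : kcut k t s * G s x = c * \int[leb]_p F s p.
  rewrite /F; have [s0|s0] := ltP 0 s; last first.
    rewrite /kcut ltNge s0/= mul0r; under eq_Rintegral do rewrite mul0r.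
    by rewrite Rintegral_cst// mul0r mulr0.
  have iJ : leb.-integrable setT (EFin \o J s).
    apply: (@integrable_cauchy_bound _ _ (4 * K)) => //.
    exact: (measurable_fun_pair2 s mJ).
  rewrite GE// mulrCA; congr (_ * _); rewrite (RintegralZl _ _ iJ)//; congr (_ * _).
  by apply: eq_Rintegral => p _; rewrite /J /chi s0.
have iFp := @integrable_Rintegral_snd _ _ _ _ _ leb leb F _ _ mF iF1 iF2 Fb.
have ikG : leb.-integrable setT (EFin \o (fun s => kcut k t s * G s x)).
  by under eq_fun do rewrite kGE; exact: integrable_mulZl.
split.
  rewrite integrable_mkcond//; move: ikG; apply: eq_integrable => // s _.
  by rewrite /= kG !patchE; case: ifPn.
have -> : \int[leb]_(s in `]0, t[) (k t s * G s x) = \int[leb]_s (kcut k t s * G s x).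
  by rewrite Rintegral_mkcond; apply: eq_Rintegral => s _; rewrite -kG.
under eq_Rintegral do rewrite kGE.
rewrite RintegralZl// (@Rintegral_fubini _ _ _ _ _ leb leb F _ _ mF iF1 iF2 Fb).
(* [K1] and - [K2] are the real and imaginary parts of e^(ipx) F u0(p). After the exchange, the
   inner integral is the real part of this times (characteristic function at t) - 1. *)
pose K1 p := cos (p * x) * Fc u0 p + sin (p * x) * Fs u0 p.
pose K2 p := cos (p * x) * Fs u0 p - sin (p * x) * Fc u0 p.
have inner p : \int[leb]_s F s p = K1 p * (a t p - 1) + K2 p * b t p.
  have m1 : measurable_fun setT (fun s : R => (chi s p).1) := measurable_fun_pair1 p mchi1.
  have m2 : measurable_fun setT (fun s : R => (chi s p).2) := measurable_fun_pair1 p mchi2.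
  have bd (y z v1 v2 : R) : `|y| <= 1 -> `|z| <= 1 -> `|v1 * y| + `|v2 * z| <= `|v1| + `|v2|.
    by move=> y1 z1; rewrite !normrM lerD// ler_piMr.
  have i1 : leb.-integrable setT (EFin \o
      (fun s => kcut k t s * (zr p * (chi s p).1 - zi p * (chi s p).2))).
    under eq_fun do rewrite mulrC.
    apply: (@integrable_mul_bounded _ _ _ leb _ _ _ (`|zr p| + `|zi p|)) => //.
      by apply: measurable_funB; apply: measurable_funM.
    move=> s _; have [c1 c2] := chib s p.
    by apply: (le_trans (ler_normB _ _)); exact: bd.
  have i2 : leb.-integrable setT (EFin \o
      (fun s => kcut k t s * (zr p * (chi s p).2 + zi p * (chi s p).1))).
    under eq_fun do rewrite mulrC.
    apply: (@integrable_mul_bounded _ _ _ leb _ _ _ (`|zr p| + `|zi p|)) => //.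
      by apply: measurable_funD; apply: measurable_funM.
    move=> s _; have [c1 c2] := chib s p.
    by apply: (le_trans (ler_normD _ _)); exact: bd.
  rewrite -kernel_char_re// -kernel_char_im//.
  have -> : \int[leb]_s (kcut k t s * (zr p * a s p - zi p * b s p)) =
      \int[leb]_s (kcut k t s * (zr p * (chi s p).1 - zi p * (chi s p).2)).
    apply: eq_Rintegral => s _; rewrite /kcut /chi.
    by case: (ltP 0 s) => //= _; rewrite !mul0r.
  have -> : \int[leb]_s (kcut k t s * (zr p * b s p + zi p * a s p)) =
      \int[leb]_s (kcut k t s * (zr p * (chi s p).2 + zi p * (chi s p).1)).
    apply: eq_Rintegral => s _; rewrite /kcut /chi.
    by case: (ltP 0 s) => //= _; rewrite !mul0r.
  rewrite -!RintegralZl// -RintegralD//; [|exact: integrable_mulZl..].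
  apply: eq_Rintegral => s _.
  by rewrite /F /J /Lr /Li /symbol_re /symbol_im /K1 /K2 /zr /zi; ring.
under [X in _ + _ * X]eq_Rintegral do rewrite inner.
rewrite uE (fourier_inversion x su) -mulrDr -/(K1 _); congr (_ * _).
have mK h (ch : continuous h) : measurable_fun setT (fun p : R => h (p * x) : R).
  exact: measurable_trig_scale.
have mc := mK _ (@continuous_cos R); have ms := mK _ (@continuous_sin R).
have mK1 : measurable_fun setT K1 by apply: measurable_funD; apply: measurable_funM.
have mK2 : measurable_fun setT K2 by apply: measurable_funB; apply: measurable_funM.
have ma : measurable_fun setT (a t).
  have -> : a t = fun p => (chi t p).1 by apply/funext => p; rewrite /chi t0.
  exact: (measurable_fun_pair2 t mchi1).
have mb : measurable_fun setT (b t).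
  have -> : b t = fun p => (chi t p).2 by apply/funext => p; rewrite /chi t0.
  exact: (measurable_fun_pair2 t mchi2).
have iK1 : leb.-integrable setT (EFin \o K1).
  apply: (@integrable_cauchy_bound _ _ (4 * D)) => // p.
  have := @rot_bound D 1 0 (Fc u0 p) (- Fs u0 p) p; rewrite normr1 normr0 normrN.
  move=> /(_ (lexx _) ler01 (FcD p) (FsD p)).
  by congr (`|_| <= _); rewrite /K1; ring.
rewrite -RintegralD//.
  by apply: eq_Rintegral => p _; rewrite /K1 /K2; ring.
have -> : (fun p => K1 p * (a t p - 1) + K2 p * b t p) = (fun p =>
    (cos (p * x) * (a t p * Fc u0 p - b t p * - Fs u0 p) -
    sin (p * x) * (b t p * Fc u0 p + a t p * - Fs u0 p)) - K1 p).
  by apply/funext => p; rewrite /K1 /K2; ring.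
apply: integrable_sub => //; apply: (@integrable_cauchy_bound _ _ (4 * D)).
  by apply: measurable_funB; apply: measurable_funM => //;
    [apply: measurable_funB|apply: measurable_funD]; apply: measurable_funM.
by move=> p; apply: rot_bound; rewrite ?normrN ?a_le1 ?b_le1.
Qed.

Lemma expect_solves : solves (Lbar delta rho) k u0
  (fun t x => expect P (fun t' => u0 (x + X t t'))).
Proof.
exists G; split; first by move=> s s0; apply: Lbar_expect => //; exact: mX.
split; first by move=> t x t0; exact: expect_integral_equation.
move=> x.
have [CL [B hB]] := Lop_C_infty delta_gt0 delta_le2 rho su.
have mL := continuous_measurable_fun CL.1.
(* The initial value is read off from the equation: L u0 is bounded by [B], and by homogeneity the
   integral of |k(t,s)| over ]0, t[ is t^beta times its value [kap] at t = 1. *)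
pose kap := \int[leb]_s `|kcut k 1 s|.
have bd t : 0 < t -> `|u t x - u0 x| <= B * (t `^ beta * kap).
  move=> t0; have [ikG ->] := expect_integral_equation x t0.
  rewrite addrC addKr.
  have ik := kcut_integrable hom intk t0.
  have -> : \int[leb]_(s in `]0, t[) (k t s * G s x) = \int[leb]_s (kcut k t s * G s x).
    by rewrite Rintegral_mkcond; apply: eq_Rintegral => s _; rewrite -kG.
  rewrite -(Rintegral_normr_kcut hom intk t0) -RintegralZl//; last exact: integrable_normr.
  apply: normr_Rintegral_le => //.
  - apply: (@integrable_measurable _ _ _ leb).
    have : leb.-integrable setT ((fun s => (k t s * G s x)%:E) \_ `]0, t[).
      by rewrite -integrable_mkcond.
    by apply: eq_integrable => // s _; rewrite /= kG !patchE; case: ifPn.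
  - move=> s _; rewrite normrM mulrC /kcut; case: ifPn => [/andP[s0 _]|_]; last first.
      by rewrite normr0 !mulr0.
    rewrite ler_wpM2r//; apply: normr_expect_le => //.
    by apply: measurable_shift => //; exact: mX.
  - by apply: integrable_mulZl => //; exact: integrable_normr.
apply/subr_cvg0; apply: (@norm_cvg0 _ R^o).
apply: (@squeeze_cvgr _ _ _ _ (fun=> 0) (fun t => B * (t `^ beta * kap))).
- near=> t; rewrite normr_ge0/=; apply: bd.
  by near: t; exact: nbhs_right_gt.
- exact: cvg_cst.
- rewrite -[X in _ --> X](mulr0 B); apply: cvgMr; rewrite -[X in _ --> X](mul0r kap); apply: cvgMl.
  exact: powR_cvg0.
Unshelve. all: by end_near. Qed.

End integral_equation.

(** * Independence and characteristic functions of sums *)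

Section counting_approximation.
Variable R : realType.

(** The sum counts the positive integers up to y, so it is the floor of y. *)
Lemma staircase_bound (n : nat) (y : R) : 0 <= y <= n%:R ->
  `|y - \sum_(k < n) ((k.+1%:R <= y)%R)%:R| <= 1.
Proof.
pose N n := \sum_(k < n) ((k.+1%:R <= y)%R)%:R : R.
have full m : m%:R <= y -> N m = m%:R.
  elim: m => [|m IH] my; rewrite /N ?big_ord0// big_ord_recr/= -/(N m) my IH ?natr1//.
  by rewrite (le_trans _ my)// ler_nat.
have up m : 0 <= y -> N m <= y.
  move=> y0; elim: m => [|m IH]; first by rewrite /N big_ord0.
  have [my|my] := leP m.+1%:R y; first by rewrite full.
  by rewrite /N big_ord_recr/= -/(N m) (leNgt m.+1%:R) my/= addr0.
have low m : y <= m%:R -> y - 1 <= N m.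
  elim: m => [|m IH] ym.
    by rewrite /N big_ord0; lra.
  have [ym'|ym'] := leP y m%:R.
    by rewrite /N big_ord_recr/= -/(N m) (le_trans (IH ym'))// lerDl.
  rewrite /N big_ord_recr/= -/(N m) full; last exact: ltW.
  by rewrite -natr1 in ym; apply: (@le_trans _ _ m%:R); [lra|rewrite lerDl].
move=> /andP[y0 yn]; rewrite -/(N n) ler_norml.
by have := up n y0; have := low n yn; lra.
Qed.

End counting_approximation.

Section independence.
Context (R : realType) (d : measure_display) (T : measurableType d).
Variable P : probability T R.

Lemma prob_Rintegral_indic (A : set T) : measurable A ->
  \int[P]_t \1_A t = fine (P A).
Proof. by move=> mA; rewrite /Rintegral integral_indic// setIT. Qed.

Lemma expect_factor (Y W : T -> R) (r B : R) (h : R -> R) :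
  measurable_fun setT Y -> measurable_fun setT W -> (forall t, `|W t| <= B) ->
  (forall A : set R, measurable A ->
    \int[P]_t (\1_(Y @^-1` A) t * W t) = fine (P (Y @^-1` A)) * r) ->
  measurable_fun setT h -> (forall x, `|h x| <= 1) ->
  \int[P]_t (h (Y t) * W t) = \int[P]_t h (Y t) * r.
Proof.
move=> mY mW WB ind mh h1.
have t0 : T := point.
have B0 : 0 <= B by exact: le_trans (WB t0).
have iW : P.-integrable setT (EFin \o W) by exact: integrable_prob_bounded.
have mhY : measurable_fun setT (fun t => h (Y t)) by exact: measurableT_comp.
have ihY : P.-integrable setT (EFin \o (fun t => h (Y t))).
  exact: integrable_prob_bounded.
have ihW : P.-integrable setT (EFin \o (fun t => h (Y t) * W t)).
  by apply: (@integrable_mul_bounded _ _ _ P _ _ _ 1).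
(* Rescaled into [0, 1], the range in which floor staircases apply; both sides are affine in [h], so
   nothing is lost. *)
pose g y := (1 + h y) / 2.
have mg : measurable_fun setT g.
  by apply: measurable_funM => //; exact: measurable_funD.
have g01 y : 0 <= g y <= 1.
  by have := h1 y; rewrite ler_norml /g; lra.
have mgY : measurable_fun setT (fun t => g (Y t)) by exact: measurableT_comp.
have gb t : `|g (Y t)| <= 1 by have := g01 (Y t); rewrite ler_norml; lra.
have igY : P.-integrable setT (EFin \o (fun t => g (Y t))).
  exact: integrable_prob_bounded.
have igW : P.-integrable setT (EFin \o (fun t => g (Y t) * W t)).
  by apply: (@integrable_mul_bounded _ _ _ P _ _ _ 1).
suff main : \int[P]_t (g (Y t) * W t) = \int[P]_t g (Y t) * r.
  have iWr : \int[P]_t W t = r.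
    have := ind setT measurableT; rewrite preimage_setT probability_setT/= mul1r => <-.
    by apply: eq_Rintegral => t _; rewrite indicT mul1r.
  have -> : \int[P]_t (h (Y t) * W t) = \int[P]_t (2 * (g (Y t) * W t) - W t).
    by apply: eq_Rintegral => t _; rewrite /g; field.
  rewrite RintegralB//; last exact: integrable_mulZl.
  rewrite RintegralZl// main iWr.
  have -> : \int[P]_t h (Y t) = \int[P]_t (2 * g (Y t) - 1).
    by apply: eq_Rintegral => t _; rewrite /g; field.
  rewrite RintegralB//; [|exact: integrable_mulZl|exact: finite_measure_integrable_cst].
  by rewrite RintegralZl// Rintegral_prob_cst; ring.
(* The indicators of these level sets add up to the floor of (n+1) g, so [gn] is within 1/(n+1) of
   g(Y). *)
pose A (n k : nat) := [set y : R | k.+1%:R <= n.+1%:R * g y].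
have mA n k : measurable (A n k).
  have -> : A n k = setT `&` (fun y => n.+1%:R * g y) @^-1` `[k.+1%:R, +oo[.
    by apply/seteqP; split => y /=; rewrite in_itv/= andbT; [|case].
  by apply: measurable_funM => //; exact: measurable_itv.
have mYA n k : measurable (Y @^-1` A n k).
  by rewrite -[_ @^-1` _]setTI; apply: mY.
pose gn n t : R := n.+1%:R^-1 * \sum_(k < n.+1) \1_(Y @^-1` A n k) t.
have gnb n t : `|g (Y t) - gn n t| <= n.+1%:R^-1.
  have := @staircase_bound R n.+1 (n.+1%:R * g (Y t)).
  have := g01 (Y t) => /andP[g0 g1].
  rewrite mulr_ge0// ler_piMr// => /(_ isT) h0.
  have -> : g (Y t) - gn n t = n.+1%:R^-1 * (n.+1%:R * g (Y t) -
      \sum_(k < n.+1) ((k.+1%:R <= n.+1%:R * g (Y t))%R)%:R).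
    rewrite mulrBr mulrA mulVf ?mul1r ?pnatr_eq0//; congr (_ - _ * _).
    apply: eq_bigr => k _; rewrite indicE; congr (nat_of_bool _)%:R.
    by apply/idP/idP; rewrite inE.
  by rewrite normrM ger0_norm ?invr_ge0// ler_piMr// invr_ge0.
have mgn n : measurable_fun setT (gn n).
  by apply: measurable_funM => //; apply: measurable_sum => k; exact: measurable_indic.
have gnE n : \int[P]_t (gn n t * W t) = \int[P]_t gn n t * r.
  have ii k : P.-integrable setT (EFin \o (fun t => \1_(Y @^-1` A n k) t * W t)).
    apply: (@integrable_mul_bounded _ _ _ P _ _ _ 1) => //.
    by move=> t _; rewrite indicE normr_nat lern1 leq_b1.
  have ij k : P.-integrable setT (EFin \o (\1_(Y @^-1` A n k) : T -> R)).
    apply: (@integrable_prob_bounded _ _ _ _ _ 1) => //.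
    by move=> t; rewrite indicE normr_nat lern1 leq_b1.
  have Esum N : P.-integrable setT (EFin \o (fun t => (\sum_(k < N) \1_(Y @^-1` A n k) t) * W t)) /\
      P.-integrable setT (EFin \o (fun t => (\sum_(k < N) \1_(Y @^-1` A n k) t) : R)) /\
      \int[P]_t ((\sum_(k < N) \1_(Y @^-1` A n k) t) * W t) =
      \int[P]_t (\sum_(k < N) \1_(Y @^-1` A n k) t) * r.
    elim: N => [|N [IH1 [IH2 IH3]]].
      have i0 : P.-integrable setT (EFin \o (fun t => 0 : R)).
        exact: finite_measure_integrable_cst.
      split; [|split].
      - by under eq_fun do rewrite big_ord0 mul0r.
      - by under eq_fun do rewrite big_ord0.
      - under eq_Rintegral do rewrite big_ord0 mul0r.
        under [X in _ = X * _]eq_Rintegral do rewrite big_ord0.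
        by rewrite Rintegral_prob_cst mul0r.
    have E1 : (fun t => (\sum_(k < N.+1) \1_(Y @^-1` A n k) t) * W t) =
       (fun t => (\sum_(k < N) \1_(Y @^-1` A n k) t) * W t + \1_(Y @^-1` A n N) t * W t).
      by apply/funext => t; rewrite big_ord_recr/= mulrDl.
    have E2 : (fun t => (\sum_(k < N.+1) \1_(Y @^-1` A n k) t) : R) =
       (fun t => (\sum_(k < N) \1_(Y @^-1` A n k) t) + \1_(Y @^-1` A n N) t).
      by apply/funext => t; rewrite big_ord_recr.
    rewrite E1 E2; split; [exact: integrable_add|split; first exact: integrable_add].
    by rewrite !RintegralD// IH3 ind// -prob_Rintegral_indic// mulrDl.
  have [h2 [h3 h4]] := Esum n.+1.
  rewrite /gn; under eq_Rintegral do rewrite -mulrA.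
  by rewrite RintegralZl// [in RHS]RintegralZl// h4 mulrA.
apply/eqP; rewrite -subr_eq0 -normr_le0; apply/ler_addgt0Pl => e e0; rewrite addr0.
have [n hn] : exists n : nat, (B + `|r|) * n.+1%:R^-1 <= e.
  have e1 : 0 < e / (B + `|r| + 1) by rewrite divr_gt0// ltr_wpDl// addr_ge0.
  have /cvgrPdist_lt /(_ _ e1) [n _ /(_ n (leqnn _))] := @cvg_harmonic R.
  rewrite /= sub0r normrN ger0_norm ?invr_ge0// => hn.
  exists n; have Br : 0 <= B + `|r| by rewrite addr_ge0.
  apply: (le_trans (ler_wpM2l Br (ltW hn))).
  by rewrite mulrCA ler_piMr ?ltW// ltr_pdivrMr ?ltr_wpDl// mul1r ltrDl.
apply: le_trans hn.
have gn2 t : `|gn n t| <= 2.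
  have := ler_normB (g (Y t)) (g (Y t) - gn n t); rewrite subKr => tri.
  rewrite (le_trans tri)// (_ : 2 = 1 + 1)// lerD//.
  by rewrite (le_trans (gnb n t))// invf_le1// ler1n.
have ign : P.-integrable setT (EFin \o gn n).
  exact: (@integrable_prob_bounded _ _ _ _ _ 2).
have ignW : P.-integrable setT (EFin \o (fun t => gn n t * W t)).
  apply: (@integrable_prob_bounded _ _ _ _ _ (2 * B)) => [|t].
    exact: measurable_funM.
  by rewrite normrM ler_pM.
have -> : \int[P]_t (g (Y t) * W t) - \int[P]_t g (Y t) * r =
   \int[P]_t ((g (Y t) - gn n t) * W t) - \int[P]_t (g (Y t) - gn n t) * r.
  under [X in _ = X - _]eq_Rintegral do rewrite mulrBl.
  by rewrite !RintegralB// gnE; ring.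
apply: (le_trans (ler_normB _ _)); rewrite mulrDl lerD//.
  rewrite mulrC; apply: normr_expect_le.
    by apply: measurable_funM => //; exact: measurable_funB.
  by move=> t; rewrite normrM ler_pM.
rewrite normrM mulrC ler_wpM2l//; apply: normr_expect_le => //.
exact: measurable_funB.
Qed.

Section independent_sum.
Variables (n : nat) (X : 'I_n -> T -> R).
Hypothesis mX : forall i, measurable_fun setT (X i).
Hypothesis indX : mutually_indep P X.
Variables (q er ei : 'I_n -> R).
Hypothesis char_cos : forall i, \int[P]_t cos (q i * X i t) = expR (- er i) * cos (ei i).
Hypothesis char_sin : forall i, \int[P]_t sin (q i * X i t) = - (expR (- er i) * sin (ei i)).

Let I (B : 'I_n -> set R) := \bigcap_(i in [set: 'I_n]) (X i @^-1` B i).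

Let mXB (B : 'I_n -> set R) i : (forall i, measurable (B i)) -> measurable (X i @^-1` B i).
Proof. by move=> mB; rewrite -[_ @^-1` _]setTI; apply: mX. Qed.

Let mI B : (forall i, measurable (B i)) -> measurable (I B).
Proof.
by move=> mB; apply: fin_bigcap_measurable => //= i _; exact: mXB.
Qed.

Let upd (B : 'I_n -> set R) (j : 'I_n) (A : set R) i := if i == j then A else B i.

Let I_upd B j A : B j = setT -> I (upd B j A) = X j @^-1` A `&` I B.
Proof.
move=> Bj; apply/seteqP; split => [t h|t [tA h] i _]; rewrite /upd.
  split; first by have := h j Logic.I; rewrite /upd eqxx.
  move=> i _; have := h i Logic.I; rewrite /upd; case: eqP => [->|//].
  by rewrite Bj.
by case: eqP => [->//|_]; exact: h.
Qed.

Let P_upd B j A : (forall i, measurable (B i)) -> measurable A -> B j = setT ->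
  fine (P (I (upd B j A))) = fine (P (X j @^-1` A)) * fine (P (I B)).
Proof.
move=> mB mA Bj.
have mu' i : measurable (upd B j A i) by rewrite /upd; case: ifP.
rewrite !indX//.
have fineprod (C : 'I_n -> set R) : (forall i, measurable (C i)) ->
    fine (\prod_(i < n) P (X i @^-1` C i))%E = \prod_(i < n) fine (P (X i @^-1` C i)).
  move=> mC; rewrite -[RHS]/(fine (\prod_(i < n) fine (P (X i @^-1` C i)))%:E) -prodEFin.
  congr fine; apply: eq_bigr => i _; rewrite fineK//.
  by apply: fin_num_measure; exact: mXB.
rewrite !fineprod// (bigD1 j)//= [in RHS](bigD1 j)//= /upd eqxx Bj preimage_setT.
rewrite probability_setT/= mul1r; congr (_ * _).
by apply: eq_bigr => i ij; rewrite (negbTE ij).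
Qed.

Let S (j : nat) t := \sum_(i < n | (i < j)%N) q i * X i t.
Let Er (j : nat) := \sum_(i < n | (i < j)%N) er i.
Let Ei (j : nat) := \sum_(i < n | (i < j)%N) ei i.

Let mS j : measurable_fun setT (S j).
Proof.
have -> : S j = fun t => \sum_(i < n) (if (i < j)%N then q i else 0) * X i t.
  apply/funext => t; rewrite /S big_mkcond; apply: eq_bigr => i _.
  by case: ifP => // _; rewrite mul0r.
by apply: measurable_sum => i; exact: measurable_funM.
Qed.

Let split_sum (f : 'I_n -> R) (j : 'I_n) :
  \sum_(i < n | (i < j.+1)%N) f i = \sum_(i < n | (i < j)%N) f i + f j.
Proof.
rewrite (bigD1 j)//= addrC; congr (_ + _); apply: eq_bigl => i.
by rewrite ltnS [in RHS]ltn_neqAle andbC.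
Qed.

(** The indicator of an event on the variables of index >= j is what lets the induction run. Taking
    [A] for the set at index j turns the induction hypothesis into the factorisation over events of
    X_j that [expect_factor] asks for, so independence is only ever used on rectangles. *)
Let char_prefix (j : nat) (B : 'I_n -> set R) : (j <= n)%N ->
  (forall i, measurable (B i)) -> (forall i : 'I_n, (i < j)%N -> B i = setT) ->
  \int[P]_t (cos (S j t) * \1_(I B) t) = expR (- Er j) * cos (Ei j) * fine (P (I B)) /\
  \int[P]_t (sin (S j t) * \1_(I B) t) = - (expR (- Er j) * sin (Ei j)) * fine (P (I B)).
Proof.
elim: j B => [|j IH] B jn mB BT.
  rewrite /Er /Ei /S !big_pred0//; rewrite oppr0 expR0 cos0 sin0 !mulr0 oppr0 mul0r !mul1r.
  have E t : \sum_(i < n | (i < 0)%N) q i * X i t = 0 by rewrite big_pred0.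
  under eq_Rintegral do rewrite E cos0 mul1r.
  under [X in _ /\ X = _]eq_Rintegral do rewrite E sin0 mul0r.
  by rewrite Rintegral_prob_cst prob_Rintegral_indic//; exact: mI.
pose jo := Ordinal jn.
have Bj : B jo = setT by apply: BT.
have mind : measurable_fun setT (\1_(I B) : T -> R) by apply: measurable_indic; exact: mI.
have ind1 t : `|\1_(I B) t : R| <= 1 by rewrite indicE normr_nat lern1 leq_b1.
have IHA (A : set R) : measurable A ->
    let r := fine (P (I B)) in
    \int[P]_t (\1_(X jo @^-1` A) t * (cos (S j t) * \1_(I B) t)) =
      fine (P (X jo @^-1` A)) * (expR (- Er j) * cos (Ei j) * r) /\
    \int[P]_t (\1_(X jo @^-1` A) t * (sin (S j t) * \1_(I B) t)) =
      fine (P (X jo @^-1` A)) * (- (expR (- Er j) * sin (Ei j)) * r).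
  move=> mA r.
  have mu' i : measurable (upd B jo A i) by rewrite /upd; case: ifP.
  have [|h1 h2] := IH (upd B jo A) (ltnW jn) mu'.
    move=> i ij; rewrite /upd; case: eqP => [ijo|_]; last by apply: BT; rewrite ltnW.
    by move: ij; rewrite ijo /= ltnn.
  have indE t : \1_(I (upd B jo A)) t = \1_(X jo @^-1` A) t * \1_(I B) t :> R.
    by rewrite I_upd// indicI.
  move: h1 h2; rewrite P_upd//.
  under eq_Rintegral do rewrite indE mulrCA.
  under [X in _ -> X = _ -> _]eq_Rintegral do rewrite indE mulrCA.
  by move=> e1 e2; split; [rewrite e1|rewrite e2]; rewrite /r; ring.
have mc : measurable_fun setT (fun t => cos (S j t) * \1_(I B) t).
  by apply: measurable_funM => //; apply: measurableT_comp => //; exact: measurable_cosR.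
have ms : measurable_fun setT (fun t => sin (S j t) * \1_(I B) t).
  by apply: measurable_funM => //; apply: measurableT_comp => //; exact: measurable_sinR.
have bc t : `|cos (S j t) * \1_(I B) t| <= 1.
  by rewrite normrM -[leRHS]mulr1 ler_pM// normr_cos_le1.
have bs t : `|sin (S j t) * \1_(I B) t| <= 1.
  by rewrite normrM -[leRHS]mulr1 ler_pM// normr_sin_le1.
have mhc := measurable_cos_scale (q jo); have mhs := measurable_sin_scale (q jo).
have hc y : `|cos (q jo * y)| <= 1 by exact: normr_cos_le1.
have hs y : `|sin (q jo * y)| <= 1 by exact: normr_sin_le1.
have F1 := expect_factor (mX jo) mc bc (fun A mA => (IHA A mA).1) mhc hc.
have F2 := expect_factor (mX jo) ms bs (fun A mA => (IHA A mA).2) mhs hs.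
have F3 := expect_factor (mX jo) mc bc (fun A mA => (IHA A mA).1) mhs hs.
have F4 := expect_factor (mX jo) ms bs (fun A mA => (IHA A mA).2) mhc hc.
have int (f g : T -> R) : measurable_fun setT f -> measurable_fun setT g ->
    (forall t, `|f t| <= 1) -> (forall t, `|g t| <= 1) ->
    P.-integrable setT (EFin \o (fun t => f t * g t)).
  move=> mf mg f1 g1; apply: (@integrable_prob_bounded _ _ _ _ _ 1).
    exact: measurable_funM.
  by move=> t; rewrite normrM -[leRHS]mulr1 ler_pM.
have mhc' : measurable_fun setT (fun t => cos (q jo * X jo t)) by exact: (measurableT_comp mhc).
have mhs' : measurable_fun setT (fun t => sin (q jo * X jo t)) by exact: (measurableT_comp mhs).
have SE t : S j.+1 t = S j t + q jo * X jo t by exact: (split_sum (fun i => q i * X i t) jo).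
have ErE : Er j.+1 = Er j + er jo by exact: (split_sum er jo).
have EiE : Ei j.+1 = Ei j + ei jo by exact: (split_sum ei jo).
split.
  transitivity (\int[P]_t (cos (q jo * X jo t) * (cos (S j t) * \1_(I B) t) -
      sin (q jo * X jo t) * (sin (S j t) * \1_(I B) t))).
    by apply: eq_Rintegral => t _; rewrite SE cosD; ring.
  rewrite RintegralB//; [|exact: int|exact: int].
  rewrite F1 F2 char_cos char_sin ErE EiE opprD expRD cosD; ring.
transitivity (\int[P]_t (cos (q jo * X jo t) * (sin (S j t) * \1_(I B) t) +
    sin (q jo * X jo t) * (cos (S j t) * \1_(I B) t))).
  by apply: eq_Rintegral => t _; rewrite SE sinD; ring.
rewrite RintegralD//; [|exact: int|exact: int].
rewrite F4 F3 char_cos char_sin ErE EiE opprD expRD sinD; ring.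
Qed.

Lemma char_independent_sum :
  \int[P]_t cos (\sum_i q i * X i t) = expR (- \sum_i er i) * cos (\sum_i ei i) /\
  \int[P]_t sin (\sum_i q i * X i t) = - (expR (- \sum_i er i) * sin (\sum_i ei i)).
Proof.
have [] := @char_prefix n (fun=> setT) (leqnn _) (fun=> measurableT) (fun _ _ => erefl).
have -> : I (fun=> setT) = setT by apply/seteqP; split.
have full (f : 'I_n -> R) : \sum_(i < n | (i < n)%N) f i = \sum_i f i.
  by apply: eq_bigl => i; rewrite ltn_ord.
rewrite /Er /Ei !full probability_setT/= !mulr1 => <- <-.
by split; apply: eq_Rintegral => t _; rewrite /S full indicT mulr1.
Qed.

End independent_sum.

End independence.

(** * Rewriting simple functions over disjoint sets *)

Section disjoint_simple_functions.
Variable R : realType.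
Local Notation leb := (@lebesgue_measure R).
Implicit Types (s : seq (R * set R)) (A B : set R) (g : R -> R).

Definition disj_sets s :=
  pairwise (fun c c' : R * set R => `[< c.2 `&` c'.2 = set0 >]) s.

(** Adds a 1_A to a family: every member is split into its parts inside and outside A, the former
    gaining [a], and what remains of A is appended at the end. *)
Fixpoint refine_simple (a : R) A s : seq (R * set R) :=
  if s is d :: s' then
    (d.1 + a, d.2 `&` A) :: (d.1, d.2 `\` A) :: refine_simple a (A `\` d.2) s'
  else [:: (a, A)].

Fixpoint disjointify s : seq (R * set R) :=
  if s is c :: s' then refine_simple c.1 c.2 (disjointify s') else [::].

Lemma lebesgue_fin_subset A B : measurable A -> measurable B -> A `<=` B ->
  (leb B < +oo)%E -> (leb A < +oo)%E.
Proof. by move=> mA mB AB; apply: le_lt_trans; apply: le_measure => //; rewrite inE. Qed.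

Lemma simple_adm_cons c s : simple_adm (c :: s) <->
  (measurable c.2 /\ (leb c.2 < +oo)%E) /\ simple_adm s.
Proof.
split=> [h|[hc hs] c']; last by rewrite inE => /predU1P[->//|]; exact: hs.
by split=> [|c' c's]; apply: h; rewrite inE ?eqxx// c's orbT.
Qed.

Lemma refine_simple_adm a A s : measurable A -> (leb A < +oo)%E ->
  simple_adm s -> simple_adm (refine_simple a A s).
Proof.
elim: s a A => [|d s IH] a A mA lA /=.
  by move=> _; apply/simple_adm_cons; split.
move=> /simple_adm_cons[[md ld] hs].
apply/simple_adm_cons; split => /=.
  split; first exact: measurableI.
  by apply: lebesgue_fin_subset ld => //; exact: measurableI.
apply/simple_adm_cons; split => /=.
  split; first exact: measurableD.
  by apply: lebesgue_fin_subset ld => //; exact: measurableD.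
apply: IH => //; first exact: measurableD.
by apply: lebesgue_fin_subset lA => //; exact: measurableD.
Qed.

Lemma disjointify_adm s : simple_adm s -> simple_adm (disjointify s).
Proof.
elim: s => [//|c s IH] /simple_adm_cons[[mc lc] hs] /=.
by apply: refine_simple_adm => //; exact: IH.
Qed.

Lemma sf_eval_cons c s (x : R) : sf_eval (c :: s) x = c.1 * \1_(c.2) x + sf_eval s x.
Proof. by rewrite /sf_eval big_cons. Qed.

Lemma sf_eval_refine a A s (x : R) :
  sf_eval (refine_simple a A s) x = a * \1_A x + sf_eval s x.
Proof.
elim: s a A => [|d s IH] a A /=; first by rewrite sf_eval_cons.
rewrite !sf_eval_cons/= IH !setDE !indicE !in_setI !classical_sets.in_setC.
by case: (x \in A); case: (x \in d.2) => /=; ring.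
Qed.

Lemma sf_eval_disjointify s (x : R) : sf_eval (disjointify s) x = sf_eval s x.
Proof.
elim: s => [//|c s IH] /=.
by rewrite sf_eval_refine IH sf_eval_cons.
Qed.

Let disj_refine_from B a A s : B `&` A = set0 ->
  all (fun c : R * set R => `[< B `&` c.2 = set0 >]) s ->
  all (fun c : R * set R => `[< B `&` c.2 = set0 >]) (refine_simple a A s).
Proof.
elim: s a A => [|d s IH] a A BA /=; first by move=> _; rewrite andbT; exact/asboolP.
move=> /andP[/asboolP Bd hs]; apply/and3P; split.
- by apply/asboolP; rewrite setIA Bd set0I.
- by apply/asboolP; rewrite setDE setIA Bd set0I.
- by apply: IH => //; rewrite setDE setIA BA set0I.
Qed.

Lemma refine_simple_disj a A s : disj_sets s -> disj_sets (refine_simple a A s).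
Proof.
rewrite /disj_sets; elim: s a A => [//|d s IH] a A.
rewrite pairwise_cons => /andP[hd hs] /=; rewrite IH// andbT.
have sub B : B `<=` d.2 -> all (fun c : R * set R => `[< B `&` c.2 = set0 >]) s.
  move=> Bd; apply: sub_all hd => c /asboolP h; apply/asboolP.
  by apply/seteqP; split => // x [/Bd dx cx]; rewrite -h.
rewrite -andbA; apply/and3P; split.
- by apply/asboolP/seteqP; split => // x [[_ +]] [].
- apply: disj_refine_from; last by apply: sub; exact: subIsetl.
  by apply/seteqP; split => // x [[dx _]] [].
- apply: disj_refine_from; last by apply: sub; exact: subDsetl.
  by apply/seteqP; split => // x [[_ nA]] [].
Qed.

Lemma disjointify_disj s : disj_sets (disjointify s).
Proof. by elim: s => [//|c s IH] /=; exact: refine_simple_disj. Qed.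

Lemma sf_eval_notin s (x : R) : (forall c, c \in s -> ~ c.2 x) -> sf_eval s x = 0.
Proof.
move=> h; rewrite /sf_eval big1_seq// => c /andP[_ cs].
by rewrite indicE memNset ?mulr0//; exact: h.
Qed.

(** By disjointness at most one term is nonzero at each point, so [g] acts term by term; [g 0 = 0]
    covers the points outside all the sets. *)
Lemma Rintegral_sf_eval g s : g 0 = 0 -> simple_adm s -> disj_sets s ->
  leb.-integrable setT (EFin \o (fun x => g (sf_eval s x))) /\
  \int[leb]_x g (sf_eval s x) = \sum_(c <- s) fine (leb c.2) * g c.1.
Proof.
move=> g0; elim: s => [|c s IH].
  have E x : g (sf_eval [::] x) = 0 by rewrite /sf_eval big_nil.
  move=> _ _; rewrite big_nil; split.
    by under eq_fun do rewrite E; exact: integrable0.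
  by under eq_Rintegral do rewrite E; rewrite Rintegral_cst// mul0r.
rewrite /disj_sets pairwise_cons => /simple_adm_cons[[mc lc] hs] /andP[/allP hc ds].
have [i1 i2] := IH hs ds.
have E x : g (sf_eval (c :: s) x) = g c.1 * \1_(c.2) x + g (sf_eval s x).
  rewrite sf_eval_cons indicE; case: (boolP (x \in c.2)) => xc; last first.
    by rewrite !mulr0 !add0r.
  rewrite (@sf_eval_notin s) ?g0 ?addr0 ?mulr1// => c' c's c'x.
  have /asboolP h := hc _ c's.
  have : (c.2 `&` c'.2) x by split => //; exact/set_mem.
  by rewrite h.
have ic : leb.-integrable setT (EFin \o (fun x => g c.1 * \1_(c.2) x)).
  apply: integrable_mulZl => //; apply/integrableP; split.
    by apply/measurable_EFinP; exact: measurable_indic.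
  under eq_integral do rewrite /= ger0_norm//.
  by rewrite integral_indic// setIT.
split; first by under eq_fun do rewrite E; exact: integrable_add.
under eq_Rintegral do rewrite E.
rewrite RintegralD// i2 big_cons; congr (_ + _).
rewrite RintegralZl//; first by rewrite mulrC /Rintegral integral_indic// setIT.
apply/integrableP; split; first by apply/measurable_EFinP; exact: measurable_indic.
under eq_integral do rewrite /= ger0_norm//.
by rewrite integral_indic// setIT.
Qed.

End disjoint_simple_functions.

(** * Integrals of simple functions against the stable random measure *)

Section stable_measure.
Context (R : realType) (d : measure_display) (T : measurableType d).
Variables (P : probability T R) (delta rho : R) (M : set R -> T -> R).
Local Notation leb := (@lebesgue_measure R).
Hypothesis delta_gt0 : 0 < delta.
Hypothesis srm : stable_random_measure P delta rho M.

Let mM A : measurable A -> (leb A < +oo)%E -> measurable_fun setT (M A).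
Proof. by case: srm => h _; exact: h. Qed.

(** Sigma-additivity on a sequence of empty sets makes N m converge for m = M(set0); consecutive
    terms differ by m, which must be 0. *)
Lemma random_measure0 : {ae P, forall t, M set0 t = 0}.
Proof.
have [_ [h _]] := srm.
have tF : trivIset setT (fun _ : nat => set0 : set R).
  by apply/trivIsetP => i j _ _ _; rewrite set0I.
have := h _ (fun=> measurable0) tF.
rewrite bigcup0// measure0 => /(_ (ltry _)); apply: filterS => t.
set m := M set0 t => hm.
have E N : \sum_(i < N) m = m *+ N by rewrite sumr_const card_ord.
have {}hm : m *+ N @[N --> \oo] --> m by move: hm; under eq_fun do rewrite E.
have hm1 : m *+ N.+1 @[N --> \oo] --> m.
  by rewrite (cvg_shiftS (fun N => m *+ N)).
have : m *+ N.+1 - m *+ N @[N --> \oo] --> m - m by exact: cvgB.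
under eq_fun do rewrite mulrS addrK; rewrite subrr => h1.
by move/(cvg_lim (@Rhausdorff R)) : h1; rewrite (lim_cst (@Rhausdorff R)).
Qed.

Lemma random_measureU A B : measurable A -> measurable B ->
  (leb A < +oo)%E -> (leb B < +oo)%E -> A `&` B = set0 ->
  {ae P, forall t, M (A `|` B) t = M A t + M B t}.
Proof.
move=> mA mB lA lB AB0; have [_ [h _]] := srm.
have mF n : measurable (bigcup2 A B n).
  by case: n => [|[|n]]; rewrite /bigcup2/=.
have tF : trivIset setT (bigcup2 A B).
  apply/trivIsetP => -[|[|i]] [|[|j]] _ _ //= _; rewrite /bigcup2 ?set0I ?setI0//.
  by rewrite setIC.
have := h _ mF tF; rewrite bigcup2E => /(_ _)/wrap[].
  apply: (@le_lt_trans _ _ (leb A + leb B)%E); first exact: measureU2.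
  exact: lte_add_pinfty.
move=> h1; apply: filterS2 h1 random_measure0 => t ht h0.
apply/esym/(cvg_unique _ _ ht) => //.
(* From two terms on, only empty sets are added, so the partial sums are constant outside the null
   set of [random_measure0]. *)
apply: cvg_near_cst; exists 2%N => // -[|[|N]]//= _.
rewrite big_ord_recl big_ord_recl /= big1 ?addr0//.
Qed.

Lemma sf_int_cons c s t : sf_int M (c :: s) t = c.1 * M c.2 t + sf_int M s t.
Proof. by rewrite /sf_int big_cons. Qed.

Lemma measurable_sf_int s : simple_adm s -> measurable_fun setT (sf_int M s).
Proof.
elim: s => [|c s IH].
  by move=> _; rewrite (_ : sf_int M [::] = cst 0)//; apply/funext => t; rewrite /sf_int big_nil.
move=> /simple_adm_cons[[mc lc] hs].
rewrite (_ : sf_int M (c :: s) = fun t => c.1 * M c.2 t + sf_int M s t); last first.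
  by apply/funext => t; rewrite sf_int_cons.
by apply: measurable_funD; [apply: measurable_funM => //; exact: mM|exact: IH].
Qed.

(** Pointwise equality is out of reach: every use of finite additivity has its own null set,
    depending on the sets. *)
Lemma sf_int_refine a A s : measurable A -> (leb A < +oo)%E -> simple_adm s ->
  {ae P, forall t, sf_int M (refine_simple a A s) t = a * M A t + sf_int M s t}.
Proof.
elim: s a A => [|e s IH] a A mA lA.
  by move=> _; apply: aeW => t; rewrite /= sf_int_cons.
move=> /simple_adm_cons[[me le] hs] /=.
have mI := measurableI _ _ me mA.
have mD1 := measurableD me mA.
have mD2 := measurableD mA me.
have lI : (leb (e.2 `&` A) < +oo)%E by apply: lebesgue_fin_subset le => //; exact: subIsetl.
have lD1 : (leb (e.2 `\` A) < +oo)%E by apply: lebesgue_fin_subset le => //; exact: subDsetl.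
have lD2 : (leb (A `\` e.2) < +oo)%E by apply: lebesgue_fin_subset lA => //; exact: subDsetl.
have h1 : {ae P, forall t, M e.2 t = M (e.2 `&` A) t + M (e.2 `\` A) t}.
  rewrite -[in X in {ae P, forall t, M X t = _}](setUIDK e.2 A).
  apply: random_measureU => //.
  by apply/seteqP; split => // x [[_ ?]] [].
have h2 : {ae P, forall t, M A t = M (e.2 `&` A) t + M (A `\` e.2) t}.
  rewrite -[in X in {ae P, forall t, M X t = _}](setUIDK A e.2) (setIC A).
  apply: random_measureU => //.
  by apply/seteqP; split => // x [[? _]] [].
have h3 := IH a _ mD2 lD2 hs.
apply: filterS3 h1 h2 h3 => t e1 e2 e3.
by rewrite !sf_int_cons/= e3 e1 e2; ring.
Qed.

Lemma sf_int_disjointify s : simple_adm s ->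
  {ae P, forall t, sf_int M (disjointify s) t = sf_int M s t}.
Proof.
elim: s => [_|c s IH]; first exact: aeW.
move=> /simple_adm_cons[[mc lc] hs] /=.
apply: filterS2 (sf_int_refine c.1 mc lc (disjointify_adm hs)) (IH hs) => t -> ->.
by rewrite sf_int_cons.
Qed.

Lemma char_disjoint (s : seq (R * set R)) (p : R) : simple_adm s -> disj_sets s ->
  let er := \sum_(c <- s) fine (leb c.2) * psiRe delta (p * c.1) in
  let ei := \sum_(c <- s) fine (leb c.2) * psiIm delta rho (p * c.1) in
  \int[P]_t cos (p * sf_int M s t) = expR (- er) * cos ei /\
  \int[P]_t sin (p * sf_int M s t) = - (expR (- er) * sin ei).
Proof.
move=> hs ds er ei; have [_ [_ [ind char]]] := srm.
pose F (i : 'I_(size s)) := (tnth (in_tuple s) i).2.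
have fF i : measurable (F i) /\ (leb (F i) < +oo)%E.
  by apply: hs; exact: mem_tnth.
have tF : trivIset setT F.
  apply/trivIsetP => i j _ _ ij.
  have x0 : R * set R := (0, set0).
  have lt (i' j' : 'I_(size s)) : (i' < j')%N -> F i' `&` F j' = set0.
    move=> ltij; have /(pairwiseP x0) h := ds.
    have /asboolP := h i' j' (ltn_ord i') (ltn_ord j') ltij.
    by rewrite /F !(tnth_nth x0).
  have [h|h|h] := ltngtP i j; [exact: lt|by rewrite setIC; exact: lt|].
  by move: ij; rewrite (ord_inj h) eqxx.
have := @char_independent_sum R d T P (size s) (fun i => M (F i))
  (fun i => mM (fF i).1 (fF i).2) (ind _ F fF tF)
  (fun i => p * (tnth (in_tuple s) i).1)
  (fun i => fine (leb (F i)) * psiRe delta (p * (tnth (in_tuple s) i).1))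
  (fun i => fine (leb (F i)) * psiIm delta rho (p * (tnth (in_tuple s) i).1)).
move=> /(_ (fun i => (char _ (fF i).1 (fF i).2 _).1) (fun i => (char _ (fF i).1 (fF i).2 _).2)).
have erE : er = \sum_i fine (leb (F i)) * psiRe delta (p * (tnth (in_tuple s) i).1).
  by rewrite /er big_tnth.
have eiE : ei = \sum_i fine (leb (F i)) * psiIm delta rho (p * (tnth (in_tuple s) i).1).
  by rewrite /ei big_tnth.
have siE t : p * sf_int M s t = \sum_i p * (tnth (in_tuple s) i).1 * M (F i) t.
  by rewrite /sf_int big_tnth mulr_sumr; apply: eq_bigr => i _; rewrite mulrA.
move=> [h1 h2]; rewrite erE eiE -h1 -h2.
by split; apply: eq_Rintegral => t _; rewrite siE.
Qed.

(** The signed power sign(x)|x|^delta, by which [psiIm] scales; its integral over the integrand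
    carries the skewness. *)
Definition spow (x : R) : R := Num.sg x * `|x| `^ delta.

Lemma psiReM (p x : R) : psiRe delta (p * x) = psiRe delta p * `|x| `^ delta.
Proof. by rewrite /psiRe normrM powRM. Qed.

Lemma psiImM (r p x : R) : psiIm delta r (p * x) = psiIm delta r p * spow x.
Proof. by rewrite /psiIm /spow normrM powRM// sgrM; ring. Qed.

Lemma spow0 : spow 0 = 0. Proof. by rewrite /spow sgr0 mul0r. Qed.

(** [disjointify] changes neither the function nor, almost surely, its integral. Over disjoint sets
    independence adds up the exponents, and the sums are integrals of |f|^delta and of the signed
    power. *)
Lemma char_simple (s : seq (R * set R)) (p : R) : simple_adm s ->
  [/\ leb.-integrable setT (EFin \o (fun x => `|sf_eval s x| `^ delta)),
      leb.-integrable setT (EFin \o (fun x => spow (sf_eval s x))),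
      \int[P]_t cos (p * sf_int M s t) =
        expR (- (psiRe delta p * \int[leb]_x `|sf_eval s x| `^ delta)) *
        cos (psiIm delta rho p * \int[leb]_x spow (sf_eval s x)) &
      \int[P]_t sin (p * sf_int M s t) =
        - (expR (- (psiRe delta p * \int[leb]_x `|sf_eval s x| `^ delta)) *
        sin (psiIm delta rho p * \int[leb]_x spow (sf_eval s x)))].
Proof.
move=> hs; pose s' := disjointify s.
have hs' := disjointify_adm hs; have ds' := disjointify_disj s.
have ev : sf_eval s' = sf_eval s by apply/funext => x; exact: sf_eval_disjointify.
have g0 : `|0 : R| `^ delta = 0 by rewrite normr0 powR0// gt_eqF.
have [i1 e1] := @Rintegral_sf_eval _ (fun x => `|x| `^ delta) _ g0 hs' ds'.
have [i2 e2] := Rintegral_sf_eval spow0 hs' ds'.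
have [c1 c2] := char_disjoint p hs' ds'.
have er : \sum_(c <- s') fine (leb c.2) * psiRe delta (p * c.1) =
    psiRe delta p * \int[leb]_x `|sf_eval s x| `^ delta.
  rewrite -ev e1 mulr_sumr; apply: eq_bigr => c _.
  by rewrite psiReM mulrCA.
have ei : \sum_(c <- s') fine (leb c.2) * psiIm delta rho (p * c.1) =
    psiIm delta rho p * \int[leb]_x spow (sf_eval s x).
  rewrite -ev e2 mulr_sumr; apply: eq_bigr => c _.
  by rewrite psiImM mulrCA.
have ae (h : R -> R) : measurable_fun setT h ->
    \int[P]_t h (p * sf_int M s t) = \int[P]_t h (p * sf_int M s' t).
  move=> mh; rewrite /Rintegral; congr fine.
  have m1 s1 : simple_adm s1 -> measurable_fun setT (fun t => (h (p * sf_int M s1 t))%:E).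
    move=> h1; apply/measurable_EFinP; apply: measurableT_comp => //.
    by apply: measurable_funM => //; exact: measurable_sf_int.
  apply: ae_eq_integral => //; [exact: m1|exact: m1|].
  by apply: filterS (sf_int_disjointify hs) => t e _; rewrite e.
split.
- by rewrite -ev.
- by rewrite -ev.
- by rewrite ae ?c1 ?er ?ei//; exact: measurable_cosR.
- by rewrite ae ?c2 ?er ?ei//; exact: measurable_sinR.
Qed.

End stable_measure.

(** * Continuity of powers in L^delta and of characteristic functions in probability *)

Section lipschitz_trig.
Variable R : realType.

Lemma lipschitz1_derive (f f' : R -> R) : (forall x : R, is_derive x 1 f (f' x)) ->
  (forall x, `|f' x| <= 1) -> forall x y, `|f x - f y| <= `|x - y|.
Proof.
move=> df f1; have lt x y : x < y -> `|f x - f y| <= `|x - y|.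
  move=> xy; have [|z _ e] := @MVT _ f f' x y xy (fun z _ => df z).
    by apply: continuous_subspaceT; exact: (is_derive_continuous df).
  by rewrite distrC e normrM (distrC x) ler_piMl.
move=> x y; have [xy|xy|->] := ltgtP x y; first exact: lt.
  by rewrite distrC (distrC x); exact: lt.
by rewrite !subrr normr0.
Qed.

Lemma lipschitz_cos (x y : R) : `|cos x - cos y| <= `|x - y|.
Proof.
apply: (@lipschitz1_derive cos (fun x => - sin x) (@is_derive_cos R)) => z.
by rewrite normrN normr_sin_le1.
Qed.

Lemma lipschitz_sin (x y : R) : `|sin x - sin y| <= `|x - y|.
Proof.
apply: (@lipschitz1_derive sin cos (@is_derive_sin R)) => z.
exact: normr_cos_le1.
Qed.

End lipschitz_trig.

Section power_continuity.
Variables (R : realType) (delta : R).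
Hypothesis delta_gt0 : 0 < delta.
Hypothesis delta_le2 : delta <= 2.

Lemma powR_le_sqr (x : R) : 1 <= x -> x `^ delta <= x ^+ 2.
Proof.
move=> x1; have := ler_powR x1 delta_le2.
by rewrite (_ : 2 = 2%:R :> R)// powR_mulrn// (le_trans _ x1).
Qed.

Lemma powR_ge_sqr (x : R) : 0 <= x <= 1 -> x ^+ 2 <= x `^ delta.
Proof.
move=> /andP[x0 x1]; move: x0; rewrite le_eqVlt => /predU1P[<-|x0].
  by rewrite expr0n/= powR_ge0.
rewrite -(powR_mulrn 2 (ltW x0)) /powR (gt_eqF x0) ler_expR.
by apply: ler_wnM2r => //; exact: ln_le0.
Qed.

(** Two regimes. If |a-b| <= th |b|, then a and b have the same sign and the powers differ by a
    factor between (1-th)^2 >= 1 - 2th and (1+th)^2 <= 1 + 3th. Otherwise both |a| and |b| are at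
    most (1 + 1/th) |a-b|. The bound delta <= 2 enters by replacing the exponent by 2. *)
Lemma powR_close (th a b : R) : 0 < th < 1 ->
  `|(`|a| `^ delta) - `|b| `^ delta| <=
    3 * th * `|b| `^ delta + 2 * (1 + th^-1) ^+ 2 * `|a - b| `^ delta /\
  `|spow delta a - spow delta b| <=
    3 * th * `|b| `^ delta + 2 * (1 + th^-1) ^+ 2 * `|a - b| `^ delta.
Proof.
move=> /andP[th0 th1].
have th3 : 0 <= 3 * th * `|b| `^ delta by rewrite mulr_ge0 ?powR_ge0// mulr_ge0// ltW.
have [close|far] := leP `|a - b| (th * `|b|).
- have R0 : 0 <= 2 * (1 + th^-1) ^+ 2 * `|a - b| `^ delta.
    by rewrite !mulr_ge0 ?powR_ge0// ?exprn_ge0// addr_ge0// invr_ge0 ltW.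
  have up : `|a| <= (1 + th) * `|b|.
    by have := ler_normD (a - b) b; rewrite subrK; lra.
  have low : (1 - th) * `|b| <= `|a|.
    by have := ler_normB a (a - b); rewrite subKr; lra.
  have th1' : 0 <= 1 - th <= 1 by lra.
  have upP : `|a| `^ delta <= (1 + 3 * th) * `|b| `^ delta.
    apply: (le_trans (powR_le_base (ltW delta_gt0) (normr_ge0 _) up)).
    rewrite powRM//; last by rewrite addr_ge0// ltW.
    apply: ler_wpM2r; first exact: powR_ge0.
    apply: (@le_trans _ _ ((1 + th) ^+ 2)); first by apply: powR_le_sqr; rewrite lerDl ltW.
    by rewrite expr2; nra.
  have lowP : (1 - 2 * th) * `|b| `^ delta <= `|a| `^ delta.
    have : ((1 - th) * `|b|) `^ delta <= `|a| `^ delta.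
      by apply: powR_le_base low => //; [exact: ltW|rewrite mulr_ge0//; lra].
    apply: le_trans; rewrite powRM//; last by lra.
    rewrite ler_wpM2r ?powR_ge0// (le_trans _ (powR_ge_sqr th1'))//.
    by rewrite expr2; nra.
  have B0 : 0 <= `|b| `^ delta by exact: powR_ge0.
  have main : `|(`|a| `^ delta) - `|b| `^ delta| <= 3 * th * `|b| `^ delta.
    by rewrite ler_norml; nra.
  split; first by lra.
  suff -> : spow delta a - spow delta b = Num.sg b * (`|a| `^ delta - `|b| `^ delta).
    rewrite normrM normr_sg (le_trans (ler_piMl _ _)) ?lern1 ?leq_b1//; lra.
  rewrite mulrBr /spow; congr (_ * _ - _).
  have [b0|b0] := eqVneq b 0.
    by move: close; rewrite b0 normr0 mulr0 subr0 normr_le0 => /eqP ->.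
  have ab : `|a - b| < `|b|.
    by rewrite (le_lt_trans close)// gtr_pMl ?normr_gt0.
  have [bp|bn|b00] := ltgtP b 0.
  + rewrite !ltr0_sg//; move: ab; rewrite (ltr0_norm bp) ltr_norml; lra.
  + rewrite !gtr0_sg//; move: ab; rewrite (gtr0_norm bn) ltr_norml; lra.
  + by rewrite b00 eqxx in b0.
- have bD : `|b| <= (1 + th^-1) * `|a - b|.
    rewrite mulrDl mul1r (le_trans _ (_ : th^-1 * `|a - b| <= _))//; last first.
      by rewrite lerDr.
    by rewrite ler_pdivlMl// ltW.
  have aD : `|a| <= (1 + th^-1) * `|a - b|.
    have : `|b| <= th^-1 * `|a - b| by rewrite ler_pdivlMl// ltW.
    by have := ler_normD (a - b) b; rewrite subrK mulrDl mul1r; lra.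
  have t1 : 1 <= 1 + th^-1 by rewrite lerDl invr_ge0 ltW.
  have P (y : R) : `|y| <= (1 + th^-1) * `|a - b| ->
      `|y| `^ delta <= (1 + th^-1) ^+ 2 * `|a - b| `^ delta.
    move=> /(powR_le_base (ltW delta_gt0) (normr_ge0 _)) h; apply: (le_trans h).
    rewrite powRM// ?(le_trans _ t1)// ler_wpM2r ?powR_ge0//.
    exact: powR_le_sqr.
  have Pa := P _ aD; have Pb := P _ bD.
  have S (y : R) : `|spow delta y| <= `|y| `^ delta.
    rewrite /spow normrM normr_sg (ger0_norm (powR_ge0 _ _)) ler_piMl ?powR_ge0//.
    by rewrite lern1 leq_b1.
  split.
    apply: (le_trans (ler_normB _ _)); rewrite !(ger0_norm (powR_ge0 _ _)); lra.
  by apply: (le_trans (ler_normB _ _)); have := S a; have := S b; lra.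
Qed.

End power_continuity.

Section char_limit.
Context (R : realType) (d : measure_display) (T : measurableType d).
Variable P : probability T R.

Lemma char_cvg_prob (h : R -> R) (Z_ : nat -> T -> R) (Z : T -> R) (p : R) :
  measurable_fun setT h -> (forall x, `|h x| <= 1) ->
  (forall x y, `|h x - h y| <= `|x - y|) ->
  (forall n, measurable_fun setT (Z_ n)) -> measurable_fun setT Z ->
  (forall e : R, 0 < e -> (fun n => P [set t | e < `|Z_ n t - Z t|]) @ \oo --> 0%E) ->
  \int[P]_t h (p * Z_ n t) @[n --> \oo] --> \int[P]_t h (p * Z t).
Proof.
move=> mh h1 hl mZ_ mZ cvgP.
have mhZ (Y : T -> R) : measurable_fun setT Y -> measurable_fun setT (fun t => h (p * Y t)).
  by move=> mY; apply: measurableT_comp => //; exact: measurable_funM.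
have ihZ (Y : T -> R) : measurable_fun setT Y ->
    P.-integrable setT (EFin \o (fun t => h (p * Y t))).
  by move=> mY; apply: (@integrable_prob_bounded _ _ _ _ _ 1) => //; exact: mhZ.
apply/cvgrPdist_le => e e0.
(* Off the event [A] the Lipschitz bound costs |p| e1 <= e/2; on [A], eventually of probability at
   most e/4, the difference is at most 2. *)
pose e1 := e / 2 / (`|p| + 1).
have e10 : 0 < e1 by rewrite !divr_gt0// ltr_wpDl.
have e4 : 0 < e / 4 by rewrite divr_gt0.
have /fine_cvgP[_ /cvgrPdist_le /(_ _ e4)] := cvgP e1 e10.
apply: filterS => n; rewrite sub0r normrN => hn.
set A := [set t | e1 < `|Z_ n t - Z t|] in hn *.
have mA : measurable A.
  have -> : A = setT `&` (fun t => `|Z_ n t - Z t|) @^-1` `]e1, +oo[.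
    by apply/seteqP; split => t /=; rewrite in_itv/= andbT; [|case].
  by apply: measurableT_comp => //; exact: measurable_funB.
have iA : P.-integrable setT (EFin \o (fun t => `|p| * e1 + 2 * \1_A t)).
  apply: (@integrable_prob_bounded _ _ _ _ _ (`|p| * e1 + 2)).
    apply: measurable_funD => //; apply: measurable_funM => //; exact: measurable_indic.
  move=> t; rewrite ger0_norm; last by rewrite addr_ge0// mulr_ge0// ltW.
  by rewrite lerD2l ler_piMr// indicE lern1 leq_b1.
have i1 : P.-integrable setT (EFin \o (\1_A : T -> R)).
  apply: (@integrable_prob_bounded _ _ _ _ _ 1) => [|t]; first exact: measurable_indic.
  by rewrite indicE normr_nat lern1 leq_b1.
rewrite -RintegralB//; [|exact: ihZ|exact: ihZ].
apply: (@le_trans _ _ (\int[P]_t (`|p| * e1 + 2 * \1_A t))).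
  apply: normr_Rintegral_le => //; first by apply: measurable_funB; exact: mhZ.
  move=> t _; rewrite indicE; case: (boolP (t \in A)) => tA.
    have := ler_normB (h (p * Z t)) (h (p * Z_ n t)).
    have := h1 (p * Z t); have := h1 (p * Z_ n t).
    have : 0 <= `|p| * e1 by rewrite mulr_ge0// ltW.
    by rewrite mulr1; lra.
  rewrite mulr0 addr0 (le_trans (hl _ _))// -mulrBr normrM ler_wpM2l// distrC leNgt.
  by apply: contra tA => h0; rewrite inE.
rewrite RintegralD//; [|exact: finite_measure_integrable_cst|exact: integrable_mulZl].
rewrite Rintegral_prob_cst RintegralZl// prob_Rintegral_indic//.
have : `|p| * e1 <= e / 2.
  rewrite /e1 mulrCA ler_piMr ?divr_ge0 ?ltW// ltr_pdivrMr ?ltr_wpDl// mul1r ltrDl//.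
move: hn; rewrite /= ger0_norm; last by rewrite fine_ge0.
lra.
Qed.

End char_limit.

(** * Characteristic function of a stable stochastic integral *)

Section char_stochastic_integral.
Context (R : realType) (d : measure_display) (T : measurableType d).
Variables (P : probability T R) (delta rho : R) (M : set R -> T -> R).
Local Notation leb := (@lebesgue_measure R).
Hypothesis delta_gt0 : 0 < delta.
Hypothesis delta_le2 : delta <= 2.
Hypothesis srm : stable_random_measure P delta rho M.

Lemma measurable_spow : measurable_fun setT (spow delta).
Proof. by apply: continuous_measurable_fun; exact: continuous_sgr_powR. Qed.

Lemma measurable_normr_powR (D : set R) : measurable_fun D (fun x : R => `|x| `^ delta).
Proof.
by apply: measurable_funTS; apply: continuous_measurable_fun; exact: continuous_normr_powR.
Qed.

Lemma measurable_comp_normr_powR d' (U : measurableType d') (g : U -> R) :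
  measurable_fun setT g -> measurable_fun setT (fun x => `|g x| `^ delta).
Proof.
move=> mg; rewrite (_ : (fun x => _) = (fun x : R => `|x| `^ delta) \o g)//.
by apply: measurableT_comp => //; exact: measurable_normr_powR.
Qed.

Lemma measurable_sf_eval (s : seq (R * set R)) : simple_adm s ->
  measurable_fun setT (sf_eval s).
Proof.
elim: s => [|c s IH].
  by move=> _; rewrite (_ : sf_eval [::] = cst 0)//; apply/funext => x; rewrite /sf_eval big_nil.
move=> /simple_adm_cons[[mc lc] hs].
rewrite (_ : sf_eval (c :: s) = fun t => c.1 * \1_(c.2) t + sf_eval s t); last first.
  by apply/funext => x; rewrite sf_eval_cons.
apply: measurable_funD; last exact: IH.
by apply: measurable_funM => //; exact: measurable_indic.
Qed.

(** Each side of [char_simple] passes to the limit: the left by convergence in probability, as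
    cosine and sine are bounded and Lipschitz, the right by [powR_close], which turns L^delta
    approximation into convergence of both exponents. *)
Lemma char_stoch_int (f : R -> R) (Z : T -> R) : measurable_fun setT f ->
  stoch_int P M delta f Z ->
  [/\ leb.-integrable setT (EFin \o (fun x => `|f x| `^ delta)),
      leb.-integrable setT (EFin \o (fun x => spow delta (f x))) &
      forall p, 
      \int[P]_t cos (p * Z t) =
        expR (- (psiRe delta p * \int[leb]_x `|f x| `^ delta)) *
        cos (psiIm delta rho p * \int[leb]_x spow delta (f x)) /\
      \int[P]_t sin (p * Z t) =
        - (expR (- (psiRe delta p * \int[leb]_x `|f x| `^ delta)) *
        sin (psiIm delta rho p * \int[leb]_x spow delta (f x)))].
Proof.
move=> mf [mZ [s [adm [Lcvg Pcvg]]]].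
pose D n x := `|sf_eval (s n) x - f x| `^ delta.
have mD n : measurable_fun setT (D n).
  have msf : measurable_fun setT (fun x => sf_eval (s n) x - f x).
    by apply: measurable_funB => //; exact: measurable_sf_eval.
  exact: (measurable_comp_normr_powR msf).
have D0 n x : 0 <= D n x by exact: powR_ge0.
(* The distances are finite only eventually; a single such index already makes |f|^delta integrable,
   through [powR_close] with th = 1/2. *)
have /fine_cvgP[Dfin Dcvg] := Lcvg.
have iD n : (\int[leb]_x (D n x)%:E)%E \is a fin_num ->
    leb.-integrable setT (EFin \o D n).
  move=> h; apply/integrableP; split; first by apply/measurable_EFinP; exact: mD.
  under eq_integral do rewrite /= ger0_norm//.
  by rewrite -ge0_fin_numE//; apply: integral_ge0 => x _; rewrite lee_fin.
have half : 0 < (2^-1 : R) < 1 by lra.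
have csf n := char_simple delta_gt0 srm 1 (adm n).
have mpf : measurable_fun setT (fun x => `|f x| `^ delta).
  exact: (measurable_comp_normr_powR mf).
have msf : measurable_fun setT (fun x => spow delta (f x)).
  exact: (measurableT_comp measurable_spow mf).
have ipf : leb.-integrable setT (EFin \o (fun x => `|f x| `^ delta)).
  have [n0 _ hn0] := Dfin; have iDn := iD _ (hn0 n0 (leqnn _)).
  have [i1 _ _ _] := csf n0.
  apply: (@integrable_dominated _ _ _ leb _ _ (fun x =>
    3 * `|sf_eval (s n0) x| `^ delta + 2 * (1 + (2^-1)^-1) ^+ 2 * D n0 x)) => //.
    move=> x _; rewrite ger0_norm ?powR_ge0//.
    have [+ _] := powR_close delta_gt0 delta_le2 (f x) (sf_eval (s n0) x) half.
    rewrite (distrC (f x)) -/(D n0 x).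
    have := ler_norm (`|f x| `^ delta - `|sf_eval (s n0) x| `^ delta).
    by have := powR_ge0 `|sf_eval (s n0) x| delta; lra.
  by apply: integrable_add => //; exact: integrable_mulZl.
have spow_le x : `|spow delta x| <= `|x| `^ delta.
  rewrite /spow normrM normr_sg (ger0_norm (powR_ge0 _ _)) ler_piMl ?powR_ge0//.
  by rewrite lern1 leq_b1.
have isf : leb.-integrable setT (EFin \o (fun x => spow delta (f x))).
  by apply: (@integrable_dominated _ _ _ leb _ _ (fun x => `|f x| `^ delta)).
have Icvg (g : R -> R) : measurable_fun setT g ->
    (forall n, leb.-integrable setT (EFin \o (fun x => g (sf_eval (s n) x)))) ->
    leb.-integrable setT (EFin \o (fun x => g (f x))) ->
    (forall th a b, 0 < th < 1 -> `|g a - g b| <=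
      3 * th * `|b| `^ delta + 2 * (1 + th^-1) ^+ 2 * `|a - b| `^ delta) ->
    \int[leb]_x g (sf_eval (s n) x) @[n --> \oo] --> \int[leb]_x g (f x).
  move=> mg igs igf close; apply/cvgrPdist_le => e e0.
  set If := \int[leb]_x `|f x| `^ delta.
  have If0 : 0 <= If by apply: Rintegral_ge0 => x _; exact: powR_ge0.
  (* Makes the relative part 3 th times the integral of |f|^delta at most e/2; the other half goes
     to the L^delta distance, once [th] is fixed. *)
  pose th := Num.min (2^-1) (e / 2 / (3 * (If + 1))).
  have th0 : 0 < th by rewrite lt_min; apply/andP; split; rewrite ?divr_gt0// mulr_gt0// ltr_wpDl.
  have th1 : 0 < th < 1 by rewrite th0/= (@le_lt_trans _ _ 2^-1)// ?ge_min ?lexx//; lra.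
  have thI : 3 * th * If <= e / 2.
    apply: (@le_trans _ _ (3 * (e / 2 / (3 * (If + 1))) * (If + 1))).
      have tle : th <= e / 2 / (3 * (If + 1)) by rewrite ge_min lexx orbT.
      apply: ler_pM => //; first by rewrite mulr_ge0// ltW.
        by rewrite ler_wpM2l.
      by rewrite lerDl.
    rewrite le_eqVlt; apply/orP; left; apply/eqP; field.
    by rewrite gt_eqF// ltr_wpDl.
  pose Cth := 2 * (1 + th^-1) ^+ 2.
  have Cth0 : 0 < Cth by rewrite mulr_gt0// exprn_gt0// addr_gt0// invr_gt0.
  have e2 : 0 < e / 2 / Cth by rewrite !divr_gt0.
  have := Dcvg => /cvgrPdist_le /(_ _ e2); apply: filterS2 (Dfin) => n fn.
  rewrite /= sub0r normrN => hn; have iDn := iD _ fn.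
  rewrite distrC -RintegralB//.
  apply: (@le_trans _ _ (\int[leb]_x (3 * th * `|f x| `^ delta + Cth * D n x))).
    apply: normr_Rintegral_le => //.
    - apply: measurable_funB; apply: measurableT_comp => //; exact: measurable_sf_eval.
    - by move=> x _; exact: close.
    - by apply: integrable_add => //; exact: integrable_mulZl.
  rewrite RintegralD//; [|exact: integrable_mulZl..].
  rewrite !RintegralZl// -/If.
  have : Cth * \int[leb]_x D n x <= e / 2.
    by rewrite mulrC -ler_pdivlMr// (le_trans (ler_norm _)).
  by move=> hC; rewrite [leRHS](splitr e); apply: lerD thI hC.
split=> // p.
have c1 := Icvg _ (@measurable_normr_powR setT) (fun n => let: And4 i _ _ _ := csf n in i) ipf
  (fun th a b h => (powR_close delta_gt0 delta_le2 a b h).1).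
have c2 := Icvg _ measurable_spow (fun n => let: And4 _ i _ _ := csf n in i) isf
  (fun th a b h => (powR_close delta_gt0 delta_le2 a b h).2).
have mZn n : measurable_fun setT (sf_int M (s n)) by exact: (measurable_sf_int srm (adm n)).
split.
- have h1 : \int[P]_t cos (p * sf_int M (s n) t) @[n --> \oo] --> \int[P]_t cos (p * Z t).
    apply: char_cvg_prob => //; first exact: measurable_cosR.
      exact: normr_cos_le1.
    exact: lipschitz_cos.
  apply: (cvg_unique _ h1) => //=.
  have E n : \int[P]_t cos (p * sf_int M (s n) t) = _ :=
    let: And4 _ _ e _ := char_simple delta_gt0 srm p (adm n) in e.
  under eq_cvg do rewrite E.
  apply: cvgM.
    apply: (cvg_comp _ expR); last exact: continuous_expR.
    by apply: cvgN; apply: cvgMr.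
  apply: (cvg_comp _ cos); last exact: continuous_cos.
  by apply: cvgMr.
- have h1 : \int[P]_t sin (p * sf_int M (s n) t) @[n --> \oo] --> \int[P]_t sin (p * Z t).
    apply: char_cvg_prob => //; first exact: measurable_sinR.
      exact: normr_sin_le1.
    exact: lipschitz_sin.
  apply: (cvg_unique _ h1) => //=.
  have E n : \int[P]_t sin (p * sf_int M (s n) t) = _ :=
    let: And4 _ _ _ e := char_simple delta_gt0 srm p (adm n) in e.
  under eq_cvg do rewrite E.
  apply: cvgN; apply: cvgM.
    apply: (cvg_comp _ expR); last exact: continuous_expR.
    by apply: cvgN; apply: cvgMr.
  apply: (cvg_comp _ sin); last exact: continuous_sin.
  by apply: cvgMr.
Qed.

End char_stochastic_integral.

(** * The moving-average kernel: scaling and integrals *)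

Section power_integral.
Variable R : realType.
Local Notation leb := (@lebesgue_measure R).

Lemma integrable_reflect (f : R -> R) : leb.-integrable setT (EFin \o f) ->
  leb.-integrable setT (EFin \o (fun x => f (- x))).
Proof.
move=> iF; have n1 : (-1 : R) != 0 by rewrite oppr_eq0 oner_eq0.
rewrite (_ : (fun x => f (- x)) = (fun x => f (-1 * x + 0))); last first.
  by apply/funext => x; rewrite mulN1r addr0.
exact: (@integrable_affine R (-1) 0 f n1 iF).
Qed.

(** Cut off outside ]0, 1], in particular for y <= 0 where the real power returns default values. *)
Definition unit_powR (b y : R) : R := if 0 < y <= 1 then y `^ b else 0.

Lemma Rintegral_powR_itv (b c : R) : b != 0 -> 0 < c < 1 ->
  \int[leb]_(y in `[c, 1]) y `^ (b - 1) = (1 - c `^ b) / b.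
Proof.
move=> b0 /andP[c0 c1].
have dF (x : R) : 0 < x -> is_derive x 1 (fun y : R => b^-1 * y `^ b) (x `^ (b - 1)).
  move=> x0; have := is_derive_mull b^-1 (is_derive1_powR b x0).
  by rewrite mulrA mulVf// mul1r.
have cp (r x : R) : 0 < x -> {for x, continuous (fun y : R => y `^ r)}.
  move=> x0; have [dx _] := is_derive1_powR r x0.
  by apply: differentiable_continuous; exact/derivable1_diffP.
rewrite /Rintegral (@continuous_FTC2 _ _ (fun y => b^-1 * y `^ b))//=.
- by rewrite powR1; field.
- apply: continuous_in_subspaceT => x; rewrite inE/= in_itv/= => /andP[cx _].
  by apply: cp; exact: lt_le_trans cx.
- have cF (x : R) : 0 < x -> {for x, continuous (fun y : R => b^-1 * y `^ b)}.
    by move=> x0; apply: cvgMr; exact: cp.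
  split.
  + move=> x; rewrite in_itv/= => /andP[cx _].
    by have [] := dF x (lt_trans c0 cx).
  + by apply: cvg_at_right_filter; exact: cF.
  + by apply: cvg_at_left_filter; exact: cF.
- move=> x; rewrite in_itv/= => /andP[cx _]; rewrite derive1E.
  exact: (@derive_val _ _ _ _ _ _ _ (dF x (lt_trans c0 cx))).
Qed.

(** For b < 1 the integrand is singular at 0, so the antiderivative is used on [1/(n+2), 1], with
    dominated convergence afterwards. The shift by 2 keeps the left end below 1. *)
Lemma Rintegral_unit_powR (b : R) : 0 < b ->
  leb.-integrable setT (EFin \o unit_powR (b - 1)) ->
  \int[leb]_y unit_powR (b - 1) y = b^-1.
Proof.
move=> b0 iu; pose c n : R := n.+2%:R^-1.
have c01 n : 0 < c n < 1 by rewrite /c invr_gt0 ltr0n/= invf_lt1 ?ltr1n ?ltr0n.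
have c_cvg : c n @[n --> \oo] --> 0.
  rewrite (_ : c = (fun n => (n + 1).+1%:R^-1)); last by apply/funext => n; rewrite addn1.
  by have := @cvg_harmonic R; rewrite -(cvg_shiftn 1).
pose f n := unit_powR (b - 1) \_ `[c n, 1].
have f_cvg : \int[leb]_y f n y @[n --> \oo] --> \int[leb]_y unit_powR (b - 1) y.
  apply: (@Rintegral_dominated_cvg _ _ _ leb _ _ _ (unit_powR (b - 1))) => //.
  - move=> n; apply/(measurable_restrictT _ _).1 => //.
    apply: measurable_funTS; exact: integrable_measurable iu.
  - move=> x _; apply: cvg_near_cst; have [x0|x0] := ltP 0 x; last first.
      apply: nearW => n; rewrite /f patchE /unit_powR; case: ifPn => //.
      by rewrite ltNge x0.
    have := c_cvg => /cvgrPdist_lt /(_ _ x0); apply: filterS => n.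
    rewrite sub0r normrN gtr0_norm; last by case/andP: (c01 n).
    move=> cx; rewrite /f patchE mem_setE in_itv/= (ltW cx)/=; case: ifPn => // x1.
    by rewrite /unit_powR (negbTE x1) andbF.
  - move=> n x _; rewrite /f patchE; case: ifPn => _.
      by rewrite ger0_norm// /unit_powR; case: ifPn => // _; exact: powR_ge0.
    by rewrite normr0 /unit_powR; case: ifPn => // _; exact: powR_ge0.
have E n : \int[leb]_y f n y = (1 - c n `^ b) / b.
  rewrite -Rintegral_mkcond -Rintegral_powR_itv ?gt_eqF//.
  apply: eq_Rintegral => x; rewrite inE/= in_itv/= => /andP[cx x1].
  by rewrite /unit_powR x1 (lt_le_trans _ cx)//; case/andP: (c01 n).
suff L : (1 - c n `^ b) / b @[n --> \oo] --> b^-1.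
  by apply: (cvg_unique _ f_cvg) => //=; under eq_cvg do rewrite E; exact: L.
rewrite -[X in _ --> X]mul1r; apply: cvgMl; rewrite -[X in _ --> X]subr0.
apply: cvgB; first exact: cvg_cst.
have cn (n : nat) : c n `^ b = `|c n| `^ b.
  by rewrite gtr0_norm//; case/andP: (c01 n).
have b00 : 0 = `|0 : R| `^ b by rewrite normr0 powR0 ?gt_eqF.
under eq_cvg do rewrite cn.
have : (fun x : R => `|x| `^ b) (c n) @[n --> \oo] --> (fun x : R => `|x| `^ b) 0.
  by apply: (cvg_comp c (fun x : R => `|x| `^ b) c_cvg); exact: continuous_normr_powR.
by rewrite -b00.
Qed.

End power_integral.

Section lfsm_kernel.
Variable R : realType.
Local Notation leb := (@lebesgue_measure R).
Variables (delta H : R).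
Hypothesis delta_gt0 : 0 < delta.
Hypothesis H_gt0 : 0 < H.
Local Notation a := (H - delta^-1).
Local Notation f := (lfsm_kernel delta H).

Lemma measurable_pospow (r : R) : measurable_fun setT (fun x : R => pospow x r).
Proof.
apply: measurable_fun_ifT ; [|exact: measurable_powR|exact: measurable_cst].
exact: measurable_fun_ltr.
Qed.

Lemma measurable_lfsm_kernel (t : R) : measurable_fun setT (f t).
Proof.
apply: measurable_funB.
  apply: (measurableT_comp (measurable_pospow _)); exact: measurable_funB.
by apply: (measurableT_comp (measurable_pospow _)).
Qed.

Lemma pospowM (r c x : R) : 0 < c -> pospow (c * x) r = c `^ r * pospow x r.
Proof.
move=> c0; rewrite /pospow pmulr_rgt0//; case: ifPn => x0; last by rewrite mulr0.
by rewrite powRM ?ltW.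
Qed.

Lemma lfsm_kernel_scale (t x : R) : 0 < t ->
  f t x = t `^ a * f 1 (t^-1 * x + 0).
Proof.
move=> t0; rewrite /lfsm_kernel addr0 mulrBr -!pospowM//.
by rewrite mulrBr mulr1 mulrN mulVKf ?gt_eqF.
Qed.

Lemma lfsm_kernel0 (x : R) : f 0 x = 0.
Proof. by rewrite /lfsm_kernel sub0r subrr. Qed.

Section homogeneous_function.
Variable g : R -> R.
Hypothesis gM : forall c x, 0 <= c -> g (c * x) = c `^ delta * g x.
Hypothesis g1 : g 1 = 1.
Hypothesis ig : leb.-integrable setT (EFin \o (fun x => g (f 1 x))).

Lemma homogeneous_ge0 x : 0 <= x -> g x = x `^ delta.
Proof. by move=> x0; rewrite -[x in g x]mulr1 gM// g1 mulr1. Qed.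

(** [g] stands for |x|^delta or for its signed version. Self-similarity f_t(x) = t^(H - 1/delta)
    f_1(x/t) gives the factor t^(delta H - 1), and the substitution one more t. *)
Lemma Rintegral_lfsm_kernel_scale (t : R) : 0 < t ->
  \int[leb]_x g (f t x) = t `^ (delta * H) * \int[leb]_x g (f 1 x).
Proof.
move=> t0; rewrite -Rintegral_scaling//; apply: eq_Rintegral => x _.
rewrite lfsm_kernel_scale// gM ?powR_ge0// -powRrM; congr (_ `^ _ * _).
by field; rewrite gt_eqF.
Qed.

(** Split at 0. The negative half-line, reflected, gives the integral on the right. On [0, 1[ the
    kernel is (1-x)^(H - 1/delta) and beyond 1 it is 0, so this part is the integral of y^(delta H -
    1) over the unit interval. *)
Lemma Rintegral_lfsm_kernel1 : 
  \int[leb]_x g (f 1 x) =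
  \int[leb]_(x in `]0, +oo[) g ((1 + x) `^ a - x `^ a) + (delta * H)^-1.
Proof.
have igD (D : set R) : measurable D -> leb.-integrable D (EFin \o (fun x => g (f 1 x))).
  by move=> mD; apply: integrableS ig.
have igN : leb.-integrable setT (EFin \o (fun x => g (f 1 (- x)))).
  exact: (integrable_reflect ig).
have igND (D : set R) : measurable D -> leb.-integrable D (EFin \o (fun x => g (f 1 (- x)))).
  by move=> mD; apply: integrableS igN.
have g0 : g 0 = 0 by rewrite homogeneous_ge0// powR0 ?gt_eqF.
rewrite Rintegral_fold// RintegralD//; [|exact: igD|exact: igND].
rewrite addrC; congr (_ + _).
  rewrite -Rintegral_itv_obnd_cbnd; last exact: igND.
  apply: eq_Rintegral => x; rewrite inE/= in_itv/= andbT => x0.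
  by rewrite /lfsm_kernel /pospow !opprK addr_gt0// x0.
have dH : 0 < delta * H by rewrite mulr_gt0.
have uE : (fun x => g (f 1 x)) \_ `[0, +oo[ =
    (fun x => unit_powR (delta * H - 1) (-1 * x + 1)).
  apply/funext => x; rewrite patchE mem_setE in_itv/= andbT /unit_powR mulN1r addrC.
  rewrite subr_gt0 lerBlDr lerDl; have [x0|x0] := leP 0 x; last by rewrite andbF.
  rewrite andbT /lfsm_kernel /pospow oppr_gt0 (ltNge x 0) x0/= subr0 subr_gt0.
  case: ifPn => x1; last by rewrite g0.
  rewrite homogeneous_ge0 ?powR_ge0// -powRrM; congr (_ `^ _).
  by field; rewrite gt_eqF.
have iu' : leb.-integrable setT (EFin \o (fun x => unit_powR (delta * H - 1) (-1 * x + 1))).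
  rewrite -uE -restrict_EFin; apply/(integrable_mkcond _ _).1 => //; exact: igD.
have n1 : (-1 : R) != 0 by rewrite oppr_eq0 oner_eq0.
have iu : leb.-integrable setT (EFin \o unit_powR (delta * H - 1)).
  have := @integrable_affine R (-1) 1 _ n1 iu'.
  by congr (integrable _ _ (_ \o _)); apply/funext => x; congr unit_powR; ring.
rewrite Rintegral_mkcond uE -(Rintegral_unit_powR dH iu).
rewrite -[RHS](Rintegral_affine 1 n1) ?normrN1 ?mul1r//.
exact: integrable_measurable iu.
Qed.

End homogeneous_function.

End lfsm_kernel.

(** * Linear fractional stable motion: one-time laws and skewness *)

Section lfsm_characteristic_function.
Context (R : realType) (d : measure_display) (T : measurableType d).
Variables (P : probability T R) (delta rho H : R) (M : set R -> T -> R).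
Variable Y : R -> T -> R.
Local Notation leb := (@lebesgue_measure R).
Local Notation f := (lfsm_kernel delta H).
Local Notation K := (KdH delta H).
Hypothesis delta_gt0 : 0 < delta.
Hypothesis delta_le2 : delta <= 2.
Hypothesis H_gt0 : 0 < H.
Hypothesis srm : stable_random_measure P delta rho M.
Hypothesis lfsm : is_lfsm P M delta H Y.

Lemma spowM (c x : R) : 0 <= c -> spow delta (c * x) = c `^ delta * spow delta x.
Proof.
rewrite le_eqVlt => /predU1P[<-|c0]; first by rewrite mul0r spow0 powR0 ?gt_eqF// mul0r.
by rewrite /spow sgrM gtr0_sg// mul1r normrM powRM// (gtr0_norm c0) mulrCA.
Qed.

Lemma normr_powRM (c x : R) : 0 <= c -> `|c * x| `^ delta = c `^ delta * `|x| `^ delta.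
Proof. by move=> c0; rewrite normrM powRM// ger0_norm. Qed.

Lemma spow1 : spow delta 1 = 1. Proof. by rewrite /spow sgr1 normr1 powR1 mul1r. Qed.

Lemma spow_ge0 (x : R) : 0 <= x -> spow delta x = `|x| `^ delta.
Proof. by move=> x0; rewrite -{1}[x]mulr1 spowM// spow1 mulr1 ger0_norm. Qed.

Lemma spow_le0 (x : R) : x <= 0 -> spow delta x = - `|x| `^ delta.
Proof.
by move=> x0; rewrite -[in RHS]normrN -spow_ge0 ?oppr_ge0// /spow sgrN normrN mulNr opprK.
Qed.

(** Read off from the existence of the stochastic integral at t = 1, rather than from estimates on
    the kernel. *)
Lemma lfsm_kernel_integrable :
  leb.-integrable setT (EFin \o (fun x => `|f 1 x| `^ delta)) /\
  leb.-integrable setT (EFin \o (fun x => spow delta (f 1 x))).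
Proof.
have [] := char_stoch_int delta_gt0 delta_le2 srm (@measurable_lfsm_kernel R delta H 1) (lfsm ler01).
by [].
Qed.

Lemma KdH_base_gt0 : 0 < \int[leb]_(x in `]0, +oo[)
  `|(1 + x) `^ (H - delta^-1) - x `^ (H - delta^-1)| `^ delta + (delta * H)^-1.
Proof.
apply: ltr_wpDl; last by rewrite invr_gt0 mulr_gt0.
by apply: Rintegral_ge0 => x _; exact: powR_ge0.
Qed.

Lemma KdH_gt0 : 0 < K. Proof. by apply: powR_gt0; exact: KdH_base_gt0. Qed.

Lemma KdH_powRE : K `^ delta = \int[leb]_x `|f 1 x| `^ delta.
Proof.
rewrite (@Rintegral_lfsm_kernel1 _ _ _ delta_gt0 H_gt0 (fun x => `|x| `^ delta))//.
- by rewrite /KdH -powRrM mulVf ?gt_eqF// powRr1// ltW// KdH_base_gt0.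
- exact: normr_powRM.
- by rewrite normr1 powR1.
- by have [] := lfsm_kernel_integrable.
Qed.

(** Since K^delta is the integral of |f_1|^delta by [KdH_powRE], this is the factor by which
    integrating f_1 multiplies the skewness parameter. *)
Definition lfsm_skewness : R := (\int[leb]_x spow delta (f 1 x)) / K `^ delta.

Lemma lfsm_char (t p : R) : 0 < t ->
  \int[P]_w cos (p * Y t w) =
    expR (- (t `^ (delta * H) * psiRe delta p)) *
    cos (t `^ (delta * H) * psiIm delta (rho * lfsm_skewness) p) /\
  \int[P]_w sin (p * Y t w) =
    - (expR (- (t `^ (delta * H) * psiRe delta p)) *
    sin (t `^ (delta * H) * psiIm delta (rho * lfsm_skewness) p)).
Proof.
move=> t0; have [ip is_] := lfsm_kernel_integrable.
have [_ _ /(_ (p / K))] := char_stoch_int delta_gt0 delta_le2 srm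
  (@measurable_lfsm_kernel R delta H t) (lfsm (ltW t0)).
have K0 := KdH_gt0; have KV w : p / K * (K * Y t w) = p * Y t w.
  by rewrite mulrA divfK// gt_eqF.
under eq_Rintegral do rewrite KV.
under [in X in _ /\ X]eq_Rintegral do rewrite KV.
rewrite (@Rintegral_lfsm_kernel_scale _ _ _ delta_gt0 (fun x => `|x| `^ delta) normr_powRM ip _ t0).
rewrite (@Rintegral_lfsm_kernel_scale _ _ _ delta_gt0 (spow delta) spowM is_ _ t0).
rewrite -KdH_powRE.
have Kd0 : K `^ delta != 0 by apply: lt0r_neq0; exact: powR_gt0.
have KK : K^-1 `^ delta = (K `^ delta)^-1.
  apply: (mulfI Kd0); rewrite mulfV// -powRM ?invr_ge0 ?ltW// mulfV ?powR1//.
  exact: lt0r_neq0.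
have -> : psiRe delta (p / K) * (t `^ (delta * H) * K `^ delta) = t `^ (delta * H) * psiRe delta p.
  by rewrite psiReM// ger0_norm ?invr_ge0 ?ltW// KK; field.
suff -> : psiIm delta rho (p / K) * (t `^ (delta * H) * \int[leb]_x spow delta (f 1 x)) =
  t `^ (delta * H) * psiIm delta (rho * lfsm_skewness) p by [].
rewrite psiImM// spow_ge0 ?invr_ge0 ?ltW// ger0_norm ?invr_ge0 ?ltW// KK /lfsm_skewness /psiIm.
by ring.
Qed.

Lemma measurable_lfsm (t : R) : 0 <= t -> measurable_fun setT (Y t).
Proof.
move=> t0; have [mKY _] := lfsm t0.
rewrite (_ : Y t = (fun w => K^-1 * (K * Y t w))); last first.
  by apply/funext => w; rewrite mulKf// gt_eqF// KdH_gt0.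
by apply: measurable_funM.
Qed.

(** For nonzero z and n large, |z|/(n+1) lies in ]0, pi], where the cosine is injective and 1 is its
    value at 0 only. *)
Lemma cos_div_nat_eq1 (z : R) : (forall n : nat, cos (n.+1%:R^-1 * z) = 1) -> z = 0.
Proof.
move=> c1; apply/eqP; apply: contraT => z0; have z0' : 0 < `|z| by rewrite normr_gt0.
pose n := Num.truncn (`|z| / pi).
have zn : `|z| / pi < n.+1%:R by exact: truncnS_gt.
have y0 : 0 < n.+1%:R^-1 * `|z| by rewrite mulr_gt0// invr_gt0 ltr0n.
have ypi : n.+1%:R^-1 * `|z| <= pi.
  by rewrite mulrC ler_pdivrMr ?ltr0n// mulrC -ler_pdivrMr ?pi_gt0// ltW.
have : cos (n.+1%:R^-1 * `|z|) = cos 0.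
  rewrite cos0 -[RHS](c1 n); have [|] := ger0P z => // _.
  by rewrite mulrN cosN.
move=> /cos_inj; rewrite !in_itv/= lexx pi_ge0 (ltW y0) ypi => /(_ isT isT) e.
by rewrite e ltxx in y0.
Qed.

(** The kernel at t = 0 vanishes, so the characteristic function of K Y_0 is 1 and each nonnegative
    variable 1 - cos(K Y_0 / (n+1)) has mean 0. It is thus null almost surely, for all n at once. *)
Lemma lfsm_init : {ae P, forall w, Y 0 w = 0}.
Proof.
have [_ _ ch] := char_stoch_int delta_gt0 delta_le2 srm
  (@measurable_lfsm_kernel R delta H 0) (lfsm (lexx 0)).
have mY := measurable_lfsm (lexx 0).
have K0 := KdH_gt0.
pose g (n : nat) w : R := 1 - cos (n.+1%:R^-1 * (K * Y 0 w)).
have mc n : measurable_fun setT (fun w => cos (n.+1%:R^-1 * (K * Y 0 w))).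
  by apply: (measurableT_comp (@measurable_cosR R setT)); do 2 apply: measurable_funM => //.
have mg n : measurable_fun setT (g n) by apply: measurable_funB => //; exact: mc.
have g0 n w : 0 <= g n w.
  by rewrite /g subr_ge0 (le_trans (ler_norm _))// normr_cos_le1.
have ic n : P.-integrable setT (EFin \o (fun w => cos (n.+1%:R^-1 * (K * Y 0 w)))).
  by apply: (@integrable_prob_bounded _ _ _ _ _ 1) => // w; exact: normr_cos_le1.
have Ig n : \int[P]_w g n w = 0.
  rewrite RintegralB//; last exact: finite_measure_integrable_cst.
  rewrite Rintegral_prob_cst.
  have [-> _] := ch n.+1%:R^-1.
  under eq_Rintegral do rewrite lfsm_kernel0 normr0 powR0 ?gt_eqF//.
  under [X in cos (_ * X)]eq_Rintegral do rewrite lfsm_kernel0 spow0.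
  have -> : \int[leb]_(x in setT) (0 : R) = 0 by rewrite /Rintegral integral0.
  by rewrite !mulr0 oppr0 expR0 cos0 mulr1 subrr.
have ae n : {ae P, forall w, g n w = 0}.
  have : ae_eq P setT (EFin \o g n) (cst 0%E).
    apply/ae_eq_integral_abs => //; first by apply/measurable_EFinP; exact: mg.
    under eq_integral do rewrite /= ger0_norm//.
    rewrite -[LHS]fineK; first by rewrite -/(Rintegral P setT (g n)) Ig.
    rewrite integrable_fin_num//; apply: (@integrable_prob_bounded _ _ _ _ _ 2) => // w.
    by rewrite ger0_norm// /g; have := normr_cos_le1 (n.+1%:R^-1 * (K * Y 0 w)); rewrite ler_norml; lra.
  by apply: filterS => w /(_ I)[].
have := ae_foralln ae; apply: filterS => w h.
have /eqP : K * Y 0 w = 0.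
  by apply: cos_div_nat_eq1 => n; apply/esym/eqP; rewrite -subr_eq0; apply/eqP; exact: h.
by rewrite mulf_eq0 (gt_eqF K0)/= => /eqP.
Qed.

End lfsm_characteristic_function.

Section lfsm_skewness_rho0.
Context (R : realType) (d : measure_display) (T : measurableType d).
Variables (P : probability T R) (delta rho beta : R) (M : set R -> T -> R).
Variable Y : R -> T -> R.
Local Notation leb := (@lebesgue_measure R).
Hypothesis delta_gt0 : 0 < delta.
Hypothesis delta_le2 : delta <= 2.
Hypothesis beta_gt0 : 0 < beta.
Hypothesis srm : stable_random_measure P delta rho M.
Hypothesis lfsm : is_lfsm P M delta (beta / delta) Y.
Local Notation H := (beta / delta).
Local Notation f := (lfsm_kernel delta H).

Lemma lfsm_exponentE : H - delta^-1 = (beta - 1) / delta.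
Proof. by rewrite mulrBl mul1r. Qed.

(** For beta > 1 the exponent is positive and the kernel nonnegative: the ratio is 1. For beta < 1
    the kernel is nonpositive on the negative half-line, contributing -I, and positive on [0, 1[,
    contributing 1/beta, whereas K^delta is the sum 1/beta + I. *)
Lemma lfsm_skewnessE : beta != 1 -> rho * lfsm_skewness delta H = rho0 delta beta rho.
Proof.
have H0 : 0 < H by rewrite divr_gt0.
have [ip is_] := lfsm_kernel_integrable delta_gt0 delta_le2 srm lfsm.
have KE := KdH_powRE delta_gt0 delta_le2 H0 srm lfsm.
have Kp0 : 0 < KdH delta H `^ delta by apply: powR_gt0; exact: KdH_gt0.
have dH : delta * H = beta by rewrite mulrC divfK// gt_eqF.
rewrite /rho0 neq_lt => /orP[b1|b1]; last first.
  rewrite b1 /lfsm_skewness (_ : \int[leb]_x spow delta (f 1 x) = KdH delta H `^ delta).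
    by rewrite mulfV ?mulr1 ?gt_eqF.
  rewrite KE; apply: eq_Rintegral => x _; apply: spow_ge0 => //.
  have a0 : 0 <= H - delta^-1 by rewrite lfsm_exponentE divr_ge0 ?ltW// subr_gt0.
  rewrite /lfsm_kernel subr_ge0 /pospow subr_gt0 oppr_gt0.
  case: (ltP x 0) => x0; last by case: ifPn => // _; exact: powR_ge0.
  rewrite (lt_trans x0)//; apply: powR_le_base => //; first by rewrite oppr_ge0 ltW.
  by rewrite lerDr.
rewrite ltNge (ltW b1)/= /lfsm_skewness; congr (_ * _).
have an0 : H - delta^-1 <= 0 by rewrite lfsm_exponentE; apply: mulr_le0_ge0; rewrite ?invr_ge0 ?subr_le0 ltW.
have le (x : R) : 0 < x -> (1 + x) `^ (H - delta^-1) <= x `^ (H - delta^-1).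
  move=> x0; rewrite /powR !gt_eqF ?addr_gt0// ler_expR; apply: ler_wnM2l => //.
  by rewrite ler_ln ?posrE ?addr_gt0// lerDr.
have IE : \int[leb]_(x in `]0, +oo[) `|(1 + x) `^ (H - delta^-1) - x `^ (H - delta^-1)| `^ delta =
    \int[leb]_(x in `]0, +oo[)
      (x `^ ((beta - 1) / delta) - (1 + x) `^ ((beta - 1) / delta)) `^ delta.
  apply: eq_Rintegral => x; rewrite inE/= in_itv/= andbT => x0.
  by rewrite ler0_norm ?subr_le0 ?le// opprB lfsm_exponentE.
rewrite KE.
have n1 : `|1 : R| `^ delta = 1 by rewrite normr1 powR1.
rewrite (Rintegral_lfsm_kernel1 delta_gt0 H0 (@spowM _ _ delta_gt0) (@spow1 _ _) is_).
rewrite (Rintegral_lfsm_kernel1 (g := fun x => `|x| `^ delta) delta_gt0 H0 (@normr_powRM _ _) n1 ip).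
have -> : \int[leb]_(x in `]0, +oo[) spow delta ((1 + x) `^ (H - delta^-1) - x `^ (H - delta^-1))
    = - \int[leb]_(x in `]0, +oo[) `|(1 + x) `^ (H - delta^-1) - x `^ (H - delta^-1)| `^ delta.
  rewrite -[RHS]mulN1r -RintegralZl//.
    apply: eq_Rintegral => x; rewrite inE/= in_itv/= andbT => x0.
    by rewrite mulN1r spow_le0// subr_le0 le.
  have ipN : leb.-integrable setT (EFin \o (fun x => `|f 1 (- x)| `^ delta)).
    exact: (integrable_reflect ip).
  have ipD : leb.-integrable `]0, +oo[ (EFin \o (fun x => `|f 1 (- x)| `^ delta)).
    by apply: integrableS ipN.
  apply: eq_integrable ipD => // x; rewrite inE/= in_itv/= andbT => x0.
  by rewrite /lfsm_kernel /pospow !opprK addr_gt0// x0.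
by rewrite IE dH !(addrC _ beta^-1).
Qed.

End lfsm_skewness_rho0.

(** * Taylor remainders of the complex exponential *)

Lemma Rintegral_sum_nat (R : realType) (d : measure_display) (T : measurableType d)
    (mu : measure T R) (F : nat -> T -> R) (N : nat) :
  (forall n, (n < N)%N -> mu.-integrable setT (EFin \o F n)) ->
  mu.-integrable setT (EFin \o (fun t => \sum_(n < N) F n t)) /\
  \int[mu]_t (\sum_(n < N) F n t) = \sum_(n < N) \int[mu]_t F n t.
Proof.
elim: N => [_|N IH iF].
  rewrite big_ord0 (_ : (fun t => _) = cst 0); last by apply/funext => t; rewrite big_ord0.
  by split; [exact: integrable0|rewrite /Rintegral integral0].
have [i1 e1] := IH (fun n nN => iF n (ltnW nN)); have iN := iF N (ltnSn N).
rewrite big_ord_recr/= -e1.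
rewrite (_ : (fun t => _) = (fun t => (\sum_(n < N) F n t) + F N t)); last first.
  by apply/funext => t; rewrite big_ord_recr.
by split; [exact: integrable_add|rewrite RintegralD].
Qed.

Section exponential_taylor.
Variable R : realType.

Lemma normr_le_derive (f f' g g' : R -> R) :
  (forall x : R, is_derive x 1 f (f' x)) -> (forall x : R, is_derive x 1 g (g' x)) ->
  (forall x, 0 <= x -> `|f' x| <= g' x) -> f 0 = 0 -> g 0 = 0 ->
  forall x, 0 <= x -> `|f x| <= g x.
Proof.
move=> df dg fg f0 g0 x; rewrite le_eqVlt => /predU1P[<-|x0].
  by rewrite f0 g0 normr0.
have ge0 (h h' : R -> R) : (forall x : R, is_derive x 1 h (h' x)) -> h 0 = 0 ->
    (forall x, 0 <= x -> 0 <= h' x) -> 0 <= h x.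
  move=> dh h0 h'0; have [|z zx e] := @MVT _ h h' 0 x x0 (fun z _ => dh z).
    by apply: continuous_subspaceT; exact: (is_derive_continuous dh).
  move: zx; rewrite in_itv/= => /andP[z0 _].
  move: e; rewrite h0 !subr0 => ->; apply: mulr_ge0; last exact: ltW.
  by apply: h'0; exact: ltW.
have p1 := ge0 _ _ (fun y => is_derive_sub (dg y) (df y)).
have p2 := ge0 _ _ (fun y => is_derive_add (dg y) (df y)).
rewrite ler_norml; apply/andP; split.
  rewrite lerNl -subr_ge0 opprK; apply: p2 => [|y y0]; first by rewrite f0 g0 addr0.
  by have := fg y y0; rewrite ler_norml; lra.
rewrite -subr_ge0; apply: p1 => [|y y0]; first by rewrite f0 g0 subr0.
by have := fg y y0; rewrite ler_norml; lra.
Qed.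

Variables (zr zi : R).
Hypothesis zr_ge0 : 0 <= zr.

(** With [exp_poly_im], the Taylor polynomial with N terms, in a, of exp(-a (zr + i zi)). *)
Definition exp_poly_re (N : nat) (a : R) : R :=
  \sum_(n < N) a ^+ n / n`!%:R * (cpow (- zr) (- zi) n).1.
Definition exp_poly_im (N : nat) (a : R) : R :=
  \sum_(n < N) a ^+ n / n`!%:R * (cpow (- zr) (- zi) n).2.

Lemma is_derive_expn_fact (n : nat) (x : R) :
  is_derive x 1 (fun a : R => a ^+ n.+1 / n.+1`!%:R) (x ^+ n / n`!%:R).
Proof.
have h := @is_deriveX _ _ (id : R -> R) n.+1 x 1 1 (is_derive_id _ _).
have := is_derive_mull (n.+1`!%:R^-1) h.
have -> : (fun y : R => n.+1`!%:R^-1 * (id ^+ n.+1) y) = (fun a : R => a ^+ n.+1 / n.+1`!%:R).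
  by apply/funext => y; rewrite mulrC exprfctE.
move=> h'; have /is_derive_eq := h'; apply; rewrite factS natrM.
rewrite /= /GRing.scale/= mulr1; field.
by rewrite nat1r !pnatr_eq0 -lt0n fact_gt0.
Qed.

Lemma exp_poly_derive (N : nat) (x : R) :
  is_derive x 1 (exp_poly_re N.+1) (- zr * exp_poly_re N x + zi * exp_poly_im N x) /\
  is_derive x 1 (exp_poly_im N.+1) (- zr * exp_poly_im N x - zi * exp_poly_re N x).
Proof.
elim: N => [|N [IHr IHi]].
  rewrite /exp_poly_re /exp_poly_im !big_ord0 !mulr0 subrr addr0; split.
  - rewrite (_ : (fun a => _) = cst 1); first exact: is_derive_cst.
    by apply/funext => a; rewrite big_ord1/= expr0 fact0 divr1 mulr1.
  - rewrite (_ : (fun a => _) = cst 0); first exact: is_derive_cst.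
    by apply/funext => a; rewrite big_ord1/= mulr0.
have rE : exp_poly_re N.+2 = (fun a => exp_poly_re N.+1 a +
    (cpow (- zr) (- zi) N.+1).1 * (a ^+ N.+1 / N.+1`!%:R)).
  by apply/funext => a; rewrite /exp_poly_re big_ord_recr/= (mulrC _ (_ / _)).
have iE : exp_poly_im N.+2 = (fun a => exp_poly_im N.+1 a +
    (cpow (- zr) (- zi) N.+1).2 * (a ^+ N.+1 / N.+1`!%:R)).
  by apply/funext => a; rewrite /exp_poly_im big_ord_recr/= (mulrC _ (_ / _)).
have d1 := is_derive_add IHr (is_derive_mull (cpow (- zr) (- zi) N.+1).1 (is_derive_expn_fact N x)).
have d2 := is_derive_add IHi (is_derive_mull (cpow (- zr) (- zi) N.+1).2 (is_derive_expn_fact N x)).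
rewrite rE iE; split.
- have /is_derive_eq := d1; apply.
  by rewrite /exp_poly_re /exp_poly_im !big_ord_recr/=; ring.
- have /is_derive_eq := d2; apply.
  by rewrite /exp_poly_re /exp_poly_im !big_ord_recr/=; ring.
Qed.

Definition exp_rem_re (N : nat) (a : R) : R :=
  expR (- zr * a) * cos (zi * a) - exp_poly_re N a.
Definition exp_rem_im (N : nat) (a : R) : R :=
  - (expR (- zr * a) * sin (zi * a)) - exp_poly_im N a.

Lemma exp_rem_derive (N : nat) (x : R) :
  is_derive x 1 (exp_rem_re N.+1) (- zr * exp_rem_re N x + zi * exp_rem_im N x) /\
  is_derive x 1 (exp_rem_im N.+1) (- zr * exp_rem_im N x - zi * exp_rem_re N x).
Proof.
have [dr di] := exp_poly_derive N x.
have de := is_derive_expRM (- zr) x.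
have dc := is_derive_mul de (is_derive_cosM zi x).
have ds := is_derive_mul de (is_derive_sinM zi x).
split.
- have /is_derive_eq := is_derive_sub dc dr; apply.
  by rewrite /exp_rem_re /exp_rem_im; ring.
- have ds' := is_derive_mull (-1) ds.
  have -> : exp_rem_im N.+1 = (fun a => -1 * (expR (- zr * a) * sin (zi * a)) - exp_poly_im N.+1 a).
    by apply/funext => a; rewrite mulN1r.
  have /is_derive_eq := is_derive_sub ds' di; apply.
  by rewrite /exp_rem_re /exp_rem_im; ring.
Qed.

Lemma exp_rem0 (N : nat) : exp_rem_re N.+1 0 = 0 /\ exp_rem_im N.+1 0 = 0.
Proof.
rewrite /exp_rem_re /exp_rem_im /exp_poly_re /exp_poly_im !big_ord_recl/=.
rewrite !mulr0 expR0 cos0 sin0 fact0 expr0 !mulr1 divr1 !big1 ?addr0 ?subrr//.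
- by rewrite mulr0 oppr0 addr0.
- by move=> i _; rewrite /= /bump/= expr0n/= !mul0r.
- by move=> i _; rewrite /= /bump/= expr0n/= !mul0r.
Qed.

(** The remainders satisfy r_(N+1)' = -(zr + i zi) r_N and r_(N+1)(0) = 0, so the bound integrates
    by induction. The base case is |exp(-a (zr + i zi))| <= 1, from zr >= 0. *)
Lemma exp_rem_bound (N : nat) (a : R) : 0 <= a ->
  `|exp_rem_re N a| <= (zr + `|zi|) ^+ N * (a ^+ N / N`!%:R) /\
  `|exp_rem_im N a| <= (zr + `|zi|) ^+ N * (a ^+ N / N`!%:R).
Proof.
elim: N a => [|N IH] a a0.
  rewrite /exp_rem_re /exp_rem_im /exp_poly_re /exp_poly_im !big_ord0 !expr0 fact0 divr1 !subr0 mul1r.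
  have e1 : `|expR (- zr * a)| <= 1.
    by rewrite ger0_norm ?expR_ge0// -expR0 ler_expR mulNr oppr_le0 mulr_ge0.
  rewrite normrN !normrM; split; rewrite -[leRHS]mulr1; apply: ler_pM => //.
    exact: normr_cos_le1.
  exact: normr_sin_le1.
have C0 : 0 <= zr + `|zi| by rewrite addr_ge0.
have dg (x : R) : is_derive x 1 (fun a : R => (zr + `|zi|) ^+ N.+1 * (a ^+ N.+1 / N.+1`!%:R))
   ((zr + `|zi|) ^+ N.+1 * (x ^+ N / N`!%:R)).
  by apply: is_derive_mull; exact: is_derive_expn_fact.
have g0 : (zr + `|zi|) ^+ N.+1 * ((0 : R) ^+ N.+1 / N.+1`!%:R) = 0 by rewrite expr0n/= mul0r mulr0.
have [r0 i0] := exp_rem0 N.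
split.
- apply: (normr_le_derive (fun x => (exp_rem_derive N x).1) dg) => // x x0.
  have [b1 b2] := IH x x0.
  apply: (le_trans (ler_normD _ _)); rewrite !normrM normrN (ger0_norm zr_ge0).
  rewrite exprS -mulrA mulrDl; apply: lerD; exact: ler_wpM2l.
- apply: (normr_le_derive (fun x => (exp_rem_derive N x).2) dg) => // x x0.
  have [b1 b2] := IH x x0.
  apply: (le_trans (ler_normB _ _)); rewrite !normrM normrN (ger0_norm zr_ge0).
  rewrite exprS -mulrA mulrDl; apply: lerD; exact: ler_wpM2l.
Qed.

End exponential_taylor.

(** * Moments from a Laplace transform with entire power series *)

Section laplace_moments.
Context (R : realType) (d : measure_display) (T : measurableType d).
Variables (P : probability T R) (A : T -> R) (c : nat -> R).
Hypothesis mA : measurable_fun setT A.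
Hypothesis A_ge0 : forall t, 0 <= A t.
Hypothesis c_sum : forall r, 0 <= r ->
  exists S, forall N, \sum_(n < N) `|c n| * r ^+ n <= S.
Hypothesis laplace : forall x, 0 < x ->
  \sum_(n < N) c n * (- x) ^+ n @[N --> \oo] --> \int[P]_t expR (- (x * A t)).

Local Notation x_ := (fun m : nat => m.+1%:R^-1 : R).

(** For x <= 1 the tail of the series is at most x^N times the absolute sum of the coefficients, so
    one [S] serves all x. *)
Lemma laplace_tail (N : nat) : exists S, forall x, 0 < x <= 1 ->
  `|\int[P]_t expR (- (x * A t)) - \sum_(n < N) c n * (- x) ^+ n| <= S * x ^+ N.
Proof.
have [S hS] := c_sum ler01; exists S => x /andP[x0 x1].
have cvgL := laplace x0.
have h : `|\sum_(n < M + N) c n * (- x) ^+ n - \sum_(n < N) c n * (- x) ^+ n|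
    @[M --> \oo] --> `|\int[P]_t expR (- (x * A t)) - \sum_(n < N) c n * (- x) ^+ n|.
  apply: cvg_norm; apply: cvgB; last exact: cvg_cst.
  by have := cvgL; rewrite -(cvg_shiftn N).
apply: (ler_cvg_to h (cvg_cst (S * x ^+ N))); apply: nearW => M.
have -> : \sum_(n < M + N) c n * (- x) ^+ n - \sum_(n < N) c n * (- x) ^+ n =
    \sum_(N <= n < M + N) c n * (- x) ^+ n.
  rewrite -!(big_mkord xpredT (fun n => c n * (- x) ^+ n)).
  by rewrite (@big_cat_nat _ _ _ N 0 (M + N))//= ?leq_addl// [LHS]addrC addKr.
apply: (le_trans (ler_norm_sum _ _ _)).
apply: (@le_trans _ _ (\sum_(N <= n < M + N) `|c n| * x ^+ N)).
  rewrite big_nat [leRHS]big_nat; apply: ler_sum => n /andP[Nn _].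
  rewrite normrM normrX normrN (gtr0_norm x0) ler_wpM2l//.
  by rewrite ler_wiXn2l// ltW.
rewrite -mulr_suml; apply: ler_wpM2r; first by rewrite exprn_ge0// ltW.
apply: le_trans (hS (M + N)%N); rewrite -(big_mkord xpredT (fun n => `|c n| * 1 ^+ n)).
rewrite [leRHS](@big_cat_nat _ _ _ N 0 (M + N))//= ?leq_addl//.
rewrite [X in _ <= _ + X](eq_bigr (fun n => `|c n|)) => [|i _]; last by rewrite expr1n mulr1.
by rewrite lerDr; apply: sumr_ge0 => i _; rewrite expr1n mulr1.
Qed.

Definition exp_rem (N : nat) (y : R) : R :=
  (-1) ^+ N * (expR (- y) - \sum_(n < N) (- y) ^+ n / n`!%:R).

Lemma exp_remE (N : nat) (y : R) : exp_rem N y = (-1) ^+ N * exp_rem_re 1 0 N y.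
Proof.
rewrite /exp_rem /exp_rem_re mulN1r mul0r cos0 mulr1 /exp_poly_re; congr (_ * (_ - _)).
apply: eq_bigr => n _; rewrite (_ : (cpow (-1) (- 0) n).1 = (-1) ^+ n).
  by rewrite [in LHS]exprNn -mulrA mulrC.
elim: {1 2}(n : nat) => [//|k IH] /=; by rewrite IH oppr0 mul0r subr0 exprS.
Qed.

Lemma exp_remS (N : nat) (y : R) : exp_rem N.+1 y = y ^+ N / N`!%:R - exp_rem N y.
Proof.
rewrite /exp_rem big_ord_recr/= exprS [(- y) ^+ N]exprNn.
have : ((-1) ^+ N * (-1) ^+ N : R) = 1 by rewrite -expr2 sqrr_sign.
by move=> s; rewrite [X in _ = X - _](_ : _ = ((-1) ^+ N * (-1) ^+ N) * (y ^+ N / N`!%:R)); [ring|rewrite s mul1r].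
Qed.

(** With the sign (-1)^N, consecutive remainders add up to y^N / N!. The upper bound at order N is
    therefore nonnegativity at order N + 1. *)
Lemma exp_rem_itv (N : nat) (y : R) : 0 <= y -> 0 <= exp_rem N y <= y ^+ N / N`!%:R.
Proof.
move=> y0; have up M : `|exp_rem M y| <= y ^+ M / M`!%:R.
  rewrite exp_remE normrM normrX normrN1 expr1n mul1r.
  have [+ _] := exp_rem_bound 0 ler01 M y0.
  by rewrite normr0 addr0 expr1n mul1r.
rewrite (le_trans (ler_norm _) (up N)) andbT.
case: N => [|N].
  by rewrite /exp_rem big_ord0 subr0 mul1r expR_ge0.
by rewrite exp_remS subr_ge0 (le_trans (ler_norm _) (up N)).
Qed.

(** Squeezed by [exp_rem_itv] at orders N and N + 1, whose bounds differ by x y^(N+1) / (N+1)! after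
    division by x^N. *)
Lemma exp_rem_scaled_cvg (N : nat) (y : R) : 0 <= y ->
  exp_rem N (x_ m * y) / x_ m ^+ N @[m --> \oo] --> y ^+ N / N`!%:R.
Proof.
move=> y0; have x0 m : 0 < x_ m by rewrite invr_gt0 ltr0n.
apply: (@squeeze_cvgr _ _ _ _ (fun m => y ^+ N / N`!%:R - x_ m * (y ^+ N.+1 / N.+1`!%:R))
   (cst (y ^+ N / N`!%:R))).
- apply: nearW => m /=; have xy : 0 <= x_ m * y by rewrite mulr_ge0// ltW.
  have xN : 0 < x_ m ^+ N by exact: exprn_gt0.
  have /andP[_ h1] := exp_rem_itv N xy; have /andP[_ h2] := exp_rem_itv N.+1 xy.
  rewrite ler_pdivlMr// ler_pdivrMr//; apply/andP; split.
    move: h2; rewrite exp_remS !exprMn exprS => h2.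
    rewrite mulrBl; move: h2; set u := _ / _ - _; set v := _ / _.
    have -> : v = x_ m * (y ^+ N.+1 / N.+1`!%:R) * x_ m ^+ N by rewrite /v; ring.
    rewrite /u; have -> : x_ m ^+ N * y ^+ N / N`!%:R = y ^+ N / N`!%:R * x_ m ^+ N by ring.
    by move=> h2; rewrite lerBlDr addrC -lerBlDr.
  by rewrite (le_trans h1)// exprMn -mulrA mulrC.
- rewrite -[X in _ --> X]subr0; apply: cvgB; first exact: cvg_cst.
  rewrite -[X in _ --> X](mul0r (y ^+ N.+1 / N.+1`!%:R)); apply: cvgMl.
  exact: cvg_harmonic.
- exact: cvg_cst.
Qed.

Lemma measurable_exp_rem (N : nat) : measurable_fun setT (exp_rem N).
Proof.
apply: measurable_funM => //; apply: measurable_funB.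
  by apply: measurableT_comp.
apply: measurable_sum => n; apply: measurable_funM => //.
by apply: measurable_funX.
Qed.

(** Strong induction: the lower moments make the mean of the Taylor polynomial computable, so E f_m
    is the signed tail of the series at x_m divided by x_m^N, which tends to c_N. Since f_m tends to
    A^N / N! from below, Fatou gives integrability. *)
Lemma laplace_moment (N : nat) :
  P.-integrable setT (EFin \o (fun t => A t ^+ N)) /\
  \int[P]_t A t ^+ N = N`!%:R * c N.
Proof.
elim/ltn_ind: N => N IH.
have x0 m : 0 < x_ m by rewrite invr_gt0 ltr0n.
pose f m t := exp_rem N (x_ m * A t) / x_ m ^+ N.
have f0 m t : 0 <= f m t.
  apply: divr_ge0; last by rewrite exprn_ge0// ltW.
  by have /andP[] := exp_rem_itv N (mulr_ge0 (ltW (x0 m)) (A_ge0 t)).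
have mf m : measurable_fun setT (f m).
  apply: measurable_funM => //; apply: (measurableT_comp (@measurable_exp_rem N)).
  exact: measurable_funM.
have mAN n : measurable_fun setT (fun t => A t ^+ n) by exact: measurable_funX.
have ie m : P.-integrable setT (EFin \o (fun t => expR (- (x_ m * A t)))).
  apply: (@integrable_prob_bounded _ _ _ _ _ 1) => [|t].
    apply: (measurableT_comp (@measurable_expR R)); apply: measurableT_comp => //.
    exact: measurable_funM.
  rewrite ger0_norm ?expR_ge0// -expR0 ler_expR oppr_le0.
  by apply: mulr_ge0 => //; exact: ltW.
have [isum Esum] : (forall m, P.-integrable setT (EFin \o (fun t =>
      \sum_(n < N) (- x_ m) ^+ n / n`!%:R * A t ^+ n))) /\
    forall m, \int[P]_t (\sum_(n < N) (- x_ m) ^+ n / n`!%:R * A t ^+ n) =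
      \sum_(n < N) c n * (- x_ m) ^+ n.
  have i1 m n : (n < N)%N -> P.-integrable setT
      (EFin \o (fun t => (- x_ m) ^+ n / n`!%:R * A t ^+ n)).
    by move=> nN; apply: integrable_mulZl => //; have [] := IH n nN.
  split=> m; have [h1 h2] := Rintegral_sum_nat (i1 m); first exact: h1.
  rewrite h2; apply: eq_bigr => n _; have [i2 e2] := IH n (ltn_ord n).
  rewrite RintegralZl// e2; field.
  by rewrite pnatr_eq0 -lt0n fact_gt0.
have fE m t : f m t = (-1) ^+ N / x_ m ^+ N *
    (expR (- (x_ m * A t)) - \sum_(n < N) (- x_ m) ^+ n / n`!%:R * A t ^+ n).
  rewrite /f /exp_rem mulrAC; congr (_ * (_ - _)); apply: eq_bigr => n _.
  by rewrite -mulNr exprMn mulrAC.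
have iF m : P.-integrable setT (EFin \o f m).
  rewrite (funext (fE m)).
  by apply: integrable_mulZl => //; apply: integrable_sub.
have If m : \int[P]_t f m t = (-1) ^+ N / x_ m ^+ N *
    (\int[P]_t expR (- (x_ m * A t)) - \sum_(n < N) c n * (- x_ m) ^+ n).
  under eq_Rintegral do rewrite fE.
  rewrite RintegralZl//; last exact: integrable_sub.
  by rewrite RintegralB// Esum.
have Icvg : \int[P]_t f m t @[m --> \oo] --> c N.
  (* One order beyond N: after division by x^N the error is still of size x. *)
  have [S hS] := laplace_tail N.+1.
  apply/cvgrPdist_le => e e0.
  have : S * x_ m @[m --> \oo] --> S * 0 by apply: cvgMr; exact: cvg_harmonic.
  rewrite mulr0 => /cvgrPdist_le /(_ _ e0); apply: filterS => m.
  rewrite sub0r normrN => hm; apply: le_trans (le_trans (ler_norm _) hm).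
  have xN : 0 < x_ m ^+ N by exact: exprn_gt0.
  have x1 : 0 < x_ m <= 1 by rewrite x0 invf_le1 ?ltr0n// ler1n.
  have := hS _ x1; rewrite big_ord_recr/= opprD addrA exprS mulrA.
  rewrite -ler_pdivrMr//; apply: le_trans.
  rewrite -[X in _ <= _ / X](gtr0_norm xN) -normf_div If distrC.
  set L := \int[P]_t expR _ - \sum_(n < N) _.
  have -> : (-1) ^+ N / x_ m ^+ N * L - c N =
      (-1) ^+ N * ((L - c N * (- x_ m) ^+ N) / x_ m ^+ N).
    have s : ((-1) ^+ N * (-1) ^+ N : R) = 1 by rewrite -expr2 sqrr_sign.
    have xN0 := lt0r_neq0 xN; rewrite (exprNn m.+1%:R^-1 N).
    move: s xN0; move: ((-1) ^+ N : R) (m.+1%:R^-1 ^+ N : R) => s X ss X0.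
    by rewrite -[X in _ - X]mulr1 -ss; field.
  by rewrite normrM normrX normrN1 expr1n mul1r.
have fcvg t : f m t @[m --> \oo] --> A t ^+ N / N`!%:R by exact: exp_rem_scaled_cvg.
have N0 : (N`!%:R : R) != 0 by rewrite pnatr_eq0 -lt0n fact_gt0.
have iA : P.-integrable setT (EFin \o (fun t => A t ^+ N / N`!%:R)).
  apply/integrableP; split; first by apply/measurable_EFinP; exact: measurable_funM.
  apply: (@le_lt_trans _ _ (c N)%:E); last exact: ltry.
  have := @fatou _ _ _ P setT measurableT (fun m t => (f m t)%:E)
    (fun m => (measurable_EFinP _ _).2 (mf m)) (fun m t _ => f0 m t).
  have -> : limn_einf (fun m => \int[P]_t (f m t)%:E)%E = (c N)%:E.
    apply: (cvg_limn_einf_sup _).1.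
    rewrite (_ : (fun m => _) = (fun m => (\int[P]_t f m t)%:E)).
      by apply/cvg_EFin; [exact: nearW|exact: Icvg].
    by apply/funext => m; rewrite /Rintegral fineK//; exact: integrable_fin_num (iF m).
  apply: le_trans; rewrite le_eqVlt; apply/orP; left; apply/eqP.
  apply: eq_integral => t _ /=; rewrite ger0_norm; last by rewrite divr_ge0 ?exprn_ge0.
  apply/esym; apply: (cvg_limn_einf_sup _).1.
  by apply/cvg_EFin; [exact: nearW|exact: fcvg].
have AE : (fun t => A t ^+ N) = (fun t => N`!%:R * (A t ^+ N / N`!%:R)).
  by apply/funext => t; rewrite mulrCA mulfV// mulr1.
split; first by rewrite AE; exact: integrable_mulZl.
rewrite AE RintegralZl//; congr (_ * _).
(* The limit itself dominates every f_m, so its integrability upgrades the Fatou inequality to an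
   equality. *)
have : \int[P]_t f m t @[m --> \oo] --> \int[P]_t (A t ^+ N / N`!%:R).
  apply: (@Rintegral_dominated_cvg _ _ _ P _ _ _ (fun t => A t ^+ N / N`!%:R)) => //.
  move=> m t _; rewrite ger0_norm// /f ler_pdivrMr ?exprn_gt0//.
  have /andP[_ h] := exp_rem_itv N (mulr_ge0 (ltW (x0 m)) (A_ge0 t)).
  by rewrite (le_trans h)// exprMn -mulrA mulrC.
by move=> h; exact: (cvg_unique _ h Icvg).
Qed.

(** Averaging [exp_rem_bound] at a = A, the error after N terms is at most C^N E A^N / N! = c_N
    C^N. *)
Lemma laplace_complex (zr zi : R) : 0 <= zr ->
  \sum_(n < N) c n * (cpow (- zr) (- zi) n).1 @[N --> \oo] -->
    \int[P]_t (expR (- zr * A t) * cos (zi * A t)) /\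
  \sum_(n < N) c n * (cpow (- zr) (- zi) n).2 @[N --> \oo] -->
    \int[P]_t (- (expR (- zr * A t) * sin (zi * A t))).
Proof.
move=> zr0; set C := zr + `|zi|.
have C0 : 0 <= C by rewrite addr_ge0.
(* Summability at radius 2C gives |c_N| C^N <= S 2^-N. *)
have cC : c N * C ^+ N @[N --> \oo] --> 0.
  have [S hS] := c_sum (mulr_ge0 (ler0n R 2) C0).
  apply: norm_cvg0; apply: (@squeeze_cvgr _ _ _ _ (cst 0) (fun N => S * 2^-1 ^+ N)).
  - apply: nearW => N; rewrite normr_ge0/= normrM normrX (ger0_norm C0).
    rewrite exprVn ler_pdivlMr ?exprn_gt0// -mulrA -exprMn (mulrC C).
    apply: le_trans (hS N.+1); rewrite big_ord_recr/= lerDr.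
    by apply: sumr_ge0 => i _; rewrite mulr_ge0// exprn_ge0// mulr_ge0.
  - exact: cvg_cst.
  - rewrite -(mulr0 S); apply: cvgMr; apply: cvg_expr.
    by rewrite ger0_norm// invf_lt1// ltr1n.
have main (g : R -> R) (q : nat -> R) : measurable_fun setT g ->
    (forall a, 0 <= a -> `|g a| <= 1) ->
    (forall N a, 0 <= a -> `|g a - \sum_(n < N) a ^+ n / n`!%:R * q n| <=
      C ^+ N * (a ^+ N / N`!%:R)) ->
    \sum_(n < N) c n * q n @[N --> \oo] --> \int[P]_t g (A t).
  move=> mg g1 grem.
  have igA : P.-integrable setT (EFin \o (fun t => g (A t))).
    apply: (@integrable_prob_bounded _ _ _ _ _ 1) => [|t]; last exact: g1.
    exact: measurableT_comp.
  have [isum Esum] : (forall N, P.-integrable setT (EFin \o (fun t =>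
        \sum_(n < N) q n / n`!%:R * A t ^+ n))) /\
      forall N, \int[P]_t (\sum_(n < N) q n / n`!%:R * A t ^+ n) = \sum_(n < N) c n * q n.
    have i1 n : P.-integrable setT (EFin \o (fun t => q n / n`!%:R * A t ^+ n)).
      by apply: integrable_mulZl => //; have [] := laplace_moment n.
    split=> N; have [h1 h2] := @Rintegral_sum_nat _ _ _ P _ N (fun n _ => i1 n).
      exact: h1.
    rewrite h2; apply: eq_bigr => n _; have [i2 e2] := laplace_moment n.
    rewrite RintegralZl// e2; field.
    by rewrite pnatr_eq0 -lt0n fact_gt0.
  apply/cvgrPdist_le => e e0; have := cC => /cvgrPdist_le /(_ _ e0).
  apply: filterS => N; rewrite sub0r normrN => hN.
  rewrite -Esum -RintegralB//; apply: le_trans (le_trans (ler_norm _) hN).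
  have -> : c N * C ^+ N = \int[P]_t (C ^+ N / N`!%:R * A t ^+ N).
    have [i1 e1] := laplace_moment N; rewrite RintegralZl// e1; field.
    by rewrite pnatr_eq0 -lt0n fact_gt0.
  apply: normr_Rintegral_le => //.
  - by apply: measurable_funB; [exact: integrable_measurable igA|exact: integrable_measurable (isum N)].
  - move=> t _; have := grem N (A t) (A_ge0 t).
    rewrite mulrA [in leRHS]mulrAC => h; apply: le_trans h.
    rewrite le_eqVlt; apply/orP; left; apply/eqP; congr (`|_ - _|); apply: eq_bigr => n _.
    by rewrite mulrC mulrA mulrAC.
  - by apply: integrable_mulZl => //; have [] := laplace_moment N.
have e1 a : 0 <= a -> `|expR (- zr * a)| <= 1.
  by move=> a0; rewrite ger0_norm ?expR_ge0// -expR0 ler_expR mulNr oppr_le0 mulr_ge0.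
have me : measurable_fun setT (fun a : R => expR (- zr * a)).
  by apply: (measurableT_comp (@measurable_expR R)); exact: measurable_funM.
split.
- apply: (main (fun a : R => expR (- zr * a) * cos (zi * a)) (fun n => (cpow (- zr) (- zi) n).1)).
  + apply: measurable_funM => //; apply: (measurableT_comp (@measurable_cosR R setT)).
    exact: measurable_funM.
  + by move=> a a0; rewrite normrM -[leRHS]mulr1; apply: ler_pM => //; [exact: e1|exact: normr_cos_le1].
  + by move=> N a a0; have [] := exp_rem_bound zi zr0 N a0.
- apply: (main (fun a : R => - (expR (- zr * a) * sin (zi * a))) (fun n => (cpow (- zr) (- zi) n).2)).
  + apply: measurableT_comp => //.
    apply: measurable_funM => //; apply: (measurableT_comp (@measurable_sinR R setT)).
    exact: measurable_funM.
  + by move=> a a0; rewrite normrN normrM -[leRHS]mulr1; apply: ler_pM => //; [exact: e1|exact: normr_sin_le1].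
  + by move=> N a a0; have [] := exp_rem_bound zi zr0 N a0.
Qed.

End laplace_moments.

(** * Conditioning on the independent random scale *)

Section independent_pair.
Context (R : realType) (d : measure_display) (T : measurableType d).
Variables (P : probability T R) (A Y : T -> R).
Hypothesis mA : measurable_fun setT A.
Hypothesis mY : measurable_fun setT Y.
Hypothesis indep : forall B C : set R, measurable B -> measurable C ->
  P (A @^-1` B `&` Y @^-1` C) = (P (A @^-1` B) * P (Y @^-1` C))%E.

(** The law of the pair agrees with the product of the laws on rectangles, hence everywhere; Tonelli
    then separates the variables. *)
Lemma ge0_integral_indep (F : R * R -> \bar R) : measurable_fun setT F ->
  (forall z, 0%R <= F z)%E ->
  (\int[P]_w F (A w, Y w) = \int[P]_w \int[P]_w' F (A w, Y w'))%E.
Proof.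
move=> mF F0.
pose A' : {mfun T >-> R} := HB.pack A (isMeasurableFun.Build _ _ _ _ A mA).
pose Y' : {mfun T >-> R} := HB.pack Y (isMeasurableFun.Build _ _ _ _ Y mY).
have mAY : measurable_fun setT (fun w => (A w, Y w)) by exact: measurable_fun_pair.
pose Z' : {mfun T >-> (R * R)%type} := HB.pack (fun w => (A w, Y w))
  (isMeasurableFun.Build _ _ _ _ (fun w => (A w, Y w)) mAY).
transitivity (\int[distribution P Z']_z F z)%E.
  by rewrite ge0_integral_pushforward.
transitivity (\int[distribution P A' \x distribution P Y']_z F z)%E.
  apply: eq_measure_integral => X mX _; apply/esym.
  by apply: product_measure_unique => // B C mB mC; exact: indep.
rewrite fubini_tonelli1// ge0_integral_pushforward//.
- apply: eq_integral => w _; rewrite /= /fubini_F ge0_integral_pushforward//.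
  by apply: measurableT_comp => //; exact: measurable_pair1.
- exact: measurable_fun_fubini_tonelli_F.
- by move=> y _; exact: integral_ge0.
Qed.

Lemma Rintegral_indep (F : R * R -> R) : measurable_fun setT F ->
  (forall z, `|F z| <= 1) ->
  \int[P]_w F (A w, Y w) = \int[P]_w \int[P]_w' F (A w, Y w').
Proof.
move=> mF F1.
have mAY : measurable_fun setT (fun w => F (A w, Y w)).
  by apply: measurableT_comp => //; exact: measurable_fun_pair.
have mFw w : measurable_fun setT (fun w' => F (A w, Y w')).
  by apply: measurableT_comp => //; exact: measurable_fun_pair.
have iF : P.-integrable setT (EFin \o (fun w => F (A w, Y w))).
  exact: (@integrable_prob_bounded _ _ _ _ _ 1).
have iFw w : P.-integrable setT (EFin \o (fun w' => F (A w, Y w'))).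
  exact: (@integrable_prob_bounded _ _ _ _ _ 1).
have icst : P.-integrable setT (EFin \o cst (1 : R)) by exact: finite_measure_integrable_cst.
have i1F (G : T -> R * R) : measurable_fun setT (F \o G) ->
    P.-integrable setT (EFin \o (fun w => 1 + F (G w))).
  move=> mG; apply: (@integrable_prob_bounded _ _ _ _ _ 2) => [|w].
    exact: measurable_funD.
  by apply: (le_trans (ler_normD _ _)); rewrite normr1; have := F1 (G w); lra.
(* F is bounded by 1, so 1 + F is nonnegative and the previous lemma applies; the constant cancels
   at the end. *)
have F1' z : (0%R <= (1 + F z)%:E)%E.
  by rewrite lee_fin; have := F1 z; rewrite ler_norml; lra.
have mF1 : measurable_fun setT (fun z => (1 + F z)%:E).
  by apply/measurable_EFinP; exact: measurable_funD.
have E := ge0_integral_indep mF1 F1'.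
have inner w : (\int[P]_w' (1 + F (A w, Y w'))%:E)%E = (1 + \int[P]_w' F (A w, Y w'))%:E.
  rewrite -[LHS]fineK; last first.
    by apply: integrable_fin_num => //; exact: (i1F _ (mFw w)).
  by congr EFin; rewrite -[LHS]/(\int[P]_w' (1 + F (A w, Y w'))) RintegralD// Rintegral_prob_cst.
have outer : (\int[P]_w (1 + F (A w, Y w))%:E)%E = (1 + \int[P]_w' F (A w', Y w'))%:E.
  rewrite -[LHS]fineK; last first.
    by apply: integrable_fin_num => //; exact: (i1F _ mAY).
  by congr EFin; rewrite -[LHS]/(\int[P]_w' (1 + F (A w', Y w'))) RintegralD// Rintegral_prob_cst.
have mI : measurable_fun setT (fun w => \int[P]_w' F (A w, Y w')).
  rewrite (_ : (fun w => _) = (fun w => fine (\int[P]_w' (1 + F (A w, Y w'))%:E)%E - 1)); last first.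
    by apply/funext => w; rewrite inner/= addrC addKr.
  apply: measurable_funB => //; apply: measurableT_comp => //.
  apply: (@measurable_fun_fubini_tonelli_F _ _ _ _ _ P (fun z : T * T => (1 + F (A z.1, Y z.2))%:E)) => //.
  apply/measurable_EFinP; apply: measurable_funD => //; apply: measurableT_comp => //.
  by apply: measurable_fun_pair; apply: measurableT_comp.
have iI : P.-integrable setT (EFin \o (fun w => \int[P]_w' F (A w, Y w'))).
  by apply: (@integrable_prob_bounded _ _ _ _ _ 1) => // w; exact: normr_expect_le.
move: E; rewrite outer; under eq_integral do rewrite inner.
move=> /(congr1 fine); rewrite -[X in _ = X]/(\int[P]_w (1 + \int[P]_w' F (A w, Y w'))).
by rewrite RintegralD// Rintegral_prob_cst/= => /addrI.
Qed.

End independent_pair.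

Section subordinated_lfsm.
Context (R : realType) (d : measure_display) (T : measurableType d).
Variables (P : probability T R) (delta rho H : R) (M : set R -> T -> R).
Variables (Y : R -> T -> R) (A : T -> R).
Hypothesis delta_gt0 : 0 < delta.
Hypothesis delta_le2 : delta <= 2.
Hypothesis H_gt0 : 0 < H.
Hypothesis srm : stable_random_measure P delta rho M.
Hypothesis lfsm : is_lfsm P M delta H Y.
Hypothesis mA : measurable_fun setT A.
Hypothesis A_ge0 : forall w, 0 <= A w.
Hypothesis indep : indep_rv_process P A Y.

Lemma measurable_subordinated (t : R) : 0 <= t ->
  measurable_fun setT (fun w => A w `^ delta^-1 * Y t w).
Proof.
move=> t0; apply: measurable_funM; last exact: (measurable_lfsm delta_gt0 H_gt0 lfsm).
exact: (measurableT_comp (measurable_powR delta^-1) mA).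
Qed.

Lemma indep_at (t : R) : 0 <= t -> forall B C : set R, measurable B -> measurable C ->
  P (A @^-1` B `&` Y t @^-1` C) = (P (A @^-1` B) * P (Y t @^-1` C))%E.
Proof.
move=> t0 B C mB mC; have := @indep 1 (fun=> t) B (fun=> C) (fun=> t0) mB (fun=> mC).
have -> // : \bigcap_(i in [set: 'I_1]) (Y t @^-1` C) = Y t @^-1` C.
by apply/seteqP; split => w h; [exact: (h ord0 I)|move=> i _; exact: h].
Qed.

(** With A fixed, the scale A^(1/delta) multiplies p, and homogeneity of the symbol turns it into a
    factor A in the exponent. *)
Lemma subordinated_char (t p : R) : 0 < t ->
  let zr := t `^ (delta * H) * psiRe delta p in
  let zi := t `^ (delta * H) * psiIm delta (rho * lfsm_skewness delta H) p in
  \int[P]_w cos (p * (A w `^ delta^-1 * Y t w)) =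
    \int[P]_w (expR (- zr * A w) * cos (zi * A w)) /\
  \int[P]_w sin (p * (A w `^ delta^-1 * Y t w)) =
    \int[P]_w (- (expR (- zr * A w) * sin (zi * A w))).
Proof.
move=> t0 zr zi; have mYt := measurable_lfsm delta_gt0 H_gt0 lfsm (ltW t0).
have mF (h : R -> R) : measurable_fun setT h ->
    measurable_fun setT (fun z : R * R => h (p * (z.1 `^ delta^-1 * z.2))).
  move=> mh; apply: measurableT_comp => //; apply: measurable_funM => //.
  apply: measurable_funM => //.
  by apply: (measurableT_comp (measurable_powR delta^-1)).
have Ar w : A w `^ delta^-1 `^ delta = A w by rewrite -powRrM mulVf ?gt_eqF// powRr1.
have zrE w : t `^ (delta * H) * psiRe delta (p * A w `^ delta^-1) = zr * A w.
  by rewrite psiReM ger0_norm ?powR_ge0// Ar mulrA.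
have ziE w : t `^ (delta * H) * psiIm delta (rho * lfsm_skewness delta H) (p * A w `^ delta^-1) =
    zi * A w.
  by rewrite psiImM spow_ge0 ?powR_ge0// ger0_norm ?powR_ge0// Ar mulrA.
split.
- rewrite (Rintegral_indep mA mYt (indep_at (ltW t0)) (mF _ (@measurable_cosR R setT))); last first.
    by move=> z; exact: normr_cos_le1.
  apply: eq_Rintegral => w _ /=; under eq_Rintegral do rewrite mulrA.
  have [-> _] := lfsm_char delta_gt0 delta_le2 H_gt0 srm lfsm (p * A w `^ delta^-1) t0.
  by rewrite zrE ziE mulNr.
- rewrite (Rintegral_indep mA mYt (indep_at (ltW t0)) (mF _ (@measurable_sinR R setT))); last first.
    by move=> z; exact: normr_sin_le1.
  apply: eq_Rintegral => w _ /=; under eq_Rintegral do rewrite mulrA.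
  have [_ ->] := lfsm_char delta_gt0 delta_le2 H_gt0 srm lfsm (p * A w `^ delta^-1) t0.
  by rewrite zrE ziE mulNr.
Qed.

Lemma subordinated_init : {ae P, forall w, A w `^ delta^-1 * Y 0 w = 0}.
Proof.
have := lfsm_init delta_gt0 delta_le2 H_gt0 srm lfsm.
by apply: filterS => w ->; rewrite mulr0.
Qed.

End subordinated_lfsm.

(** * Integrability of the kernel and convergence of the series *)

Section kernel_hypotheses.
Variables (R : realType) (k : R -> R -> R) (beta eps : R).
Local Notation leb := (@lebesgue_measure R).

(** On an interval of finite length, |k| <= 1 + |k|^(1+eps). *)
Lemma in_L1eps_integrable : 0 < eps -> in_L1eps k eps ->
  leb.-integrable `]0, 1[ (EFin \o k 1).
Proof.
move=> e0 [mk fin].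
have mp : measurable_fun (`]0, 1[ : set R) (fun s => `|k 1 s| `^ (1 + eps)).
  have mn := measurableT_comp (@normr_measurable R setT) mk.
  exact: (measurableT_comp (measurable_powR (1 + eps)) mn).
have ip : leb.-integrable `]0, 1[ (EFin \o (fun s => `|k 1 s| `^ (1 + eps))).
  apply/integrableP; split; first exact/measurable_EFinP.
  by under eq_integral do rewrite /= ger0_norm ?powR_ge0//.
have i1 : leb.-integrable `]0, 1[ (EFin \o cst (1 : R)).
  apply/integrableP; split; first exact/measurable_EFinP.
  under eq_integral do rewrite /= normr1.
  have l1 : leb (`]0%R, 1%R[ : set R) = 1%E.
    by rewrite lebesgue_measure_itv/= lte_fin ltr01 oppr0 adde0.
  by rewrite integral_cst// mul1e [X in (X < _)%E]l1 ltry.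
apply: (@integrable_dominated _ _ _ leb _ _ (fun s => 1 + `|k 1 s| `^ (1 + eps))) => //.
  move=> s _; have [s1|s1] := leP `|k 1 s| 1.
    by rewrite (le_trans s1)// lerDl powR_ge0.
  rewrite (@le_trans _ _ (`|k 1 s| `^ (1 + eps)))// ?lerDr//.
  rewrite -[leLHS]powRr1//; apply: ler_powR; first exact: ltW.
  by rewrite lerDl ltW.
exact: integrable_add.
Qed.

Hypothesis Phi_cvg : forall x : R, 0 < x -> cvg (Phi_partial k beta (- x) @ \oo).

(** Convergence at -x bounds the terms there; as r <= x/2, the terms at radius r are dominated by a
    geometric series. The summand 1 in x = 2r + 1 keeps x positive when r = 0. *)
Lemma chat_summable (r : R) : 0 <= r ->
  exists S, forall N, \sum_(n < N) `|chat k beta n| * r ^+ n <= S.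
Proof.
move=> r0; pose x := 2 * r + 1.
have x0 : 0 < x by rewrite ltr_wpDl// mulr_ge0.
have cs : cvg (series (fun n => chat k beta n * (- x) ^+ n) @ \oo).
  have := Phi_cvg x0; rewrite (_ : Phi_partial k beta (- x) = series (fun n => chat k beta n * (- x) ^+ n))//.
  by apply/funext => N; rewrite /series /= /Phi_partial big_mkord.
have [B [_ hB]] := cvg_series_bounded cs.
pose B1 := `|B| + 1.
have bound n : `|chat k beta n| * x ^+ n <= B1.
  have := hB B1 (le_lt_trans (ler_norm _) (ltr_pwDr ltr01 (lexx _))) n I.
  by rewrite /= normrM normrX normrN (gtr0_norm x0).
have B10 : 0 <= B1 by rewrite addr_ge0.
exists (B1 * 2) => N.
apply: (@le_trans _ _ (\sum_(n < N) B1 * 2^-1 ^+ n)).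
  apply: ler_sum => n _.
  apply: (@le_trans _ _ (`|chat k beta n| * (x / 2) ^+ n)).
    apply: ler_wpM2l => //; apply: lerXn2r; rewrite ?nnegrE//.
      by rewrite divr_ge0 ?ltW.
    by rewrite /x; lra.
  by rewrite exprMn mulrA; apply: ler_wpM2r => //; rewrite exprn_ge0 ?invr_ge0.
rewrite -mulr_sumr; apply: ler_wpM2l => //.
have E n : \sum_(i < n) (2^-1 : R) ^+ i = 2 - 2 * 2^-1 ^+ n.
  elim: n => [|n IH]; first by rewrite big_ord0 expr0 mulr1 subrr.
  by rewrite big_ord_recr/= IH exprS; field.
by rewrite E gerBl mulr_ge0// exprn_ge0 ?invr_ge0.
Qed.

Lemma Phi_partial0_cvg : Phi_partial k beta 0 @ \oo --> (1 : R).
Proof.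
(* The partial sums at 0 equal 1 from N = 1 on; the empty one is 0. *)
apply: cvg_near_cst; exists 1%N => // -[//|N] _; rewrite /Phi_partial big_ord_recl/=.
by rewrite expr0 mulr1 big1 ?addr0// => i _; rewrite /bump/= expr0n/= mulr0.
Qed.

Lemma Phihat_cvg (x : R) : 0 <= x ->
  Phi_partial k beta (- x) @ \oo --> Phihat k beta (- x).
Proof.
rewrite le_eqVlt => /predU1P[<-|x0]; last exact: Phi_cvg.
by rewrite oppr0 /Phihat (cvg_lim _ Phi_partial0_cvg)//; exact: Phi_partial0_cvg.
Qed.

End kernel_hypotheses.

(** * The two cases: identifying the power series at each time *)

Lemma psiIm0 (R : realType) (delta p : R) : psiIm delta 0 p = 0.
Proof. by rewrite /psiIm mulr0 !mul0r oppr0. Qed.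

Lemma cpow_real (R : realType) (x : R) (n : nat) : cpow x 0 n = (x ^+ n, 0).
Proof. by elim: n => [//|n /= ->]; rewrite exprS !mulr0 mul0r subr0 addr0. Qed.

Lemma powR_mulM (R : realType) (s beta : R) (n : nat) :
  s `^ (beta * n%:R) = (s `^ beta) ^+ n.
Proof. by rewrite powRrM powR_mulrn ?powR_ge0. Qed.

Theorem theorem5p1 (R : realType) (k : R -> R -> R) (beta eps : R) :
  0 < beta < 2 ->
  kernel_measurable k -> homogeneous k beta ->
  0 < eps -> in_L1eps k eps ->
  (forall x : R, 0 < x -> cvg (Phi_partial k beta (- x) @ \oo)) ->
  completely_monotone (fun x => Phihat k beta (- x)) ->
  (* (i) *)
  (forall gamma delta : R,
     beta < gamma <= 2 -> gamma <= delta <= 2 -> delta != gamma / beta ->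
     forall (d : measure_display) (T : measurableType d) (P : probability T R)
       (M : set R -> T -> R) (Y : R -> T -> R) (A : T -> R),
       stable_random_measure P delta 0 M ->
       is_lfsm P M delta (beta / gamma) Y ->
       nonneg_rv_laplace P A (fun x => Phihat k beta (- x `^ (gamma / delta))) ->
       indep_rv_process P A Y ->
       stochastic_solution P (fun t w => A w `^ (delta^-1) * Y t w)
         (Lbar gamma 0) k)
  /\
  (* (ii) *)
  (beta != 1 ->
   forall delta rho : R,
     beta < delta <= 2 -> delta != 1 -> -1 <= rho <= 1 ->
     forall (d : measure_display) (T : measurableType d) (P : probability T R)
       (M : set R -> T -> R) (Y : R -> T -> R) (A : T -> R),
       stable_random_measure P delta rho M ->
       is_lfsm P M delta (beta / delta) Y ->
       nonneg_rv_laplace P A (fun x => Phihat k beta (- x)) ->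
       indep_rv_process P A Y ->
       stochastic_solution P (fun t w => A w `^ (delta^-1) * Y t w)
         (Lbar delta (rho0 delta beta rho)) k).
Proof.
move=> /andP[b0 b2] _ hom e0 inL Phi_cvg _.
have intk := in_L1eps_integrable e0 inL.
have sumc := chat_summable Phi_cvg.
split.
- move=> gamma delta /andP[bg g2] /andP[gd d2] _ d T P M Y A srm lfsm [mA [A0 lap]] ind.
  have g0 : 0 < gamma := lt_trans b0 bg.
  have d0 : 0 < delta := lt_le_trans g0 gd.
  have H0 : 0 < beta / gamma by rewrite divr_gt0.
  split; first exact: (subordinated_init A d0 d2 H0 srm lfsm).
  (* The transform is prescribed for x > 0; the value x = 0 occurs at p = 0, where both sides are
     1. *)
  have lap0 (x : R) : 0 <= x ->
      \int[P]_w expR (- (x * A w)) = Phihat k beta (- (x `^ (gamma / delta))).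
    rewrite le_eqVlt => /predU1P[<-|x0]; last exact: lap.
    rewrite powR0; last by rewrite gt_eqF// divr_gt0.
    rewrite oppr0 /Phihat (cvg_lim _ (@Phi_partial0_cvg _ k beta))//.
    rewrite -[RHS](Rintegral_prob_cst P); apply: eq_Rintegral => w _.
    by rewrite mul0r oppr0 expR0.
  move=> u0 su0; apply: (expect_solves b0 g0 g2 hom intk sumc) => //.
  + by move=> s s0; exact: (measurable_subordinated d0 H0 lfsm mA (ltW s0)).
  + move=> s p s0; have [-> _] := subordinated_char d0 d2 H0 srm lfsm mA A0 ind p s0.
    rewrite mul0r !psiIm0 mulr0 oppr0.
    set x := s `^ (delta * (beta / gamma)) * psiRe delta p.
    have x0 : 0 <= x by rewrite mulr_ge0// powR_ge0.
    (* The power gamma/delta turns s^(delta beta / gamma) into s^beta and |p|^delta into |p|^gamma: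
       here the order of the operator passes from delta to gamma. *)
    have xE : x `^ (gamma / delta) = s `^ beta * psiRe gamma p.
      rewrite /x powRM ?powR_ge0// /psiRe -!powRrM; congr (_ `^ _ * _ `^ _); field.
        by rewrite !gt_eqF.
      by rewrite gt_eqF.
    have -> : \int[P]_w (expR (- x * A w) * cos (0 * A w)) =
        Phihat k beta (- (s `^ beta * psiRe gamma p)).
      rewrite -xE -lap0//; apply: eq_Rintegral => w _.
      by rewrite mul0r cos0 mulr1 mulNr.
    have y0 : 0 <= s `^ beta * psiRe gamma p by rewrite mulr_ge0// powR_ge0.
    rewrite (_ : (fun N => _) = Phi_partial k beta (- (s `^ beta * psiRe gamma p))).
      exact: Phihat_cvg.
    apply/funext => N; rewrite /Phi_partial; apply: eq_bigr => n _.
    by rewrite cpow_real/= powR_mulM -mulrA -exprMn mulrN.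
  (* The sine parts vanish on both sides: the symbol is real and the process symmetric. *)
  + move=> s p s0; have [_ ->] := subordinated_char d0 d2 H0 srm lfsm mA A0 ind p s0.
    rewrite mul0r !psiIm0 mulr0 oppr0.
    rewrite (_ : (fun N => _) = cst 0); last first.
      by apply/funext => N; rewrite big1// => n _; rewrite cpow_real mulr0.
    under eq_Rintegral do rewrite mul0r sin0 mulr0 oppr0.
    by rewrite Rintegral_prob_cst; exact: cvg_cst.
- move=> bn1 delta rho /andP[bd d2] _ _ d T P M Y A srm lfsm [mA [A0 lap]] ind.
  have d0 : 0 < delta := lt_trans b0 bd.
  have H0 : 0 < beta / delta by rewrite divr_gt0.
  (* With H = beta/delta the conditional exponent is A s^beta times the symbol of skewness [rho0],
     so the series in question has argument - s^beta psi(p). *)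
  have dH : delta * (beta / delta) = beta by rewrite mulrC divfK// gt_eqF.
  have sk := lfsm_skewnessE d0 d2 b0 srm lfsm bn1.
  split; first exact: (subordinated_init A d0 d2 H0 srm lfsm).
  have laplace (x : R) : 0 < x -> \sum_(n < N) chat k beta n * (- x) ^+ n @[N --> \oo] -->
      \int[P]_t expR (- (x * A t)).
    move=> x0; have -> : \int[P]_t expR (- (x * A t)) = Phihat k beta (- x) := lap x x0.
    by apply: (Phihat_cvg Phi_cvg); exact: ltW.
  have zr0 s p : 0 <= s `^ beta * psiRe delta p by rewrite mulr_ge0// powR_ge0.
  move=> u0 su0; apply: (expect_solves b0 d0 d2 hom intk sumc) => //.
  + by move=> s s0; exact: (measurable_subordinated d0 H0 lfsm mA (ltW s0)).
  + move=> s p s0; have [-> _] := subordinated_char d0 d2 H0 srm lfsm mA A0 ind p s0.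
    rewrite dH sk.
    rewrite (_ : (fun N => _) = (fun N => \sum_(n < N) chat k beta n *
        (cpow (- (s `^ beta * psiRe delta p))
          (- (s `^ beta * psiIm delta (rho0 delta beta rho) p)) n).1)).
      by have [] := laplace_complex mA A0 sumc laplace
        (s `^ beta * psiIm delta (rho0 delta beta rho) p) (zr0 s p).
    apply/funext => N; apply: eq_bigr => n _.
    have [e _] := cpow_scale (s `^ beta) (- psiRe delta p) (- psiIm delta (rho0 delta beta rho) p) n.
    by rewrite powR_mulM -mulrA -e !mulrN.
  + move=> s p s0; have [_ ->] := subordinated_char d0 d2 H0 srm lfsm mA A0 ind p s0.
    rewrite dH sk.
    rewrite (_ : (fun N => _) = (fun N => \sum_(n < N) chat k beta n *
        (cpow (- (s `^ beta * psiRe delta p))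
          (- (s `^ beta * psiIm delta (rho0 delta beta rho) p)) n).2)).
      by have [] := laplace_complex mA A0 sumc laplace
        (s `^ beta * psiIm delta (rho0 delta beta rho) p) (zr0 s p).
    apply/funext => N; apply: eq_bigr => n _.
    have [_ e] := cpow_scale (s `^ beta) (- psiRe delta p) (- psiIm delta (rho0 delta beta rho) p) n.
    by rewrite powR_mulM -mulrA -e !mulrN.
Qed.
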